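(* Let $X$ be an $\omega$-category. For $x\in\Phi_n[(\lambda X)_n]$ put $A(x)=x(I^n)\in X$. These functions are compatible with the maps $\varepsilon_1:\Phi_n[(\lambda X)_n]\to\Phi_{n+1}[(\lambda X)_{n+1}]$ and induce a function $A:\gamma\lambda X\to X$. Then $A:\gamma\lambda X\to X$ is a natural isomorphism of $\omega$-categories.
   Context: An $\omega$-category is a set $X$ with unary operations $d^-_p,d^+_p$ and partial binary operations $\#_p$ ($p=0,1,2,\dots$) such that: (i) $x\#_p y$ is defined iff $d^+_px=d^-_py$; (ii) $d^\beta_qd^\alpha_px=d^\beta_qx$ for $q<p$ and $=d^\alpha_px$ for $q\ge p$; (iii) if $x\#_py$ is defined then $d^-_p(x\#_py)=d^-_px$, $d^+_p(x\#_py)=d^+_py$, $d^\beta_q(x\#_py)=d^\beta_qx\#_pd^\beta_qy$ for $q\ne p$; (iv) $d^-_px\#_px=x\#_pd^+_px=x$; (v) $\#_p$ is associative; (vi) for $p\neq q$, $(x\#_py)\#_q(x'\#_py')=(x\#_qx')\#_p(y\#_qy')$ whenever both sides are defined; (vii) every $x$ has a dimension $\dim x$ with $d^\alpha_px=x$ iff $p\ge\dim x$. An $\omega$-category of sets is one whose elements are sets and in which $x\#_py=x\cup y$. Cubical $\omega$-categories with connections: sets $G_n$ with faces $\partial^\alpha_i:G_n\to G_{n-1}$, degeneracies $\varepsilon_i:G_{n-1}\to G_n$, connections $\Gamma^\alpha_i:G_n\to G_{n+1}$ ($1\le i\le n$) and compositions $\circ_j$ ($1\le j\le n$) on $G_n$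 (with $a\circ_jb$ defined iff $\partial^+_ja=\partial^-_jb$), satisfying the standard cubical, connection, interchange and transport identities; in particular each $\circ_j$ is a category structure with identities $\varepsilon_jy$. Folding operations: $\psi_ix=\Gamma^+_i\partial^-_{i+1}x\circ_{i+1}x\circ_{i+1}\Gamma^-_i\partial^+_{i+1}x$ ($1\le i\le n-1$), $\Psi_r=\psi_{r-1}\cdots\psi_1$, $\Phi_m=\Psi_1\Psi_2\cdots\Psi_m$. Cubes: $I=[0,1]$; a cell of $I^n$ is a product $\sigma_1\times\dots\times\sigma_n$ with $\sigma_i\in\{\{0\},\{1\},[0,1]\}$, of dimension the number of factors $[0,1]$; listing these as $e_1,\dots,e_q$, replacing $e_j$ by $\{0\}$ gives a negative face for $j$ odd and positive for $j$ even, replacing by $\{1\}$ the reverse. $M(I^n)$ is the $\omega$-category of sets of subsets of $I^n$ presented by the cells as generators, with relations $d^\pm_q\sigma=\sigma$ for $\dim\sigma=q$ and, for $q>0$, $d^-_{q-1}\sigma$, $d^+_{q-1}\sigma$ the unions of the negative, resp. positive, faces. Analogously $M(I^{i-1}\times[0,2]\times I^{n-i})$ with the directed path $\{0\}\to\{1\}\to\{2\}$ in the $i$th factor. Morphisms: $\check\partial^\alpha_i:M(I^{n-1})\to M(I^n)$ inserts $\{0\}$ ($\alpha=-$) or $\{1\}$ ($\alpha=+$) as $i$th factor of a cell; $\check\varepsilon_i:M(I^n)\to M(I^{n-1})$ deletes the $i$th factor; $\check\Gamma^\alpha_i:M(I^n)\to M(I^{n-1})$ replaces factors $\sigma_i\times\sigma_{i+1}$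 by one factor $c$, where for $\alpha=+$: $c=\{0\}$ if one of them is $\{0\}$, $\{1\}$ if both are $\{1\}$, else $[0,1]$; for $\alpha=-$: $c=\{1\}$ if one of them is $\{1\}$, $\{0\}$ if both are $\{0\}$, else $[0,1]$; $\check\iota^\mp_i:M(I^n)\to M(I^{i-1}\times[0,2]\times I^{n-i})$ keep the $i$th factor, resp. translate it by $1$, and exhibit the target as the push-out of $\check\partial^+_i,\check\partial^-_i$; $\check\mu_i$ replaces the $i$th factor via $\{0\}\mapsto\{0\},[0,1]\mapsto[0,2],\{1\}\mapsto\{2\}$. $\lambda X$: $(\lambda X)_n=\mathrm{Hom}(M(I^n),X)$ with $\partial^\alpha_ix=x\check\partial^\alpha_i$, $\varepsilon_ix=x\check\varepsilon_i$, $\Gamma^\alpha_ix=x\check\Gamma^\alpha_i$, $x\circ_iy=[x,y]\check\mu_i$ where $[x,y]\check\iota^-_i=x$, $[x,y]\check\iota^+_i=y$. $\gamma G$: $\Phi_n(G_n)$ is an $\omega$-category with $d^\alpha_px=\varepsilon_1^{n-p}(\partial^\alpha_1)^{n-p}x$, $x\#_py=x\circ_{n-p}y$ for $0\le p<n$, and $d^\alpha_px=x$, only composites $x\#_px=x$, for $p\ge n$; $\gamma G$ is the colimit of $\Phi_0(G_0)\xrightarrow{\varepsilon_1}\Phi_1(G_1)\xrightarrow{\varepsilon_1}\cdots$. *)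

(* Defs.v *)
From mathcomp Require Import all_boot.
From Stdlib Require Import ClassicalEpsilon.
Set Implicit Arguments. Unset Strict Implicit. Unset Printing Implicit Defensive.

(* omega-categories.  Signs: false = "-", true = "+".                  *)
(* The partial composition #_p is modelled by a total operation whose  *)
(* values are only constrained (and only used) when d^+_p x = d^-_p y. *)
Record omega_category := OmegaCat {
  oc_carrier :> Type;
  oc_d : bool -> nat -> oc_carrier -> oc_carrier;
  oc_comp : nat -> oc_carrier -> oc_carrier -> oc_carrier;
  oc_dd_lt : forall a b p q x, (q < p)%N -> oc_d b q (oc_d a p x) = oc_d b q x;
  oc_dd_ge : forall a b p q x, (p <= q)%N -> oc_d b q (oc_d a p x) = oc_d a p x;
  oc_d_comp_l : forall p x y, oc_d true p x = oc_d false p y ->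
      oc_d false p (oc_comp p x y) = oc_d false p x;
  oc_d_comp_r : forall p x y, oc_d true p x = oc_d false p y ->
      oc_d true p (oc_comp p x y) = oc_d true p y;
  oc_d_comp : forall b p q x y, oc_d true p x = oc_d false p y -> q <> p ->
      oc_d b q (oc_comp p x y) = oc_comp p (oc_d b q x) (oc_d b q y);
  oc_unit_l : forall p x, oc_comp p (oc_d false p x) x = x;
  oc_unit_r : forall p x, oc_comp p x (oc_d true p x) = x;
  oc_assoc : forall p x y z, oc_d true p x = oc_d false p y ->
      oc_d true p y = oc_d false p z ->
      oc_comp p (oc_comp p x y) z = oc_comp p x (oc_comp p y z);
  oc_interchange : forall p q x y x' y', p <> q ->
      oc_d true p x = oc_d false p y -> oc_d true p x' = oc_d false p y' ->
      oc_d true q (oc_comp p x y) = oc_d false q (oc_comp p x' y') ->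
      oc_d true q x = oc_d false q x' -> oc_d true q y = oc_d false q y' ->
      oc_d true p (oc_comp q x x') = oc_d false p (oc_comp q y y') ->
      oc_comp q (oc_comp p x y) (oc_comp p x' y') =
      oc_comp p (oc_comp q x x') (oc_comp q y y');
  oc_dim : forall x, exists n, forall p a, oc_d a p x = x <-> (n <= p)%N
}.

Arguments oc_d : clear implicits.
Arguments oc_comp : clear implicits.

Definition omega_functor (X Y : omega_category) (f : X -> Y) : Prop :=
  (forall a p x, f (oc_d X a p x) = oc_d Y a p (f x)) /\
  (forall p x y, oc_d X true p x = oc_d X false p y ->
     f (oc_comp X p x y) = oc_comp Y p (f x) (f y)).

(* Cells of cubes.  A cell of I^n (or of I^{i-1} x [0,2] x I^{n-i}) is *)
(* the list of its n factors.                                          *)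
(*   V0 = {0}, V1 = {1}, V2 = {2}, E01 = [0,1], E12 = [1,2].           *)
Inductive fac := V0 | V1 | V2 | E01 | E12.

Definition isE (f : fac) : bool := match f with E01 | E12 => true | _ => false end.
Definition lowf (f : fac) : fac := match f with E01 => V0 | E12 => V1 | g => g end.
Definition highf (f : fac) : fac := match f with E01 => V1 | E12 => V2 | g => g end.

Definition cell := seq fac.
Definition cdim (c : cell) : nat := count isE c.
Definition cset := cell -> Prop.

(* t is a codimension-one face of c of sign a: the k-th factor of c,  *)
(* which is the j-th interval factor (j = 1 + #interval factors before *)
(* k), is replaced by its lower endpoint (negative iff j odd) or upper *)
(* endpoint (positive iff j odd).                                      *)
Definition face1 (a : bool) (t c : cell) : Prop :=
  exists k, (k < size c)%N /\ isE (nth V0 c k) /\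
    ((t = set_nth V0 c k (lowf (nth V0 c k)) /\ odd (count isE (take k c)) = a)
  \/ (t = set_nth V0 c k (highf (nth V0 c k)) /\ odd (count isE (take k c)) = ~~ a)).

Definition le_cell (t c : cell) : Prop :=
  size t = size c /\ forall k, nth V0 t k = nth V0 c k \/
    (isE (nth V0 c k) /\ (nth V0 t k = lowf (nth V0 c k) \/ nth V0 t k = highf (nth V0 c k))).

(* the generator sigma, as a set: all faces of sigma *)
Definition cl_cell (c : cell) : cset := fun t => le_cell t c.
Definition bd_cell (a : bool) (c : cell) : cset := fun t => exists r, face1 a r c /\ le_cell t r.
Definition cunion (x y : cset) : cset := fun t => x t \/ y t.

(* The omega-category of sets M(K) presented by the cells of K, with  *)
(* relations d^{+-}_q sigma = sigma (q = dim sigma) and               *)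
(* d^{+-}_{q-1} sigma = union of the negative/positive faces.          *)
(* Mol K x : x is an element;  Bd K a p x y : y = d^a_p x.  These are  *)
(* generated by the relations together with the omega-category        *)
(* axioms (ii),(iii) and composition x #_p y = x \cup y.              *)
Inductive Mol (K : cell -> Prop) : cset -> Prop :=
| mol_gen : forall c, K c -> Mol K (cl_cell c)
| mol_comp : forall p x y z, Mol K x -> Mol K y -> Bd K true p x z -> Bd K false p y z ->
    Mol K (cunion x y)
| mol_bd : forall a p x y, Bd K a p x y -> Mol K y
with Bd (K : cell -> Prop) : bool -> nat -> cset -> cset -> Prop :=
| bd_gen_top : forall a p c, K c -> (cdim c <= p)%N -> Bd K a p (cl_cell c) (cl_cell c)
| bd_gen_face : forall a c, K c -> (0 < cdim c)%N ->
    Bd K a (cdim c).-1 (cl_cell c) (bd_cell a c)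
| bd_dd_lt : forall a b p q x y z, Bd K a p x y -> Bd K b q y z -> (q < p)%N -> Bd K b q x z
| bd_dd_ge : forall a b p q x y, Bd K a p x y -> (p <= q)%N -> Bd K b q y y
| bd_comp_l : forall p x y z w, Mol K x -> Mol K y -> Bd K true p x z -> Bd K false p y z ->
    Bd K false p x w -> Bd K false p (cunion x y) w
| bd_comp_r : forall p x y z w, Mol K x -> Mol K y -> Bd K true p x z -> Bd K false p y z ->
    Bd K true p y w -> Bd K true p (cunion x y) w
| bd_comp_other : forall b p q x y z u v, Mol K x -> Mol K y -> Bd K true p x z ->
    Bd K false p y z -> q <> p -> Bd K b q x u -> Bd K b q y v ->
    Bd K b q (cunion x y) (cunion u v).

(* morphisms M(K) -> X, represented by functions on sets of cells whose *)
(* values off the elements of M(K) are irrelevant                       *)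
Definition hom (K : cell -> Prop) (X : omega_category) (f : cset -> X) : Prop :=
  (forall a p x y, Bd K a p x y -> f y = oc_d X a p (f x)) /\
  (forall p x y z, Mol K x -> Mol K y -> Bd K true p x z -> Bd K false p y z ->
     f (cunion x y) = oc_comp X p (f x) (f y)).

Arguments hom : clear implicits.

Definition isI (f : fac) : bool := match f with V0 | V1 | E01 => true | _ => false end.
Definition Kcube (n : nat) : cell -> Prop := fun c => size c = n /\ all isI c.
(* cells of I^{i-1} x [0,2] x I^{n-i}  (i is 1-based) *)
Definition Kcube2 (n i : nat) : cell -> Prop :=
  fun c => size c = n /\ forall k, k <> i.-1 -> isI (nth V0 c k).

Definition agree (X : omega_category) (n : nat) (f g : cset -> X) : Prop :=
  forall s, Mol (Kcube n) s -> f s = g s.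

(* Maps of cubes (positions k are 0-based; k = i-1).                   *)
Definition img (g : cell -> cell) (s : cset) : cset := fun t => exists c, s c /\ t = g c.
Definition ins (k : nat) (v : fac) (c : cell) : cell := take k c ++ v :: drop k c.
Definition del (k : nat) (c : cell) : cell := take k c ++ drop k.+1 c.
(* factor replacing sigma_i x sigma_{i+1} in Gamma^a_i (a = true: +) *)
Definition merge_fac (a : bool) (f g : fac) : fac :=
  if a then
    match f, g with
    | V0, _ | _, V0 => V0
    | V1, V1 => V1
    | _, _ => E01
    end
  else
    match f, g with
    | V1, _ | _, V1 => V1
    | V0, V0 => V0
    | _, _ => E01
    end.
Definition gam (k : nat) (a : bool) (c : cell) : cell :=
  take k c ++ merge_fac a (nth V0 c k) (nth V0 c k.+1) :: drop k.+2 c.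
(* iota^+_i : translate the i-th factor by 1 (iota^-_i is the identity on cells) *)
Definition shift_fac (f : fac) : fac :=
  match f with V0 => V1 | V1 => V2 | E01 => E12 | g => g end.
Definition iota_plus (k : nat) (c : cell) : cell := set_nth V0 c k (shift_fac (nth V0 c k)).
(* mu_i : {0} -> {0}, [0,1] -> [0,2] = [0,1] u {1} u [1,2], {1} -> {2} *)
Definition mu_fac (f g : fac) : Prop :=
  match f with
  | V0 => g = V0
  | V1 => g = V2
  | E01 => g = E01 \/ g = V1 \/ g = E12
  | _ => False
  end.
Definition mu_set (k : nat) (s : cset) : cset :=
  fun t => exists c, s c /\ size t = size c /\
    (forall j, j <> k -> nth V0 t j = nth V0 c j) /\ mu_fac (nth V0 c k) (nth V0 t k).

(* The cubical structure of lambda X (indices i are 1-based).         *)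
Section Lambda.
Variable X : omega_category.

Definition lface (i : nat) (a : bool) (x : cset -> X) : cset -> X :=
  fun s => x (img (ins i.-1 (if a then V1 else V0)) s).
Definition ldegen (i : nat) (x : cset -> X) : cset -> X :=
  fun s => x (img (del i.-1) s).
Definition lconn (i : nat) (a : bool) (x : cset -> X) : cset -> X :=
  fun s => x (img (gam i.-1 a) s).
(* x o_i y = [x,y] mu_i, where [x,y] is the morphism out of the push-out *)
Definition lcomp (n i : nat) (x y : cset -> X) : cset -> X :=
  let P := fun F : cset -> X => hom (Kcube2 n i) X F /\
      (forall s, Mol (Kcube n) s -> F s = x s) /\
      (forall s, Mol (Kcube n) s -> F (img (iota_plus i.-1) s) = y s) in
  fun s => (epsilon (inhabits x) P) (mu_set i.-1 s).

Definition psi (n i : nat) (x : cset -> X) : cset -> X :=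
  lcomp n i.+1 (lcomp n i.+1 (lconn i true (lface i.+1 false x)) x)
               (lconn i false (lface i.+1 true x)).
Fixpoint Psi (n r : nat) (x : cset -> X) : cset -> X :=
  match r with
  | 0 => x
  | r'.+1 => if r' is 0 then x else psi n r' (Psi n r' x)
  end.
Fixpoint Phi (n m : nat) (x : cset -> X) : cset -> X :=
  match m with
  | 0 => x
  | m'.+1 => Phi n m' (Psi n m'.+1 x)
  end.

Definition inPhi (n : nat) (x : cset -> X) : Prop :=
  exists y, hom (Kcube n) X y /\ agree n x (Phi n n y).

(* gamma: d^a_p x = eps_1^{n-p} (d^a_1)^{n-p} x at level n, p < n *)
Definition gd (n : nat) (a : bool) (p : nat) (x : cset -> X) : cset -> X :=
  iter (n - p) (ldegen 1) (iter (n - p) (lface 1 a) x).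
(* equality in the colimit gamma lambda X of x at level n and y at level m *)
Definition gamma_eq (n : nat) (x : cset -> X) (m : nat) (y : cset -> X) : Prop :=
  exists k, (n <= k)%N /\ (m <= k)%N /\
    agree k (iter (k - n) (ldegen 1) x) (iter (k - m) (ldegen 1) y).

Definition Acube (n : nat) (x : cset -> X) : X := x (cl_cell (nseq n E01)).
End Lambda.

(* Main.v *)
From HB Require Import structures.
Require Import Defs.
From mathcomp Require Import all_boot zify.
From Stdlib Require Import ClassicalEpsilon FunctionalExtensionality PropExtensionality.
Set Implicit Arguments. Unset Strict Implicit. Unset Printing Implicit Defensive.

(* Collapse I^n onto the n-globe by sending a cell to d^b_q of the top cell,
   where q is the number of factors after its last endpoint factor and b is the
   sign of that endpoint.  For each a in X this gives a morphism M(I^n) -> X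
   with value a on I^n which is fixed by all foldings, so A is onto.  Conversely
   psi_i x is x precomposed with a relation between cells, and the relation
   obtained for Phi_n identifies all cells with the same image in the globe; so
   the elements of Phi_n[(lambda X)_n] are exactly the morphisms obtained by
   collapsing, and they are determined by their value on I^n.

   The composite x o_i y is computed from any morphism on the subdivided cube
   restricting to x and y, provided that mu_i really maps M(I^n) to the molecules
   of the subdivided cube.  This is proved by building the subdivided cube from
   [0,2] = [0,1] #_0 [1,2] with cylinders I x - and reversal of the factors. *)

(** * Cells and their faces *)

(** [Mol] and [Bd] are only generated inductively, so nothing is known in advance about the
    boundaries of a cell in codimension two or more, and morphisms out of [M(I^n)] must be built by
    induction on the generation. Two devices serve for this. A relation between cells acts on sets
    through unions, hence respects compositions, and is a morphism once each cell has the right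
    boundaries in dimensions [cdim c] and [cdim c - 1]. A morphism into [X] is read from a unique
    code attached to every molecule, such as its image in the globe. [lcomp] picks its push-out
    morphism by choice, so every composite requires exhibiting one. For a folding both halves are
    [x] preceded by a relation, and so is the whole. For [x #_p y] the halves are unrelated
    morphisms, but they are already known to be collapses, and only collapses have to be glued.
    Cylinders add factors on the left only; reversal reaches the factors to the right of the
    subdivided one. *)

Definition fac_code (f : fac) : nat :=
  match f with V0 => 0 | V1 => 1 | V2 => 2 | E01 => 3 | E12 => 4 end.

Lemma fac_code_inj : injective fac_code.
Proof. by case; case. Qed.

HB.instance Definition _ := Equality.copy fac (inj_type fac_code_inj).

Lemma csetP (x y : cset) : (forall t, x t <-> y t) -> x = y.
Proof.
move=> xy; apply: functional_extensionality => t.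
exact: propositional_extensionality.
Qed.

Definition endp (a : bool) (f : fac) : fac := if a then highf f else lowf f.

Definition lef (f g : fac) : bool :=
  (f == g) || isE g && ((f == lowf g) || (f == highf g)).

Fixpoint leb (t c : cell) : bool :=
  match t, c with
  | [::], [::] => true
  | f :: t', g :: c' => lef f g && leb t' c'
  | _, _ => false
  end.

(** Flipping the sign after each interval factor replaces the parity count of [face1]. Subfaces are
    included, so this decides membership in the union [bd_cell a c]. *)
Fixpoint bdb (a : bool) (c t : cell) : bool :=
  match c, t with
  | g :: c', f :: t' =>
      isE g && (f == endp a g) && leb t' c' || lef f g && bdb (a (+) isE g) c' t'
  | _, _ => false
  end.

Lemma lef_refl f : lef f f.
Proof. by rewrite /lef eqxx. Qed.

Lemma lef_trans f g h : lef f g -> lef g h -> lef f h.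
Proof. by case: f; case: g; case: h. Qed.

Lemma leb_refl c : leb c c.
Proof. by elim: c => //= f c ->; rewrite lef_refl. Qed.

Lemma leb_trans c1 c2 c3 : leb c1 c2 -> leb c2 c3 -> leb c1 c3.
Proof.
elim: c1 c2 c3 => [|f1 c1 IH] [|f2 c2] [|f3 c3] //= /andP[h1 h2] /andP[h3 h4].
by rewrite (lef_trans h1 h3) (IH _ _ h2 h4).
Qed.

Lemma leb_size t c : leb t c -> size t = size c.
Proof. by elim: t c => [|f t IH] [|g c] //= /andP[_ /IH ->]. Qed.

Lemma leb_cat t1 t2 c1 c2 : size t1 = size c1 ->
  leb (t1 ++ t2) (c1 ++ c2) = leb t1 c1 && leb t2 c2.
Proof. by elim: t1 c1 => [|f t1 IH] [|g c1] //= [/IH ->]; rewrite andbA. Qed.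

Lemma bdb_size a c t : bdb a c t -> size t = size c.
Proof.
elim: c a t => [|g c IH] a [|f t] //= /orP[/andP[_ /leb_size ->] //|].
by case/andP=> _ /IH ->.
Qed.

Lemma bdb_leb a c t : bdb a c t -> leb t c.
Proof.
elim: c a t => [|g c IH] a [|f t] //= /orP[/andP[/andP[Eg /eqP->] ->]|].
  by case: a g Eg => -[].
by case/andP=> -> /IH ->.
Qed.

Lemma bdb_cdim a c t : bdb a c t -> 0 < cdim c.
Proof.
elim: c a t => [|g c IH] a [|f t] //= /orP[/andP[/andP[-> _] _] //|/andP[_ /IH h]].
by rewrite ltn_addl.
Qed.

(** The product rule for oriented boundaries: faces of the second block carry the sign twisted by
    the number of interval factors before it. *)
Lemma bdb_cat a t1 t2 c1 c2 : size t1 = size c1 ->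
  bdb a (c1 ++ c2) (t1 ++ t2) =
  bdb a c1 t1 && leb t2 c2 || leb t1 c1 && bdb (a (+) odd (cdim c1)) c2 t2.
Proof.
elim: t1 c1 a => [|f t1 IH] [|g c1] a //=; first by rewrite addbF.
move=> [e]; rewrite IH // leb_cat // oddD oddb addbA.
set A := isE g && _; set L := lef f g.
by case: A; case: L; case: (leb t1 c1); case: (leb t2 c2); case: (bdb _ c1 t1);
  case: (bdb _ c2 t2).
Qed.

Lemma le_cellE t c : le_cell t c <-> leb t c.
Proof.
have fE f g : (f = g \/ isE g /\ (f = lowf g \/ f = highf g)) <-> lef f g.
  by split; case: f; case: g => //=; first [by auto | by case=> [|[_ []]] | by case=> [|[]]].
elim: t c => [|f t IH] [|g c]; split=> //=.
- by move=> _; split=> // k; left; rewrite nth_nil.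
- by case.
- by case.
- case=> [[sz]] h; apply/andP; split; first by apply/fE; exact: (h 0).
  by apply/IH; split=> // k; exact: (h k.+1).
- case/andP=> /fE h0 /IH [sz h]; split=> /=; first by rewrite sz.
  by case.
Qed.

Lemma cl_cellE c : cl_cell c = fun t => leb t c.
Proof. by apply: csetP => t; exact: le_cellE. Qed.

Lemma face1_cons a r g c : face1 a r (g :: c) <->
  (isE g /\ r = endp a g :: c) \/
  exists r', r = g :: r' /\ face1 (a (+) isE g) r' c.
Proof.
split.
  case=> [[|k]] [] /= sz [E h].
    by left; split=> //; case: h => -[-> /=]; case: a.
  right; exists (if odd (count isE (take k c)) == a (+) isE g
             then set_nth V0 c k (lowf (nth V0 c k))
             else set_nth V0 c k (highf (nth V0 c k))).
  split.
    case: h => -[->]; rewrite oddD oddb => h.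
      by rewrite -h addbC addKb eqxx.
    have -> : a = isE g (+) ~~ odd (count isE (take k c)).
      by rewrite addbN h negbK.
    by rewrite addbAC addbb /=; case: (odd _).
  exists k; split=> //; split=> //.
  case: eqP => [e|e]; [by left|right; split=> //].
  by move/eqP: e; case: (odd _); case: (_ (+) _).
case=> [[E ->]|[r' [-> [k [sz [E h]]]]]].
  by exists 0; split=> //; split=> //; case: a; [right|left].
exists k.+1; split=> //; split=> //=.
case: h => -[->]; rewrite oddD oddb => ->; [left|right]; split=> //.
  by rewrite addbC -addbA addbb addbF.
by rewrite addbN addbC -addbA addbb addbF.
Qed.

Lemma bd_cellE a c : bd_cell a c = fun t => bdb a c t.
Proof.
apply: csetP => t; elim: c a t => [|g c IH] a t.
  split; last by case: t.
  by case=> r [[k []]].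
split.
  case=> r [/face1_cons[[E ->]|[r' [-> fr']]]] /le_cellE; case: t => [|f t] //= /andP[h1 h2].
    by rewrite E h2 andbT; case: a f g E h1 => -[] [].
  rewrite h1; apply/orP; right; apply/IH; exists r'; split=> //; exact/le_cellE.
case: t => [|f t] //= /orP[/andP[/andP[E /eqP->] h]|/andP[h1]].
  exists (endp a g :: c); split; first by apply/face1_cons; left.
  by apply/le_cellE; rewrite /= lef_refl.
case/IH=> r' [fr' ler]; exists (g :: r'); split.
  by apply/face1_cons; right; exists r'.
by apply/le_cellE; rewrite /= h1; exact/le_cellE.
Qed.

Lemma cunion_id (x : cset) : cunion x x = x.
Proof. by apply: csetP => t; rewrite /cunion; tauto. Qed.

Lemma cunionC (x y : cset) : cunion x y = cunion y x.
Proof. by apply: csetP => t; rewrite /cunion; tauto. Qed.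

(** * Molecules, morphisms and relations between cells *)

Scheme Mol_mut := Minimality for Mol Sort Prop
  with Bd_mut := Minimality for Bd Sort Prop.
Combined Scheme Mol_Bd_mut from Mol_mut, Bd_mut.

Lemma Bd_Mol K a p x y : Bd K a p x y -> Mol K x.
Proof.
elim=> {a p x y} //.
- by move=> a p c Kc _; exact: mol_gen.
- by move=> a c Kc _; exact: mol_gen.
- by move=> a b p q x y /mol_bd.
- by move=> *; apply: mol_comp; eassumption.
- by move=> *; apply: mol_comp; eassumption.
- by move=> *; apply: mol_comp; eassumption.
Qed.

Lemma Bd_sub K a p x y : Bd K a p x y -> forall t, y t -> x t.
Proof.
elim=> {a p x y} //.
- by move=> a c _ _ t; rewrite cl_cellE bd_cellE; exact: bdb_leb.
- by move=> a b p q x y z _ xy _ yz _ t /yz /xy.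
- by move=> p x y z w _ _ _ _ _ _ _ h t /h; left.
- by move=> p x y z w _ _ _ _ _ _ _ h t /h; right.
- by move=> b p q x y z u v _ _ _ _ _ _ _ _ hu _ hv t [/hu|/hv]; [left|right].
Qed.

Lemma Mol_Bd_mono K K' : (forall c, K c -> K' c) ->
  (forall x, Mol K x -> Mol K' x) /\ (forall a p x y, Bd K a p x y -> Bd K' a p x y).
Proof.
move=> KK'; apply: Mol_Bd_mut.
- by move=> c /KK'; exact: mol_gen.
- by move=> p x y z _ ? _ ? _ ? _ ?; apply: mol_comp; eassumption.
- by move=> a p x y _ h; apply: mol_bd; eassumption.
- by move=> a p c /KK'; exact: bd_gen_top.
- by move=> a c /KK'; exact: bd_gen_face.
- by move=> a b p q x y z _ ? _ ? ?; apply: bd_dd_lt; eassumption.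
- by move=> a b p q x y _ ? ?; apply: bd_dd_ge; eassumption.
- by move=> p x y z w _ ? _ ? _ ? _ ? _ ?; apply: bd_comp_l; eassumption.
- by move=> p x y z w _ ? _ ? _ ? _ ? _ ?; apply: bd_comp_r; eassumption.
- by move=> b p q x y z u v _ ? _ ? _ ? _ ? ? _ ? _ ?; apply: bd_comp_other; eassumption.
Qed.

(** Relations are used instead of maps because subdivision and folding send one cell to several. *)
Definition ext (T : cell -> cset) (s : cset) : cset := fun t => exists c, s c /\ T c t.

Lemma ext_cunion T x y : ext T (cunion x y) = cunion (ext T x) (ext T y).
Proof.
apply: csetP => t; split.
  by case=> c [[xc|yc] h]; [left|right]; exists c.
by case=> [] [c [h h']]; exists c; split=> //; [left|right].
Qed.

Lemma ext_comp T U s : ext T (ext U s) = ext (fun c => ext T (U c)) s.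
Proof.
apply: csetP => t; split.
  by case=> u [[c [sc cu]] ut]; exists c; split=> //; exists u.
by case=> c [sc [u [cu ut]]]; exists u; split=> //; exists c.
Qed.

Lemma eq_ext T U (s : cset) : (forall c, s c -> T c = U c) -> ext T s = ext U s.
Proof.
by move=> TU; apply: csetP => t; split=> -[c [sc h]]; exists c; rewrite ?TU // -?TU.
Qed.

(* ext T is then a morphism M(K) -> M(K'): it commutes with unions, hence with
   all compositions. *)
Definition preserves (K K' : cell -> Prop) (T : cell -> cset) : Prop :=
  (forall x, Mol K x -> Mol K' (ext T x)) /\
  (forall a p x y, Bd K a p x y -> Bd K' a p (ext T x) (ext T y)).

Lemma preserves_gen (K K' : cell -> Prop) T :
  (forall c, K c ->
     (forall a p, cdim c <= p -> Bd K' a p (ext T (cl_cell c)) (ext T (cl_cell c))) /\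
     (0 < cdim c -> forall a, Bd K' a (cdim c).-1 (ext T (cl_cell c)) (ext T (bd_cell a c)))) ->
  preserves K K' T.
Proof.
move=> gen; apply: Mol_Bd_mut.
- by move=> c /gen[/(_ true _ (leqnn _)) /mol_bd].
- move=> p x y z _ ? _ ? _ ? _ ?; rewrite ext_cunion; apply: mol_comp; eassumption.
- by move=> a p x y _ h; apply: mol_bd; eassumption.
- by move=> a p c /gen[h _]; exact: h.
- by move=> a c /gen[_ h] ?; exact: h.
- by move=> a b p q x y z _ ? _ ? ?; apply: bd_dd_lt; eassumption.
- by move=> a b p q x y _ ? ?; apply: bd_dd_ge; eassumption.
- move=> p x y z w _ ? _ ? _ ? _ ? _ ?; rewrite ext_cunion; apply: bd_comp_l; eassumption.
- move=> p x y z w _ ? _ ? _ ? _ ? _ ?; rewrite ext_cunion; apply: bd_comp_r; eassumption.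
- move=> b p q x y z u v _ ? _ ? _ ? _ ? ? _ ? _ ?; rewrite !ext_cunion.
  by apply: bd_comp_other; eassumption.
Qed.

Lemma preserves_comp K1 K2 K3 T U : preserves K2 K3 T -> preserves K1 K2 U ->
  preserves K1 K3 (fun c => ext T (U c)).
Proof.
move=> [T1 T2] [U1 U2]; split=> [x /U1 /T1|a p x y /U2 /T2]; by rewrite !ext_comp.
Qed.

Lemma hom_preserves (X : omega_category) K K' T (f : cset -> X) :
  hom K' X f -> preserves K K' T -> hom K X (fun s => f (ext T s)).
Proof.
move=> [f1 f2] [T1 T2]; split=> [a p x y /T2 /f1 //|p x y z /T1 ? /T1 ? /T2 ? /T2 ?].
by rewrite ext_cunion; apply: f2; eassumption.
Qed.

Lemma hom_mono (X : omega_category) (K K' : cell -> Prop) (f : cset -> X) :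
  (forall c, K c -> K' c) -> hom K' X f -> hom K X f.
Proof.
move=> /Mol_Bd_mono [m b] [f1 f2]; split=> [a p x y /b /f1 //|p x y z /m ? /m ? /b ? /b ?].
by apply: f2; eassumption.
Qed.

Lemma hom_eq_gen (X : omega_category) K (f g : cset -> X) : hom K X f -> hom K X g ->
  (forall c, K c -> f (cl_cell c) = g (cl_cell c)) -> forall s, Mol K s -> f s = g s.
Proof.
move=> [f1 f2] [g1 g2] fg.
(* For [Bd] only the values on the source are compared; those on the boundary follow from [f1] and
   [g1]. *)
suff [] : (forall s, Mol K s -> f s = g s) /\ (forall a p x y, Bd K a p x y -> f x = g x) by [].
apply: Mol_Bd_mut => //.
- by move=> p x y z mx e my e' b _ b' _;
    rewrite (f2 _ _ _ _ mx my b b') (g2 _ _ _ _ mx my b b') e e'.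
- by move=> a p x y b e; rewrite (f1 _ _ _ _ b) (g1 _ _ _ _ b) e.
- by move=> *; auto.
- by move=> *; auto.
- by move=> a b p q x y b' e _; rewrite (f1 _ _ _ _ b') (g1 _ _ _ _ b') e.
- by move=> p x y z w mx e my e' b _ b' *;
    rewrite (f2 _ _ _ _ mx my b b') (g2 _ _ _ _ mx my b b') e e'.
- by move=> p x y z w mx e my e' b _ b' *;
    rewrite (f2 _ _ _ _ mx my b b') (g2 _ _ _ _ mx my b b') e e'.
- by move=> a p q x y z u v mx e my e' b _ b' *;
  rewrite (f2 _ _ _ _ mx my b b') (g2 _ _ _ _ mx my b b') e e'.
Qed.

Lemma hom_agree (X : omega_category) n (f g : cset -> X) :
  agree n f g -> hom (Kcube n) X f -> hom (Kcube n) X g.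
Proof.
move=> fg [f1 f2]; split.
  move=> a p x y b; rewrite -!fg ?(f1 _ _ _ _ b) //; [exact: Bd_Mol b|exact: mol_bd b].
move=> p x y z mx my b b'; rewrite -!fg ?(f2 _ _ _ _ mx my b b') //.
by apply: mol_comp; eassumption.
Qed.

Lemma agree_sym (X : omega_category) n (f g : cset -> X) : agree n f g -> agree n g f.
Proof. by move=> fg s /fg. Qed.

Lemma agree_trans (X : omega_category) n (f g h : cset -> X) :
  agree n f g -> agree n g h -> agree n f h.
Proof. by move=> fg gh s ms; rewrite fg // gh. Qed.

(** * Molecules with all their boundaries; cylinders *)

Lemma neq_negb (a b : bool) : b != a -> b = ~~ a.
Proof. by case: a; case: b. Qed.

Definition bdfun := bool -> nat -> cset.

(** The boundary table of the molecule [D a p] itself, as dictated by axiom (ii). *)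
Definition trunc (a : bool) (p : nat) (D : bdfun) : bdfun :=
  fun b q => if q < p then D b q else D a p.

(** Where [molec_comp] applies, the two tables agree below [p], so either could be read there; at
    [p] the outer end of each factor survives. *)
Definition compD (a : bool) (p : nat) (D1 D2 : bdfun) : bdfun := fun b q =>
  if q < p then D1 b q else if q == p then (if b == a then D1 b q else D2 b q)
  else cunion (D1 b q) (D2 b q).

Lemma trunc_ge a p D b q : p <= q -> trunc a p D b q = D a p.
Proof. by rewrite /trunc ltnNge => ->. Qed.

Lemma trunc_lt a p D b q : q < p -> trunc a p D b q = D b q.
Proof. by rewrite /trunc => ->. Qed.

Lemma compD_lt a p D1 D2 b q : q < p -> compD a p D1 D2 b q = D1 b q.
Proof. by rewrite /compD => ->. Qed.
Lemma compD_gt a p D1 D2 b q : p < q -> compD a p D1 D2 b q = cunion (D1 b q) (D2 b q).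
Proof. by rewrite /compD; case: ltngtP. Qed.
Lemma compD_l a p D1 D2 : compD a p D1 D2 a p = D1 a p.
Proof. by rewrite /compD ltnn !eqxx. Qed.
Lemma compD_r a p D1 D2 : compD a p D1 D2 (~~ a) p = D2 (~~ a) p.
Proof. by rewrite /compD ltnn !eqxx; case: a. Qed.

(* D a p is d^a_p of the molecule.  Unlike Bd this records that the lower
   boundaries exist, which for a generator is a theorem about its faces.  In
   molec_comp the composite is y1 #_p y2 if a = false and y2 #_p y1 if a = true. *)
Inductive molec (K : cell -> Prop) : cset -> bdfun -> Prop :=
| molec_gen : forall c (D : bdfun), K c -> (forall a p, cdim c <= p -> D a p = cl_cell c) ->
    (0 < cdim c -> forall a, D a (cdim c).-1 = bd_cell a c) ->
    (forall a p, p < cdim c -> molec K (D a p) (trunc a p D)) -> molec K (cl_cell c) D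
| molec_comp : forall a p y1 y2 (D1 D2 : bdfun), molec K y1 D1 -> molec K y2 D2 ->
    D1 (~~ a) p = D2 a p -> (forall b q, q < p -> D1 b q = D2 b q) ->
    molec K (cunion y1 y2) (compD a p D1 D2).

Lemma molec_ext K y D y' D' : molec K y D -> y = y' ->
  (forall a p, D a p = D' a p) -> molec K y' D'.
Proof.
move=> h <- e; suff <- : D = D' by [].
by do 2!apply: functional_extensionality => ?.
Qed.

Section SignedComp.
Variables (K : cell -> Prop) (a : bool) (p : nat) (x y z : cset).
Hypotheses (mx : Mol K x) (my : Mol K y) (bx : Bd K (~~ a) p x z) (by_ : Bd K a p y z).

Lemma mol_comp_s : Mol K (cunion x y).
Proof.
case: a bx by_ => /= h1 h2; last exact: mol_comp h1 h2.
rewrite cunionC; exact: mol_comp h2 h1.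
Qed.

Lemma bd_comp_ls w : Bd K a p x w -> Bd K a p (cunion x y) w.
Proof.
case: a bx by_ => /= h1 h2 h; last exact: bd_comp_l h1 h2 h.
rewrite cunionC; exact: bd_comp_r h2 h1 h.
Qed.

Lemma bd_comp_rs w : Bd K (~~ a) p y w -> Bd K (~~ a) p (cunion x y) w.
Proof.
case: a bx by_ => /= h1 h2 h; last exact: bd_comp_r h1 h2 h.
rewrite cunionC; exact: bd_comp_l h2 h1 h.
Qed.

Lemma bd_comp_os b q u v : q <> p -> Bd K b q x u -> Bd K b q y v ->
  Bd K b q (cunion x y) (cunion u v).
Proof.
case: a bx by_ => /= h1 h2 qp hu hv; last exact: bd_comp_other h1 h2 qp hu hv.
rewrite cunionC (cunionC u); exact: bd_comp_other h2 h1 qp hv hu.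
Qed.

(** [Q] marks the dimensions in which the boundaries of both factors are known: all of them for a
    molecule, only [q < q'] when treating a boundary [D b' q']. *)
Lemma Bd_compD (Q : nat -> Prop) (D1 D2 : bdfun) : Q p -> D1 (~~ a) p = D2 a p ->
  (forall b q, q < p -> D1 b q = D2 b q) ->
  (forall b q, Q q -> Bd K b q x (D1 b q)) -> (forall b q, Q q -> Bd K b q y (D2 b q)) ->
  forall b q, Q q -> Bd K b q (cunion x y) (compD a p D1 D2 b q).
Proof.
move=> Qp e12 e h1 h2 b q Qq; rewrite /compD; case: ltngtP => [lt|gt|eq].
(* Below [p] both factors have the same boundary, written here as a union with itself to fit the
   rule for composites. *)
- rewrite -[D1 b q]cunion_id {2}e //; apply: bd_comp_os; [|exact: h1|exact: h2].
  by move=> E; rewrite E ltnn in lt.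
- apply: bd_comp_os; [|exact: h1|exact: h2].
  by move=> E; rewrite E ltnn in gt.
- subst q; case: eqP => [->|/eqP]; first by apply: bd_comp_ls; exact: h1.
  move=> /neq_negb ->; apply: bd_comp_rs; exact: h2.
Qed.
End SignedComp.

Lemma molec_good K y D : molec K y D ->
  [/\ Mol K y, forall a p, Bd K a p y (D a p)
    & forall a p b q, q < p -> Bd K b q (D a p) (D b q)].
Proof.
elim=> {y D} [c D Kc Dtop Dbd _ IH|a p y1 y2 D1 D2 _ [m1 b1 c1] _ [m2 b2 c2] e12 e].
  (* Codimension one is a relation of the presentation; lower boundaries are boundaries of that
     union of faces, which the induction hypothesis supplies. *)
  have b2 b q : Bd K b q (cl_cell c) (D b q).
    case: (leqP (cdim c) q) => [h|h]; first by rewrite Dtop //; exact: bd_gen_top.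
    have d0 : 0 < cdim c by exact: leq_ltn_trans h.
    move: (h); rewrite -{1}(prednK d0) ltnS leq_eqVlt => /orP[/eqP ->|lt].
      by rewrite Dbd //; exact: bd_gen_face.
    apply: (@bd_dd_lt K b b (cdim c).-1 _ _ (D b (cdim c).-1)) (lt).
      by rewrite Dbd //; exact: bd_gen_face.
    have /(IH b) [_ /(_ b q) + _] : (cdim c).-1 < cdim c by rewrite prednK.
    by rewrite /trunc lt.
  split=> //; first exact: mol_gen.
  move=> a p b q lt; case: (leqP (cdim c) p) => h; first by rewrite Dtop.
  by have [_ /(_ b q) + _] := IH a p h; rewrite /trunc lt.
have z1 := b1 (~~ a) p; have z2 := b2 a p; rewrite e12 in z1.
split; first exact: mol_comp_s z1 z2.
  move=> b q; apply: (Bd_compD m1 m2 z1 z2 (Q := fun=> True)) => //.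
move=> b' q' b q lt.
have key : forall b q, q < q' -> q' <= p -> compD a p D1 D2 b q = D1 b q.
  by move=> *; rewrite /compD; case: ltnP => //; rewrite leqNgt => /negP; case;
      apply: leq_trans; eassumption.
case: (ltngtP q' p) => [h|h|h].
- by rewrite (key b q) ?(ltnW h) // compD_lt //; exact: c1.
- have -> : compD a p D1 D2 b' q' = cunion (D1 b' q') (D2 b' q').
    by rewrite /compD; case: ltngtP h.
  apply: (@Bd_compD K a p _ _ (D2 a p) _ _ _ _ (fun q => q < q')) => //.
  + exact: mol_bd (b1 _ _).
  + exact: mol_bd (b2 _ _).
  + by rewrite -e12; exact: c1.
  + exact: c2.
  + by move=> *; exact: c1.
  + by move=> *; exact: c2.
- subst q'; rewrite (key b q) // /compD ltnn eqxx; case: eqP => _; first exact: c1.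
  rewrite e //; exact: c2.
Qed.

Lemma molec_Bd K y D a p : molec K y D -> Bd K a p y (D a p).
Proof. by case/molec_good. Qed.

Lemma molec_sub K y D a p b q t : molec K y D -> q < p -> D b q t -> D a p t.
Proof. by case/molec_good=> _ _ h lt; apply: Bd_sub; exact: h lt. Qed.

Lemma bdfunP (D D' : bdfun) : (forall a p, D a p = D' a p) -> D = D'.
Proof. by move=> e; do 2!apply: functional_extensionality => ?. Qed.

Lemma trunc_trunc a b p q D : q < p -> trunc a q (trunc b p D) = trunc a q D.
Proof.
move=> lt; apply: bdfunP => b' q'; rewrite /trunc lt.
by case: ltnP => // h; rewrite (ltn_trans h lt).
Qed.

Lemma trunc_top a p D : (forall b q, p <= q -> D b q = D a p) -> trunc a p D = D.
Proof. by move=> e; apply: bdfunP => b q; rewrite /trunc; case: ltnP => // /e ->. Qed.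

Lemma trunc_compD_lt a p D1 D2 b q : q < p -> trunc b q (compD a p D1 D2) = trunc b q D1.
Proof.
move=> lt; apply: bdfunP => b' q'; rewrite /trunc; case: ltnP => h; rewrite compD_lt //.
exact: ltn_trans lt.
Qed.

Lemma trunc_compD_l a p D1 D2 : trunc a p (compD a p D1 D2) = trunc a p D1.
Proof. by apply: bdfunP => b q; rewrite /trunc compD_l; case: ltnP => // /compD_lt ->. Qed.

Lemma trunc_compD_r a p D1 D2 : (forall b q, q < p -> D1 b q = D2 b q) ->
  trunc (~~ a) p (compD a p D1 D2) = trunc (~~ a) p D2.
Proof.
move=> e; apply: bdfunP => b q; rewrite /trunc compD_r; case: ltnP => // lt.
by rewrite compD_lt // e.
Qed.

Lemma trunc_compD_gt a p D1 D2 b q : p < q ->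
  trunc b q (compD a p D1 D2) = compD a p (trunc b q D1) (trunc b q D2).
Proof.
move=> gt; apply: bdfunP => b' q'; rewrite /trunc /compD.
case: (ltngtP q' p) => [lt|lt|->].
- by rewrite (ltn_trans lt gt).
- by case: (ltnP q' q); case: (ltngtP q p) gt.
- by rewrite gt.
Qed.

(** For a cell this is the last premise of [molec_gen]. For a composite, a boundary in dimension at
    most [p] comes from one factor, and above [p] it is the composite of the boundaries of both. *)
Lemma molec_trunc K y D a p : molec K y D -> molec K (D a p) (trunc a p D).
Proof.
move=> h; elim: h a p => {y D} [c D Kc Dtop Dbd h IH|a p y1 y2 D1 D2 g1 t1 g2 t2 e12 e] b q.
  case: (leqP (cdim c) q) => [le|]; last exact: h.
  rewrite Dtop // trunc_top; first exact: molec_gen.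
  by move=> b' q' /(leq_trans le) le'; rewrite !Dtop.
case: (ltngtP q p) => [lt|gt|->].
- by rewrite compD_lt // trunc_compD_lt.
- rewrite compD_gt // trunc_compD_gt //; apply: molec_comp => //.
  + by rewrite !trunc_lt.
  + by move=> b' q' lt; rewrite !trunc_lt ?e // (ltn_trans lt gt).
- case: (b =P a) => [->|/eqP/neq_negb->]; first by rewrite compD_l trunc_compD_l.
  by rewrite compD_r trunc_compD_r.
Qed.

Definition vert (a : bool) : fac := if a then V1 else V0.
Definition point_times (v : fac) (y : cset) : cset :=
  fun t => if t is f :: t' then f = v /\ y t' else False.
Definition cyl (y : cset) : cset :=
  fun t => if t is f :: t' then isI f /\ y t' else False.
Definition cyl_below (D : bdfun) (a : bool) (p : nat) : cset :=
  if p is p'.+1 then cyl (D a p') else fun=> False.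
(* With I = [0,1] on the left, d^a_p(I x y) = {a} x d^a_p y U I x d^{-a}_{p-1} y. *)
Definition half_cyl (a : bool) (p : nat) (y : cset) (D : bdfun) : cset :=
  cunion (point_times (vert a) y) (cyl_below D (~~ a) p).
Definition cyl_bd (D : bdfun) : bdfun := fun a p => half_cyl a p (D a p) D.
(** Below dimension [p] the boundaries are those of the full cylinder; from [p] on only the end
    [{a} x y] still changes. *)
Definition half_cyl_bd (a : bool) (p : nat) (D : bdfun) : bdfun := fun b q =>
  if q < p then cyl_bd D b q else half_cyl a p (D b q) D.

Lemma vert_isI a : isI (vert a). Proof. by case: a. Qed.

Lemma cyl_below_eq D1 D2 a p : (forall q,
    q < p -> D1 a q = D2 a q) -> cyl_below D1 a p = cyl_below D2 a p.
Proof. by case: p => //= p ->. Qed.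

Lemma cyl_below_sub K y D a b p t : molec K y D -> cyl_below D a p t -> cyl (D b p) t.
Proof.
case: p => //= p g; case: t => //= f t [-> h]; split=> //.
exact: molec_sub g (ltnSn p) h.
Qed.

Lemma point_times_cyl a y t : point_times (vert a) y t -> cyl y t.
Proof. by case: t => //= f t [-> h]; rewrite vert_isI. Qed.

Lemma cyl_below_trunc D a b p q : q <= p -> cyl_below (trunc a p D) b q = cyl_below D b q.
Proof. by move=> le; apply: cyl_below_eq => q' lt; rewrite /trunc (leq_trans lt le). Qed.

Section Cylinder.
Variables (K K' : cell -> Prop).
Hypothesis KK' : forall f c, isI f -> K c -> K' (f :: c).

Lemma cl_vert a c : cl_cell (vert a :: c) = point_times (vert a) (cl_cell c).
Proof.
apply: csetP => -[|f t]; rewrite !cl_cellE //=.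
by case: a; case: f; rewrite /lef /=; split=> [|[]] //; case: (leb _ _).
Qed.

Lemma bd_vert a b c : bd_cell b (vert a :: c) = point_times (vert a) (bd_cell b c).
Proof.
apply: csetP => -[|f t]; rewrite !bd_cellE //= addbC.
by case: a; case: f; rewrite /lef /=; split=> [|[]] //; case: (bdb _ _).
Qed.

Lemma cl_E c : cl_cell (E01 :: c) = cyl (cl_cell c).
Proof.
apply: csetP => -[|f t]; rewrite !cl_cellE //=.
by case: f; rewrite /lef /=; split=> [|[]] //; case: (leb _ _).
Qed.

Lemma bd_E a c : bd_cell a (E01 :: c) =
  cunion (point_times (vert a) (cl_cell c)) (cyl (bd_cell (~~ a) c)).
Proof.
apply: csetP => -[|f t]; rewrite /cunion !bd_cellE !cl_cellE //=; first by split=> // -[].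
rewrite addbT; case: (leb t c); case: (bdb _ c t); case: a; case: f; rewrite /lef /=;
  split=> // h; intuition discriminate.
Qed.

Lemma molec_point_times a y D : molec K y D -> molec K' (point_times (vert a) y) (fun b q =>
    point_times (vert a) (D b q)).
Proof.
elim=> {y D} [c D Kc Dtop Dbd _ IH|b p y1 y2 D1 D2 _ g1 _ g2 e12 e].
  have dE : cdim (vert a :: c) = cdim c by case: a {IH}.
  rewrite -cl_vert; apply: molec_gen.
  - by apply: KK' => //; exact: vert_isI.
  - by move=> b p; rewrite dE => le; rewrite Dtop // cl_vert.
  - by rewrite dE => h b; rewrite Dbd // bd_vert.
  - move=> b p; rewrite dE => /IH h; apply: molec_ext (h b) _ _ => // b' q'.
    by rewrite /trunc; case: ltnP.
apply: molec_ext (@molec_comp K' b p _ _ _ _ g1 g2 _ _) _ _.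
- by rewrite e12.
- by move=> b' q /e ->.
- by apply: csetP => -[|f t]; rewrite /cunion /=; tauto.
- move=> b' q; rewrite /compD; case: ifP => // _; case: ifP => _; first by case: ifP.
  by apply: csetP => -[|f t]; rewrite /cunion /=; tauto.
Qed.

(* Adding the cylinders on the boundaries one dimension at a time: half_cyl (p + 1)
   is half_cyl p #_p (I x d^{-a}_p y), the factors being exchanged when a = true. *)
Lemma molec_half_cyl a y D p : molec K y D ->
  (forall q, q < p -> molec K' (cyl (D (~~ a) q)) (cyl_bd (trunc (~~ a) q D))) ->
  molec K' (half_cyl a p y D) (half_cyl_bd a p D).
Proof.
move=> g; elim: p => [|p IH] h.
  apply: molec_ext (molec_point_times a g) _ _.
    by apply: csetP => -[|f t]; rewrite /half_cyl /cunion /=; tauto.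
  by move=> b q; apply: csetP => -[|f t]; rewrite /half_cyl_bd /half_cyl /cunion /=; tauto.
have {}IH : molec K' (half_cyl a p y D) (half_cyl_bd a p D).
  by apply: IH => q lt; apply: h; rewrite ltnS ltnW.
have lc b q : q <= p -> cyl_bd (trunc (~~ a) p D) b q =
    half_cyl b q (trunc (~~ a) p D b q) D.
  by move=> le; rewrite /cyl_bd /half_cyl cyl_below_trunc.
apply: molec_ext (@molec_comp K' a p _ _ _ _ IH (h p (ltnSn p)) _ _) _ _.
- by rewrite /half_cyl_bd ltnn lc // trunc_ge.
- by move=> b q lt; rewrite /half_cyl_bd lt lc 1?ltnW // trunc_lt.
- apply: csetP => t; rewrite /half_cyl /cunion /=.
  by have := @cyl_below_sub _ _ _ (~~ a) (~~ a) p t g; tauto.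
move=> b q; case: (ltngtP q p) => [lt|gt|->].
- by rewrite compD_lt // /half_cyl_bd lt ltnS ltnW.
- rewrite compD_gt // /half_cyl_bd !ifN -?leqNgt ?(ltnW gt) //.
  case: q gt => // q gt; apply: csetP => t.
  rewrite /cyl_bd /half_cyl /cunion trunc_ge 1?ltnW // /= trunc_ge //.
  have := @cyl_below_sub _ _ _ (~~ a) (~~ a) p t g.
  have := @point_times_cyl b (D (~~ a) p) t; tauto.
- case: (b =P a) => [->|/eqP]; first by rewrite compD_l /half_cyl_bd ltnn ltnSn.
  by move=> /neq_negb ->; rewrite compD_r lc // trunc_ge // /half_cyl_bd ltnSn.
Qed.

(** The cylinder on a cell is again a cell, so the point is that its boundaries are molecules: they
    are half cylinders over the boundaries [D a p] with [p <= cdim c]. *)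
Lemma molec_cyl_gen c D : molec K (cl_cell c) D -> K c ->
  (forall a p, cdim c <= p -> D a p = cl_cell c) ->
  (0 < cdim c -> forall a, D a (cdim c).-1 = bd_cell a c) ->
  (forall a p, p < cdim c -> molec K' (cyl (D a p)) (cyl_bd (trunc a p D))) ->
  molec K' (cyl (cl_cell c)) (cyl_bd D).
Proof.
move=> g Kc Dtop Dbd IH.
rewrite -cl_E; apply: molec_gen.
- exact: KK'.
- move=> a [|p] //; rewrite /= add1n ltnS => le.
  rewrite /cyl_bd /half_cyl /= !Dtop // ?leqW // cl_E.
  by apply: csetP => t; rewrite /cunion; have := @point_times_cyl a (cl_cell c) t; tauto.
- move=> _ a; rewrite /= bd_E /cyl_bd /half_cyl Dtop // /cyl_below.
  case e: (cdim c) => [|d]; last by rewrite -Dbd ?e.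
  congr cunion; apply: csetP => -[|f t]; rewrite bd_cellE //=; split=> // -[_ h].
  by move/bdb_cdim: h; rewrite e.
move=> a p lt; apply: molec_ext (@molec_half_cyl a _ _ p (molec_trunc a p g) _) _ _.
- move=> q ltq; rewrite trunc_lt // trunc_trunc //; apply: IH.
  by rewrite (leq_trans ltq).
- by rewrite /half_cyl cyl_below_trunc.
- move=> b q; rewrite /half_cyl_bd /trunc -/(trunc a p D); case: ltnP => h.
    by rewrite /cyl_bd /half_cyl cyl_below_trunc 1?ltnW // trunc_lt.
  by rewrite /half_cyl cyl_below_trunc // trunc_ge.
Qed.

(* For a = false, put m = p + 1 and N^-(z) = {0} x z U I x d^+_{p-1} z,
   N^+(z) = {1} x z U I x d^-_{p-1} z; then
   I x (y1 #_p y2) = (N^-(d^-_m y1) #_p I x y2) #_m (I x y1 #_p N^+(d^+_m y2)). *)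
Lemma molec_cyl_comp a p y1 y2 D1 D2 : molec K y1 D1 -> molec K y2 D2 ->
  molec K' (cyl y1) (cyl_bd D1) -> molec K' (cyl y2) (cyl_bd D2) ->
  D1 (~~ a) p = D2 a p -> (forall b q, q < p -> D1 b q = D2 b q) ->
  (forall b q, q < p -> molec K' (cyl (D1 b q)) (cyl_bd (trunc b q D1))) ->
  molec K' (cyl (cunion y1 y2)) (cyl_bd (compD a p D1 D2)).
Proof.
move=> g1 g2 c1 c2 e12 e IH1.
have IH2 b q : q < p -> molec K' (cyl (D2 b q)) (cyl_bd (trunc b q D2)).
  move=> lt; have -> : trunc b q D2 = trunc b q D1.
    by apply: bdfunP => b' q'; rewrite /trunc; case: ltnP => h; rewrite e // (ltn_trans h).
  by rewrite -e //; exact: IH1.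
(* These are the factors [N^-] and [N^+]: half cylinders whose end is the boundary in dimension
   [p + 1]. *)
have nt a1 y D : molec K y D ->
    (forall b q, q < p -> molec K' (cyl (D b q)) (cyl_bd (trunc b q D))) ->
    molec K' (half_cyl a1 p (D a1 p.+1) D)
      (fun b q => if q < p then cyl_bd D b q else half_cyl a1 p (trunc a1 p.+1 D b q) D).
  move=> g IH; apply: molec_ext (@molec_half_cyl a1 _ _ p (molec_trunc a1 p.+1 g) _) _ _.
  - move=> q lt; have lt' : q < p.+1 by rewrite ltnS ltnW.
    by rewrite trunc_lt // trunc_trunc //; exact: IH.
  - by rewrite /half_cyl cyl_below_trunc.
  - move=> b q; rewrite /half_cyl_bd; case: ltnP => h; last by rewrite /half_cyl cyl_below_trunc.
    by rewrite /cyl_bd /half_cyl cyl_below_trunc 1?ltnW ?trunc_lt // ltnS ltnW.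
have low b q : q <= p -> cyl_below D2 b q = cyl_below D1 b q.
  by move=> le; apply: cyl_below_eq => r lt; rewrite e // (leq_trans lt).
have cyl12 b q : q < p -> cyl_bd D2 b q = cyl_bd D1 b q.
  by move=> lt; rewrite /cyl_bd /half_cyl e // low // ltnW.
have n1 := nt a _ _ g1 IH1; have n2 := nt (~~ a) _ _ g2 IH2.
set NP := fun b q => _ in n1; set NQ := fun b q => _ in n2.
have gP : molec K' (cunion (half_cyl a p (D1 a p.+1) D1) (cyl y2)) (compD a p NP (cyl_bd D2)).
  apply: molec_comp n1 c2 _ _.
    by rewrite /NP ltnn trunc_lt // e12 /cyl_bd /half_cyl low.
  by move=> b q lt; rewrite /NP lt cyl12.
have gQ : molec K' (cunion (cyl y1) (half_cyl (~~ a) p (D2 (~~ a) p.+1) D2)) (compD a p (cyl_bd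
    D1) NQ).
  apply: molec_comp c1 n2 _ _.
    by rewrite /NQ ltnn trunc_lt // -e12 /cyl_bd /half_cyl low.
  by move=> b q lt; rewrite /NQ lt cyl12.
set PD := compD a p _ _ in gP; set QD := compD a p _ _ in gQ.
have PDlt b q : q < p -> PD b q = cyl_bd D1 b q.
  by move=> lt; rewrite /PD compD_lt // /NP lt.
have QDlt b q : q < p -> QD b q = cyl_bd D1 b q by move=> lt; rewrite /QD compD_lt.
have PDa : PD a p = cyl_bd D1 a p by rewrite /PD compD_l /NP ltnn trunc_lt.
have PDn : PD (~~ a) p = cyl_bd D2 (~~ a) p by rewrite /PD compD_r.
have QDa : QD a p = cyl_bd D1 a p by rewrite /QD compD_l.
have QDn : QD (~~ a) p = cyl_bd D2 (~~ a) p.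
  by rewrite /QD compD_r /NQ ltnn trunc_lt.
have PDgt b q : p < q -> PD b q = cunion (half_cyl a p (D1 a p.+1) D1) (cyl_bd D2 b q).
  by move=> lt; rewrite /PD compD_gt // /NP ltnNge ltnW //= trunc_ge.
have QDgt b q : p < q -> QD b q = cunion (cyl_bd D1 b q) (half_cyl (~~ a) p (D2 (~~ a) p.+1) D2).
  by move=> lt; rewrite /QD compD_gt // /NQ ltnNge ltnW //= trunc_ge.
have S1 b b' t := @cyl_below_sub _ _ _ b b' p t g1.
have S2 b b' t : cyl_below D1 b p t -> cyl (D2 b' p) t.
  by have := @cyl_below_sub _ _ _ b b' p t g2; rewrite low.
apply: molec_ext (@molec_comp K' a p.+1 _ _ _ _ gP gQ _ _) _ _.
- rewrite PDgt // QDgt // /cyl_bd /half_cyl /= ?low // negbK e12; apply: csetP => t.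
  move: (S2 a a t) (S2 (~~ a) a t); rewrite /cunion; tauto.
- move=> b q; rewrite ltnS leq_eqVlt => /orP[/eqP->|lt]; last by rewrite PDlt // QDlt.
  case: (b =P a) => [->|/eqP]; first by rewrite PDa QDa.
  by move=> /neq_negb->; rewrite PDn QDn.
- have D1y a' q t : cyl (D1 a' q) t -> cyl y1 t.
    by case: t => //= f t [-> h]; split=> //; exact: Bd_sub (molec_Bd a' q g1) _ h.
  have D2y a' q t : cyl (D2 a' q) t -> cyl y2 t.
    by case: t => //= f t [-> h]; split=> //; exact: Bd_sub (molec_Bd a' q g2) _ h.
  apply: csetP => t; rewrite /half_cyl low //.
  move: (S1 (~~ a) a t) (S2 (~~ ~~ a) a t) (D1y a p t) (D2y a p t)
    (D1y a p.+1 t) (D2y (~~ a) p.+1 t) (@point_times_cyl a (D1 a p.+1) t)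
    (@point_times_cyl (~~ a) (D2 (~~ a) p.+1) t).
  have -> : cyl (cunion y1 y2) t <-> cyl y1 t \/ cyl y2 t.
    by case: t => [|f t]; rewrite /cunion /=; tauto.
  rewrite /cunion; tauto.
have cyU (x y : cset) t : cyl (cunion x y) t <-> cyl x t \/ cyl y t.
  by case: t => [|f t]; rewrite /cunion /=; tauto.
have vxU v (x y : cset) t : point_times v (cunion x y) t <-> point_times v x t \/ point_times v y t.
  by case: t => [|f t]; rewrite /cunion /=; tauto.
have lowD b q : q <= p -> cyl_below (compD a p D1 D2) b q = cyl_below D1 b q.
  by move=> le; apply: cyl_below_eq => r lt; rewrite compD_lt // (leq_trans lt).
move=> b q; case: (ltngtP q p.+1) => [ltS|gt|->]; last first.
- case: (b =P a) => [->|/eqP].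
    rewrite compD_l PDgt // /cyl_bd /half_cyl /= ?low // compD_gt // compD_r.
    apply: csetP => t; rewrite /cunion vxU.
    move: (S2 (~~ a) (~~ a) t); tauto.
  move=> /neq_negb->; rewrite compD_r QDgt // /cyl_bd /half_cyl /= ?low // negbK compD_gt //
      compD_l.
  apply: csetP => t; rewrite /cunion vxU.
  move: (S1 a a t); tauto.
- case: q gt => // q; rewrite ltnS => gt.
  have gt' : p < q.+1 by exact: ltnW.
  rewrite compD_gt // PDgt // QDgt // /cyl_bd /half_cyl /= ?low // !compD_gt //.
  apply: csetP => t; rewrite /cunion vxU cyU.
  (* The end of each [N] is absorbed by the boundary of the cylinder it belongs to. For [q = p + 1]
     the sign decides whether the end or the side of that cylinder contains it. *)
  have up y D a' : molec K y D -> point_times (vert a') (D a' p.+1) t ->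
      point_times (vert b) (D b q.+1) t \/ cyl (D (~~ b) q) t.
    move=> g; case: t => //= f t [-> h]; rewrite vert_isI.
    move: gt; rewrite leq_eqVlt => /orP[/eqP e'|lt]; last first.
      by right; split=> //; exact: molec_sub g lt h.
    case: (b =P a') => [->|/eqP]; first by left; split=> //; apply: molec_sub g _ h; rewrite e'.
    by move=> /neq_negb->; rewrite negbK -e'; right.
  have lw b' : cyl_below D1 b' p t -> cyl (D1 (~~ b) q) t.
    move/(S1 _ true); case: (t) => //= f t' [-> h]; split=> //; exact: molec_sub g1 gt h.
  move: (up _ _ a g1) (up _ _ (~~ a) g2) (lw (~~ a)) (lw (~~ ~~ a)); tauto.
- move: ltS; rewrite ltnS leq_eqVlt => /orP[/eqP->|lt]; last first.
    by rewrite compD_lt ?PDlt ?ltnS ?(ltnW lt) // /cyl_bd /half_cyl lowD ?compD_lt // ltnW.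
  rewrite compD_lt //; case: (b =P a) => [->|/eqP].
    by rewrite PDa /cyl_bd /half_cyl lowD // compD_l.
  by move=> /neq_negb->; rewrite PDn /cyl_bd /half_cyl lowD // compD_r low.
Qed.

(** The boundaries are carried through the induction because the composite case builds its half
    cylinders from cylinders on boundaries of the factors. *)
Lemma molec_cyl y D : molec K y D ->
  molec K' (cyl y) (cyl_bd D) /\ forall a p, molec K' (cyl (D a p)) (cyl_bd (trunc a p D)).
Proof.
elim=> {y D} [c D Kc Dtop Dbd h IH|a p y1 y2 D1 D2 g1 [c1 t1] g2 [c2 t2] e12 e].
  have gc : molec K' (cyl (cl_cell c)) (cyl_bd D).
    exact: (molec_cyl_gen (molec_gen Kc Dtop Dbd h) Kc Dtop Dbd (fun a p lt => (IH a p lt).1)).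
  split=> // a p; case: (leqP (cdim c) p) => [le|lt]; last by case: (IH a p lt).
  rewrite Dtop // trunc_top // => b' q' /(leq_trans le) le'; by rewrite !Dtop.
split=> [|b q]; first exact: molec_cyl_comp.
case: (ltngtP q p) => [lt|gt|->].
- by rewrite compD_lt // trunc_compD_lt.
- rewrite compD_gt // trunc_compD_gt //;
    apply: (molec_cyl_comp (molec_trunc b q g1) (molec_trunc b q g2)) => //.
  + by rewrite !trunc_lt.
  + by move=> b' q' lt; rewrite !trunc_lt ?e // (ltn_trans lt gt).
  + move=> b' q' lt; have lt' := ltn_trans lt gt.
    by rewrite trunc_lt // trunc_trunc.
- case: (b =P a) => [->|/eqP/neq_negb->]; first by rewrite compD_l trunc_compD_l.
  by rewrite compD_r trunc_compD_r.
Qed.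
End Cylinder.

(** * Subdivision of cubes *)

Lemma leb_rev t c : leb (rev t) (rev c) = leb t c.
Proof.
have [e|ne] := eqVneq (size t) (size c); last first.
  have d (u v : cell) : size u != size v -> leb u v = false.
    by move=> ne'; apply/negP => /leb_size e; rewrite e eqxx in ne'.
  by rewrite !d ?size_rev.
elim: t c e => [|f t IH] [|g c] //= [e].
by rewrite !rev_cons -!cats1 leb_cat ?size_rev // IH //= andbT andbC.
Qed.

Lemma cdim_rev c : cdim (rev c) = cdim c.
Proof. by rewrite /cdim count_rev. Qed.

(** The [j]th of [d] interval factors becomes number [d + 1 - j], so its parity changes exactly when
    [d] is even. *)
Lemma bdb_rev a t c : bdb a (rev c) (rev t) = bdb (a (+) ~~ odd (cdim c)) c t.
Proof.
have [e|ne] := eqVneq (size t) (size c); last first.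
  have d b (u v : cell) : size u != size v -> bdb b v u = false.
    by move=> ne'; apply/negP => /bdb_size e; rewrite e eqxx in ne'.
  by rewrite !d ?size_rev.
elim: t c a e => [|f t IH] [|g c] a //= [e].
rewrite !rev_cons -!cats1 bdb_cat ?size_rev // IH //= leb_rev cdim_rev.
set L := leb t c; set E := lef f g; set n := odd (cdim c).
have -> : odd (isE g + cdim c) = isE g (+) n by rewrite oddD oddb.
case Eg: (isE g); rewrite /= ?add1n ?add0n /= ?andbT ?andbF ?orbF.
  have -> : a (+) ~~ ~~ n = a (+) n by rewrite negbK.
  have -> : a (+) n (+) true = a (+) ~~ n by rewrite addbT addbN.
  by rewrite orbC (andbC L) (andbC E).
by rewrite addbF andbC.
Qed.

Definition rev_set (y : cset) : cset := fun t => y (rev t).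
(* Reversing the order of the factors exchanges d^-_p and d^+_p for p odd. *)
Definition rev_bd (D : bdfun) : bdfun := fun a p => rev_set (D (a (+) odd p) p).

Lemma rev_set_cl c : rev_set (cl_cell c) = cl_cell (rev c).
Proof. by apply: csetP => t; rewrite /rev_set !cl_cellE -leb_rev revK. Qed.

Lemma rev_set_bd a c : 0 < cdim c ->
    rev_set (bd_cell (a (+) odd (cdim c).-1) c) = bd_cell a (rev c).
Proof.
move=> d; apply: csetP => t.
rewrite /rev_set !bd_cellE -{2}[t]revK bdb_rev.
by case: (cdim c) d => //= n _; rewrite negbK.
Qed.

(** Reversal exchanges the factors of a composite along an odd dimension; the sign carried by
    [molec_comp] absorbs this. *)
Lemma molec_rev (K K' : cell -> Prop) y D : (forall c, K c -> K' (rev c)) ->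
  molec K y D -> molec K' (rev_set y) (rev_bd D).
Proof.
move=> KK' g; elim: g => {y D} [c D Kc Dtop Dbd h IH|a p y1 y2 D1 D2 g1 IH1 g2 IH2 e12 e].
  rewrite rev_set_cl; apply: molec_gen; rewrite ?cdim_rev.
  - exact: KK'.
  - by move=> a p le; rewrite /rev_bd Dtop // rev_set_cl.
  - by move=> d a; rewrite /rev_bd Dbd // rev_set_bd.
  - move=> a p lt; apply: molec_ext (IH (a (+) odd p) p lt) _ _ => //.
    by move=> b q; rewrite /rev_bd /trunc; case: ltnP.
apply: molec_ext (@molec_comp K' (a (+) odd p) p _ _ _ _ IH1 IH2 _ _) _ _ => //.
- by rewrite /rev_bd addNb addbK e12.
- by move=> b q lt; rewrite /rev_bd e.
- move=> b q; rewrite /rev_bd /compD; case: ltngtP => // ->.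
  by case: b a {e12} => -[]; case: (odd p).
Qed.

Definition subdiv (k : nat) (c : cell) : cset := fun t =>
  size t = size c /\ (forall j, j <> k -> nth V0 t j = nth V0 c j) /\
  mu_fac (nth V0 c k) (nth V0 t k).

Lemma mu_setE k : mu_set k = ext (subdiv k).
Proof. by []. Qed.

Lemma subdiv0 f c t : subdiv 0 (f :: c) t <-> exists2 g, t = g :: c & mu_fac f g.
Proof.
split.
  case: t => [|g t] [//=] [sz] [h /= m]; exists g => //; congr (_ :: _).
  by apply: (@eq_from_nth _ V0) => // i _; exact: (h i.+1).
by case=> g -> m; split=> //; split=> //; case.
Qed.

Lemma subdivS k f c t : subdiv k.+1 (f :: c) t <-> exists2 t', t = f :: t' & subdiv k c t'.
Proof.
split.
  case: t => [|g t] [//=] [sz] [h /= m]; have -> : g = f by exact: (h 0).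
  by exists t => //; do 2!split=> //; move=> j ne; apply: (h j.+1) => -[].
case=> t' -> [sz [h m]]; split; first by rewrite /= sz.
by split=> // -[|j] ne //=; apply: h => e; apply: ne; rewrite e.
Qed.

Lemma subdiv_rev k c t : k < size c -> subdiv k c t ->
  subdiv ((size c).-1 - k) (rev c) (rev t).
Proof.
move=> lt [sz [h m]].
have kE : size c - ((size c).-1 - k).+1 = k by lia.
have ltn : (size c).-1 - k < size c by lia.
split; first by rewrite !size_rev.
split=> [j ne|]; last by rewrite !nth_rev ?sz // kE.
case: (ltnP j (size c)) => ltj; last by rewrite !nth_default ?size_rev ?sz.
rewrite !nth_rev ?sz //; apply: h; lia.
Qed.

Lemma mu_set_rev n k y : k < n -> (forall c, y c -> size c = n) ->
  rev_set (mu_set k y) = mu_set (n.-1 - k) (rev_set y).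
Proof.
move=> lt sy; rewrite !mu_setE; apply: csetP => t; split=> -[c [yc h]].
  have sc := sy _ yc; exists (rev c); split; first by rewrite /rev_set revK.
  by rewrite -[t]revK -sc; apply: subdiv_rev; rewrite ?sc.
have sc : size c = n by rewrite -size_rev; exact: sy.
exists (rev c); split=> //; have e : k = (size c).-1 - (n.-1 - k) by lia.
by have := @subdiv_rev (n.-1 - k) c t; rewrite -e; apply=> //; lia.
Qed.

Lemma mu_set_point_times k v y : mu_set k.+1 (point_times v y) = point_times v (mu_set k y).
Proof.
rewrite !mu_setE; apply: csetP => -[|f t]; split=> //.
- by case=> -[|g c] [] //= _ [].
- by case=> -[|g c] [] //= [-> yc] /subdivS[t' [-> ->] h]; split=> //; exists c.
- by case=> -> [c [yc h]]; exists (v :: c); split=> //; apply/subdivS; exists t.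
Qed.

Lemma mu_set_cyl k y : mu_set k.+1 (cyl y) = cyl (mu_set k y).
Proof.
rewrite !mu_setE; apply: csetP => -[|f t]; split=> //.
- by case=> -[|g c] [] //= _ [].
- by case=> -[|g c] [] //= [If yc] /subdivS[t' [-> ->] h]; split=> //; exists c.
- by case=> If [c [yc h]]; exists (f :: c); split=> //; apply/subdivS; exists t.
Qed.

(* By preserves_gen only the boundaries in dimensions dim c and dim c - 1 matter. *)
Definition mu_good (k : nat) (c : cell) : Prop := exists D,
  [/\ molec (Kcube2 (size c) k.+1) (mu_set k (cl_cell c)) D,
      forall a p, cdim c <= p -> D a p = mu_set k (cl_cell c)
    & 0 < cdim c -> forall a, D a (cdim c).-1 = mu_set k (bd_cell a c)].

Lemma Kcube2_cons n k f c : isI f -> Kcube2 n k.+1 c -> Kcube2 n.+1 k.+2 (f :: c).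
Proof.
move=> If [sc h]; split=> [|[|j] ne] //=; first by rewrite sc.
by apply: h => e; apply: ne; rewrite e.
Qed.

Lemma mu_good_vert k a c : mu_good k c -> mu_good k.+1 (vert a :: c).
Proof.
case=> D [g Dtop Dbd]; exists (fun b q => point_times (vert a) (D b q)).
have dE : cdim (vert a :: c) = cdim c by case: a.
rewrite cl_vert mu_set_point_times dE; split.
- by apply: molec_point_times g => f c'; exact: Kcube2_cons.
- by move=> b p /Dtop ->.
- by move=> d b; rewrite bd_vert mu_set_point_times Dbd.
Qed.

Lemma mu_good_E k c : mu_good k c -> mu_good k.+1 (E01 :: c).
Proof.
case=> D [g Dtop Dbd]; exists (cyl_bd D).
rewrite cl_E mu_set_cyl; split.
- by have [] := @molec_cyl _ (Kcube2 (size c).+1 k.+2) (@Kcube2_cons _ k) _ _ g.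
- move=> a [|p] //=; rewrite add1n ltnS => le.
  rewrite /cyl_bd /half_cyl /= !Dtop ?leqW //; apply: csetP => t.
  by have := @point_times_cyl a (mu_set k (cl_cell c)) t; rewrite /cunion; tauto.
- move=> _ a; rewrite /= bd_E mu_setE ext_cunion -!mu_setE mu_set_point_times mu_set_cyl.
  rewrite /cyl_bd /half_cyl Dtop //; congr cunion.
  case e: (cdim c) => [|d]; last by rewrite /= -Dbd ?e.
  apply: csetP => -[|f t] //=; split=> // -[_ [c' [+ _]]]; rewrite bd_cellE.
  by move/bdb_cdim; rewrite e.
Qed.

Lemma mu_good_rev k c : k < size c -> mu_good k c -> mu_good ((size c).-1 - k) (rev c).
Proof.
move=> lt [D [g Dtop Dbd]]; exists (rev_bd D).
have cl : mu_set ((size c).-1 - k) (cl_cell (rev c)) = rev_set (mu_set k (cl_cell c)).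
  rewrite (mu_set_rev lt) ?rev_set_cl // => t; rewrite cl_cellE; exact: leb_size.
rewrite size_rev cdim_rev cl; split.
- apply: molec_rev g => c' [sc h]; split; first by rewrite size_rev.
  move=> j ne; case: (ltnP j (size c)) => ltj; last by rewrite nth_default ?size_rev ?sc.
  rewrite nth_rev ?sc //; apply: h; move: ne => /=; lia.
- by move=> a p le; rewrite /rev_bd Dtop.
- move=> d a; rewrite /rev_bd Dbd // -rev_set_bd // (mu_set_rev lt) // => t.
  by rewrite bd_cellE; exact: bdb_size.
Qed.

Lemma mu_set1 f t : mu_set 0 (cl_cell [:: f]) t <->
  exists g, t = [:: g] /\ exists2 f', lef f' f & mu_fac f' g.
Proof.
rewrite mu_setE; split.
  case=> -[|f' [|? ?]] []; rewrite cl_cellE //= ?andbT ?andbF //.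
  by move=> le /subdiv0[g -> m]; exists g; split=> //; exists f'.
case=> g [-> [f' le m]]; exists [:: f']; split; first by rewrite cl_cellE /= le.
by apply/subdiv0; exists g.
Qed.

Lemma cl1E f t : cl_cell [:: f] t <-> exists2 g, t = [:: g] & lef g f.
Proof.
rewrite cl_cellE; split; last by case=> g ->; rewrite /= andbT.
by case: t => [|g [|? ?]] //=; rewrite ?andbF ?andbT // => h; exists g.
Qed.

Lemma molec_vertex K v : K [:: v] -> ~~ isE v -> molec K (cl_cell [:: v]) (fun _ _ =>
    cl_cell [:: v]).
Proof. by move=> Kv nE; apply: molec_gen => //=; rewrite (negbTE nE). Qed.

Lemma molec_edge (K : cell -> Prop) e : isE e -> (forall v, lef v e -> K [:: v]) ->
  molec K (cl_cell [:: e]) (fun a p => if p is 0 then cl_cell [:: endp a e] else cl_cell [:: e]).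
Proof.
move=> Ee Ke; apply: molec_gen => /=; rewrite ?Ee.
- exact/Ke/lef_refl.
- by move=> a [].
- move=> _ a; apply: csetP => t; rewrite cl1E bd_cellE.
  case: t => [|g [|? ?]] /=; rewrite ?andbF ?andbT ?orbF ?Ee /=; split=> //; try by case.
    by case=> h [->]; move: Ee; clear Ke; case: e; case: a; case: h.
  by move/eqP=> ->; exists (endp a e) => //; exact: lef_refl.
- move=> a [|p] // _; apply: molec_ext (@molec_vertex K (endp a e) _ _) _ _ => //.
  + by apply: Ke; case: e a Ee => -[].
  + by clear Ke; case: e a Ee => -[].
Qed.

Lemma mu_good1 f : isI f -> mu_good 0 [:: f].
Proof.
have K1 g : Kcube2 1 1 [:: g] by split=> // -[|[]].
case: f => // _.
- exists (fun _ _ => cl_cell [:: V0]).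
  have -> : mu_set 0 (cl_cell [:: V0]) = cl_cell [:: V0].
    apply: csetP => t; rewrite mu_set1 cl1E; split.
      by case=> g [-> [[]// _ /= ->]]; exists V0.
    by case=> g -> h; exists g; split=> //; exists V0 => //; case: g h.
  by split=> //; exact: molec_vertex.
- exists (fun _ _ => cl_cell [:: V2]).
  have -> : mu_set 0 (cl_cell [:: V1]) = cl_cell [:: V2].
    apply: csetP => t; rewrite mu_set1 cl1E; split.
      by case=> g [-> [[]// _ /= ->]]; exists V2.
    by case=> g -> h; exists g; split=> //; exists V1 => //; case: g h.
  by split=> //; exact: molec_vertex.
- have g1 := @molec_edge (Kcube2 1 1) E01 isT (fun v _ => K1 v).
  have g2 := @molec_edge (Kcube2 1 1) E12 isT (fun v _ => K1 v).
  have g := @molec_comp _ false 0 _ _ _ _ g1 g2 erefl (fun b q (h : q < 0) => False_ind _ (notF h)).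
  set D := compD _ _ _ _ in g.
  have clE : mu_set 0 (cl_cell [:: E01]) = cunion (cl_cell [:: E01]) (cl_cell [:: E12]).
    apply: csetP => t; rewrite mu_set1 /cunion !cl1E; split.
      by case=> g' [-> _]; case: g'; first [by left; exists V0 | by left; exists V1 |
        by right; exists V2 | by left; exists E01 | by right; exists E12].
    have h g' : exists g0, [:: g'] = [:: g0] /\ exists2 f', lef f' E01 & mu_fac f' g0.
      exists g'; split=> //; case: g';
          [exists V0|exists E01|exists V1|exists E01|exists E01] => //=; auto.
    by case=> -[g' -> _]; exact: h.
  exists D; split; rewrite ?clE //.
  + by move=> a [|p].
  + move=> _ a /=; have -> : D a 0 = cl_cell [:: if a then V2 else V0] by case: a.
    rewrite mu_setE; apply: csetP => t; rewrite cl1E; split.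
      case=> g' -> h; exists [:: vert a]; split; first by rewrite bd_cellE; case: a h.
      by apply/subdiv0; exists g' => //; case: a g' h => -[].
    case=> -[|h [|? ?]] []; rewrite bd_cellE /= ?andbF ?orbF //.
    rewrite andbT => /eqP-> /subdiv0[g' ->]; case: a => /= ->; by [exists V2|exists V0].
Qed.

Lemma mu_good_cat c1 k c : all isI c1 -> mu_good k c -> mu_good (size c1 + k) (c1 ++ c).
Proof.
elim: c1 => //= f c1 IH /andP[If Ic1] g; rewrite addSn.
have {}g := IH Ic1 g.
case: f If => // _; [exact: (mu_good_vert false)|exact: (mu_good_vert true)|exact: mu_good_E].
Qed.

Lemma mu_goodP k c : k < size c -> all isI c -> mu_good k c.
Proof.
move=> lt; rewrite -(cat_take_drop k c) (drop_nth V0 lt) all_cat /= => /and3P[I1 If I2].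
(* For [c = c1 f c2]: put [rev c2] to the left of [f], reverse to get [f c2], then put [c1] to the
   left. *)
have := mu_good_cat (c1 := rev (drop k.+1 c)) (k := 0) _ (mu_good1 If).
rewrite all_rev addn0 => /(_ I2) g.
have sz : size (rev (drop k.+1 c)) < size (rev (drop k.+1 c) ++ [:: nth V0 c k]).
  by rewrite size_cat addn1.
have := mu_good_rev sz g; rewrite size_cat addn1 subnn rev_cat revK => /(mu_good_cat I1).
by rewrite addn0 size_takel // ltnW.
Qed.

Lemma preserves_mu n k : k < n -> preserves (Kcube n) (Kcube2 n k.+1) (subdiv k).
Proof.
move=> lt; apply: preserves_gen => c [sc Ic]; rewrite -mu_setE.
have [|D [g Dtop Dbd]] := @mu_goodP k c _ Ic; first by rewrite sc.
rewrite sc in g.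
split=> [a p le|d a]; first by rewrite -{2}(Dtop a p le); exact: molec_Bd g.
by rewrite -Dbd //; exact: molec_Bd g.
Qed.

(** * Maps of cells acting on a window of factors *)

Lemma split_window (c : cell) j w : j + w <= size c ->
  exists c1 l c2, [/\ c = c1 ++ l ++ c2, size c1 = j & size l = w].
Proof.
move=> le; exists (take j c), (take w (drop j c)), (drop w (drop j c)).
rewrite !cat_take_drop !size_takel ?size_drop //; lia.
Qed.

Definition window (j w : nat) (phi : cell -> cell) (c : cell) : cell :=
  take j c ++ phi (take w (drop j c)) ++ drop (j + w) c.

Lemma window_cat j w phi c1 l c2 : size c1 = j -> size l = w ->
  window j w phi (c1 ++ l ++ c2) = c1 ++ phi l ++ c2.
Proof.
move=> <- <-; rewrite /window take_size_cat // drop_size_cat // take_size_cat //.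
by rewrite addnC -drop_drop drop_size_cat // drop_size_cat.
Qed.

(** The alternatives are a nondegenerate and a degenerate image, whose boundary is supplied by
    [bd_gen_face] and by [bd_gen_top] respectively. *)
Definition cell_ok (g : cell -> cell) (c : cell) : Prop :=
  img g (cl_cell c) = cl_cell (g c) /\
  ((cdim (g c) = cdim c /\ forall a, img g (bd_cell a c) = bd_cell a (g c)) \/
   (cdim (g c) < cdim c /\ forall a, img g (bd_cell a c) = cl_cell (g c))).

(* In the last case phi lowers the dimension of l, so that both boundaries of l must
   cover phi l. *)
Definition local_ok (phi : cell -> cell) (l : cell) : Prop :=
  [/\ forall t, leb t l -> leb (phi t) (phi l),
      forall m, leb m (phi l) -> exists2 t, leb t l & phi t = m &
  (cdim (phi l) = cdim l /\ forall a,
     (forall t, bdb a l t -> bdb a (phi l) (phi t)) /\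
     forall m, bdb a (phi l) m -> exists2 t, bdb a l t & phi t = m) \/
  (cdim (phi l) < cdim l /\
     forall a m, leb m (phi l) -> exists2 t, bdb a l t & phi t = m)].

Lemma cdim_cat c1 c2 : cdim (c1 ++ c2) = cdim c1 + cdim c2.
Proof. exact: count_cat. Qed.

(** By [bdb_cat] a face alters one of the three blocks, and its sign on [c2] depends on the
    dimension of the middle block, which the first alternative therefore preserves. If that
    dimension drops, the faces of the middle block of either sign already cover the image. *)
Lemma window_ok j w phi c1 l c2 : size c1 = j -> size l = w -> local_ok phi l ->
  cell_ok (window j w phi) (c1 ++ l ++ c2).
Proof.
move=> s1 sl [le1 le2 bd].
have ph t : leb t l -> size (phi t) = size (phi l) by move/le1/leb_size.
have spl (t : cell) : size t = size (c1 ++ l ++ c2) ->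
    exists t1 tl t2, [/\ t = t1 ++ tl ++ t2, size t1 = size c1 & size tl = size l].
  move=> st; have := @split_window t (size c1) _; apply; rewrite st !size_cat; lia.
have splg (t : cell) : size t = size (c1 ++ phi l ++ c2) ->
    exists t1 tl t2, [/\ t = t1 ++ tl ++ t2, size t1 = size c1 & size tl = size (phi l)].
  move=> st; have := @split_window t (size c1) _; apply; rewrite st !size_cat; lia.
have cl : img (window j w phi) (cl_cell (c1 ++ l ++ c2)) = cl_cell (c1 ++ phi l ++ c2).
  apply: csetP => m; rewrite !cl_cellE; split.
    case=> t [let_ ->].
    have [t1 [tl [t2 [et st1 stl]]]] := spl t (leb_size let_); subst t.
    have ltl : leb tl l by move: let_; rewrite !leb_cat // => /and3P[].
    rewrite window_cat ?st1 ?stl //; move: let_; rewrite !leb_cat ?ph //.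
    by case/and3P=> -> h ->; rewrite le1.
  move=> lem; have [t1 [tl [t2 [et st1 stl]]]] := splg m (leb_size lem); subst m.
  move: lem; rewrite !leb_cat // => /and3P[h1 /le2[t h h'] h2].
  exists (t1 ++ t ++ t2); rewrite !leb_cat ?(leb_size h) // h1 h h2; split=> //.
  by rewrite window_cat ?st1 ?(leb_size h) // h'.
split; first by rewrite window_cat.
rewrite window_cat // !cdim_cat.
case: bd => [[de bd]|[dl bd]].
  left; split; first by rewrite de.
  move=> a; apply: csetP => m; rewrite !bd_cellE; split.
    case=> t [bt ->].
    have [t1 [tl [t2 [et st1 stl]]]] := spl t (bdb_size bt); subst t.
    have ltl : leb tl l.
      by move/bdb_leb: bt; rewrite !leb_cat // => /and3P[].
    rewrite window_cat ?st1 ?stl //; move: bt; rewrite !bdb_cat ?ph // !leb_cat ?ph //.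
    case/orP=> [/and3P[-> _ ->]|/andP[-> /orP[/andP[/(proj1 (bd _)) -> ->]|/andP[_]]]].
    - by rewrite le1.
    - by rewrite orbT.
    - by rewrite de le1 //= => ->; rewrite !orbT.
  move=> bm; have [t1 [tl [t2 [et st1 stl]]]] := splg m (bdb_size bm); subst m.
  have [t lt et] : exists2 t, leb t l & phi t = tl.
    by apply: le2; move/bdb_leb: bm; rewrite !leb_cat // => /and3P[].
  have fin u : leb u l -> phi u = tl -> bdb a (c1 ++ l ++ c2) (t1 ++ u ++ t2) ->
      img (window j w phi) (fun t => bdb a (c1 ++ l ++ c2) t) (t1 ++ tl ++ t2).
    move=> lu eu b; exists (t1 ++ u ++ t2); split=> //.
    by rewrite window_cat ?st1 ?(leb_size lu) // eu.
  move: bm; rewrite !bdb_cat // !leb_cat //.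
  case/orP=> [/and3P[b1 _ l2]|/andP[l1 /orP[/andP[/(proj2 (bd _))[u bu eu] l2]|/andP[_ b2]]]].
  - by apply: (fin t) => //; rewrite !bdb_cat ?leb_cat ?(leb_size lt) // b1 lt l2.
  - apply: (fin u) => //; first exact: bdb_leb bu.
    by rewrite !bdb_cat ?leb_cat ?(bdb_size bu) // l1 bu l2 orbT.
  - by apply: (fin t) => //; rewrite !bdb_cat ?leb_cat ?(leb_size lt) // l1 lt -de b2 !orbT.
right; split; first by lia.
move=> a; apply: csetP => m; rewrite -cl bd_cellE cl_cellE; split.
  by case=> t [/bdb_leb lt ->]; exists t.
move=> h; have {h} : cl_cell (c1 ++ phi l ++ c2) m by rewrite -cl cl_cellE.
rewrite cl_cellE => lem; have [t1 [tl [t2 [et st1 stl]]]] := splg m (leb_size lem); subst m.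
move: lem; rewrite !leb_cat // => /and3P[h1 /(bd (a (+) odd (cdim c1)))[t h h'] h2].
exists (t1 ++ t ++ t2); rewrite !bdb_cat ?leb_cat ?(bdb_size h) // h1 h h2 orbT; split=> //.
by rewrite window_cat ?st1 ?(bdb_size h) // h'.
Qed.

Definition facs : seq fac := [:: V0; V1; V2; E01; E12].

Fixpoint cells (n : nat) : seq cell :=
  if n is n'.+1 then flatten [seq [seq f :: c | c <- cells n'] | f <- facs] else [:: [::]].

Lemma mem_cells n c : size c = n -> c \in cells n.
Proof.
elim: n c => [|n IH] [|f c] // [sc]; apply/flattenP.
exists [seq f :: c' | c' <- cells n]; last by apply: map_f; exact: IH.
by apply: (map_f (fun f => [seq f :: c' | c' <- cells n])); case: f.
Qed.

(** Subcells have the same length as the cell, so the quantifiers of [local_ok] range over finite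
    lists and each instance is settled by evaluation. *)
Definition local_okb (phi : cell -> cell) (l : cell) : bool :=
  let T := cells (size l) in let M := cells (size (phi l)) in
  [&& all (fun t => leb t l ==> leb (phi t) (phi l)) T,
      all (fun m => leb m (phi l) ==> has (fun t => leb t l && (phi t == m)) T) M &
  (cdim (phi l) == cdim l) && all (fun a =>
     all (fun t => bdb a l t ==> bdb a (phi l) (phi t)) T &&
     all (fun m => bdb a (phi l) m ==> has (fun t => bdb a l t && (phi t == m)) T) M)
     [:: true; false] ||
  (cdim (phi l) < cdim l) && all (fun a =>
     all (fun m => leb m (phi l) ==> has (fun t => bdb a l t && (phi t == m)) T) M)
     [:: true; false]].

Lemma local_okP phi l : local_okb phi l -> local_ok phi l.
Proof.
have bb (a : bool) : a \in [:: true; false] by case: a.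
case/and3P=> /allP h1 /allP h2 h3; split.
- move=> t lt; have /mem_cells /h1 := leb_size lt; by rewrite lt.
- move=> m lm; have /mem_cells /h2 := leb_size lm.
  by rewrite lm => /hasP[t _ /andP[? /eqP ?]]; exists t.
case/orP: h3 => /andP[d /allP h]; [left; split; first exact/eqP|right; split=> //].
  move=> a; have /andP[/allP h3 /allP h4] := h a (bb a); split.
    by move=> t lt; have /mem_cells /h3 := bdb_size lt; rewrite lt.
  move=> m lm; have /mem_cells /h4 := bdb_size lm.
  by rewrite lm => /hasP[t _ /andP[? /eqP ?]]; exists t.
move=> a m lm; have /allP h3 := h a (bb a); have /mem_cells /h3 := leb_size lm.
by rewrite lm => /hasP[t _ /andP[? /eqP ?]]; exists t.
Qed.

Definition graph (g : cell -> cell) (c : cell) : cset := fun t => t = g c.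

Lemma cell_ok_gen K' g c : cell_ok g c -> K' (g c) ->
  (forall a p, cdim c <= p -> Bd K' a p (ext (graph g) (cl_cell c)) (ext (graph g) (cl_cell c))) /\
  (0 < cdim c -> forall a,
     Bd K' a (cdim c).-1 (ext (graph g) (cl_cell c)) (ext (graph g) (bd_cell a c))).
Proof.
have imgE s : ext (graph g) s = img g s by [].
rewrite !imgE => -[-> bd] Kg; split=> [a p le|d a].
  by apply: bd_gen_top => //; case: bd => -[]; lia.
rewrite imgE; case: bd => -[d' ->]; last by apply: bd_gen_top => //; lia.
by rewrite -d'; apply: bd_gen_face; rewrite ?d'.
Qed.

(** * Push-outs along the middle of a subdivided cube *)

Lemma Mol_cells (K : cell -> Prop) s : (forall c t, K c -> leb t c -> K t) ->
  Mol K s -> forall t, s t -> K t.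
Proof.
move=> Kd; elim=> {s} [c Kc t|p x y z _ hx _ hy _ _ t [/hx|/hy] //|a p x y b].
  by rewrite cl_cellE => /(Kd _ _ Kc).
suff [h _] : (forall t, y t -> K t) /\ (forall t, x t -> K t) by exact: h.
elim: b => {a p x y}.
- by move=> a p c Kc _; split=> t; rewrite cl_cellE => /(Kd _ _ Kc).
- move=> a c Kc _; split=> t; rewrite ?cl_cellE ?bd_cellE; last exact: Kd.
  by move/bdb_leb; exact: Kd.
- by move=> a b p q x y z _ [? ?] _ [].
- by move=> a b p q x y _ [].
- by move=> p x y z w _ _ _ [? ?] _ [? ?] _ [? ?]; split=> // t []; auto.
- by move=> p x y z w _ _ _ [? ?] _ [? ?] _ [? ?]; split=> // t []; auto.
- by move=> b p q x y z u v _ _ _ [? ?] _ [? ?] _ _ [? ?] _ [? ?]; split=> // t []; auto.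
Qed.

Lemma Kcube_down n c t : Kcube n c -> leb t c -> Kcube n t.
Proof.
case=> <- Ic le; split; first exact: leb_size.
elim: t c le Ic => [|f t IH] [|g c] //= /andP[fg /IH h] /andP[Ig /h ->].
by rewrite andbT; case: f g fg Ig => -[].
Qed.

Lemma Mol_Kcube n s t : Mol (Kcube n) s -> s t -> Kcube n t.
Proof. by move/(Mol_cells (@Kcube_down n)); apply. Qed.

Lemma Kcube_Kcube2 n i c : Kcube n c -> Kcube2 n i c.
Proof.
case=> sc Ic; split=> // k _; case: (ltnP k (size c)) => lt; last by rewrite nth_default.
by have /all_nthP := Ic; apply.
Qed.

Lemma subdiv_cat c1 f c2 t : subdiv (size c1) (c1 ++ f :: c2) t <->
  exists2 g, t = c1 ++ g :: c2 & mu_fac f g.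
Proof.
elim: c1 t => [|g c1 IH] t /=; first exact: subdiv0.
rewrite subdivS; split; first by case=> t' -> /IH[g' -> m]; exists g'.
by case=> g' -> m; exists (c1 ++ g' :: c2) => //; apply/IH; exists g'.
Qed.

Lemma iota_plus_cat c1 f c2 : iota_plus (size c1) (c1 ++ f :: c2) = c1 ++ shift_fac f :: c2.
Proof.
rewrite /iota_plus nth_cat ltnn subnn /=.
by elim: c1 => //= g c1 ->.
Qed.

Lemma split_at (c : cell) k : k < size c ->
  exists c1 f c2, c = c1 ++ f :: c2 /\ size c1 = k.
Proof.
move=> lt; exists (take k c), (nth V0 c k), (drop k.+1 c).
by rewrite -drop_nth // cat_take_drop size_takel // ltnW.
Qed.

Lemma Kcube_cat n c1 f c2 : Kcube n (c1 ++ f :: c2) <->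
  [/\ (size c1 + size c2).+1 = n, all isI c1, isI f & all isI c2].
Proof.
rewrite /Kcube size_cat all_cat /= addnS.
by split; [case=> e /and3P[]|case=> e -> -> ->].
Qed.

Lemma Kcube2_cat n c1 f c2 : Kcube2 n (size c1).+1 (c1 ++ f :: c2) <->
  [/\ (size c1 + size c2).+1 = n, all isI c1 & all isI c2].
Proof.
rewrite /Kcube2 size_cat /= addnS; split.
  case=> e h; split=> //; apply/(all_nthP V0) => i lt.
    by have := h i; rewrite nth_cat lt; apply; lia.
  have := h ((size c1).+1 + i); rewrite nth_cat ltnNge ltnW ?leq_addr //=.
  have -> : (size c1).+1 + i - size c1 = i.+1 by lia.
  apply; lia.
case=> e /(all_nthP V0) h1 /(all_nthP V0) h2; split=> // k ne.
rewrite nth_cat; case: ltnP => [/h1 //|le].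
case e': (k - size c1) => [|d] /=; first by lia.
by case: (ltnP d (size c2)) => [/h2 //|le']; rewrite nth_default.
Qed.

Lemma Kcube2_cases n k c : k < n -> Kcube2 n k.+1 c ->
  Kcube n c \/ exists2 c', Kcube n c' & c = iota_plus k c'.
Proof.
move=> lt Kc; have [|c1 [f [c2 [ec s1]]]] := @split_at c k; first by case: Kc => ->.
subst; move/Kcube2_cat: Kc => [e I1 I2].
case: f; try by left; apply/Kcube_cat; split.
  right; exists (c1 ++ V1 :: c2); first exact/Kcube_cat.
  by rewrite iota_plus_cat.
right; exists (c1 ++ E01 :: c2); first exact/Kcube_cat.
by rewrite iota_plus_cat.
Qed.

Lemma leb_cat1 c1 f c2 t : leb t (c1 ++ f :: c2) <->
  exists t1 g t2, [/\ t = t1 ++ g :: t2, leb t1 c1, lef g f & leb t2 c2].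
Proof.
split; last first.
  by case=> t1 [g [t2 [-> h1 h2 h3]]]; rewrite leb_cat ?(leb_size h1) //= h1 h2.
move=> le; have := leb_size le; rewrite size_cat /= => st.
have [|t1 [g [t2 [et s1]]]] := @split_at t (size c1); first by rewrite st; lia.
subst; move: le; rewrite leb_cat //= => /and3P[h1 h2 h3].
by exists t1, g, t2.
Qed.

Lemma iota_plus_cl n k c : k < n -> Kcube n c ->
  img (iota_plus k) (cl_cell c) = cl_cell (iota_plus k c).
Proof.
move=> lt Kc; have [|c1 [f [c2 [ec s1]]]] := @split_at c k; first by case: Kc => ->.
subst; move/Kcube_cat: Kc => [e I1 If I2]; rewrite iota_plus_cat.
apply: csetP => t; rewrite !cl_cellE leb_cat1; split.
  case=> u [/leb_cat1[t1 [g [t2 [-> h1 h2 h3]]]] ->].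
  rewrite -(leb_size h1) iota_plus_cat; exists t1, (shift_fac g), t2; split=> //.
  by case: f g If h2 => -[].
case=> t1 [g [t2 [-> h1 h2 h3]]].
have [g' h4 ->] : exists2 g', lef g' f & g = shift_fac g'.
  by case: f If h2 => // _; case: g => // _;
    [exists V0|exists V1|exists V0|exists V1|exists E01].
exists (t1 ++ g' :: t2); rewrite -(leb_size h1) iota_plus_cat; split=> //.
by apply/leb_cat1; exists t1, g', t2.
Qed.

Section LambdaX.
Variable X : omega_category.
Implicit Types x y F : cset -> X.

(** Each cell of the subdivided cube lies in one of the halves, so morphisms with the same
    restrictions agree on its molecules, and [mu_set k s] is one by [preserves_mu]. The chosen
    morphism may thus be replaced by any convenient [F]. *)
Lemma lcomp_spec n k x y F : k < n -> hom (Kcube2 n k.+1) X F ->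
  (forall s, Mol (Kcube n) s -> F s = x s) ->
  (forall s, Mol (Kcube n) s -> F (img (iota_plus k) s) = y s) ->
  agree n (lcomp n k.+1 x y) (fun s => F (mu_set k s)).
Proof.
move=> lt hF Fx Fy s ms; rewrite /lcomp.
set P := fun F0 : cset -> X => _.
have [hF' [Fx' Fy']] : P (epsilon (inhabits x) P) by apply: epsilon_spec; exists F.
apply: (hom_eq_gen hF' hF); last by have [h _] := preserves_mu lt; apply: h.
move=> c Kc; have [Kc'|[c' Kc' ->]] := Kcube2_cases lt Kc.
  by rewrite Fx ?Fx' //; exact: mol_gen.
by rewrite -(iota_plus_cl lt) // Fy ?Fy' //; exact: mol_gen.
Qed.
End LambdaX.

(** The default branch includes the middle vertex [V1], sent to [[:: f; V0]]: the value of
    [Gamma^+ d^-] at the end of the first half and of the identity at the start of the second. *)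
Definition fold_left_loc (l : cell) : cell :=
  if l is [:: f; f'] then
    match f' with
    | E12 => [:: f; E01]
    | V2 => [:: f; V1]
    | _ => [:: merge_fac true f f'; V0]
    end
  else l.

Definition unshift_fac (f : fac) : fac :=
  match f with V1 => V0 | V2 => V1 | E12 => E01 | g => g end.

Definition fold_right_loc (l : cell) : cell :=
  if l is [:: f; f'] then [:: merge_fac false f (unshift_fac f'); V1] else l.

(* On the subdivided factor, fold_left is Gamma^+ d^- on the first half and the
   identity on the second; fold_halves is (Gamma^+ d^- o id) on the first half and
   Gamma^- d^+ on the second. *)
Definition fold_left (j : nat) : cell -> cell := window j 2 fold_left_loc.
Definition fold_right (j : nat) : cell -> cell := window j 2 fold_right_loc.

Definition fold_halves (j : nat) (c : cell) : cset :=
  if nth V0 c j.+1 is (E12 | V2) then graph (fold_right j) c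
  else ext (graph (fold_left j)) (subdiv j.+1 c).

Definition fold_rel (j : nat) (c : cell) : cset := ext (fold_halves j) (subdiv j.+1 c).

Lemma fold_left_loc_ok f f' : isI f -> local_ok fold_left_loc [:: f; f'].
Proof. by move=> If; apply: local_okP; case: f If; case: f'. Qed.

Lemma fold_right_loc_ok f f' : isI f -> f' \in [:: V1; E12;
    V2] -> local_ok fold_right_loc [:: f; f'].
Proof. by move=> If If'; apply: local_okP; case: f If; case: f' If'. Qed.

Lemma split2 (c : cell) j : j.+1 < size c ->
  exists c1 f f' c2, c = c1 ++ [:: f; f'] ++ c2 /\ size c1 = j.
Proof.
move=> lt; have [|c1 [l [c2 [-> s1]]]] := @split_window c j 2; first by lia.
case: l => [|f [|f' []]] // _; by exists c1, f, f', c2.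
Qed.

Lemma Kcube_cat2 n c1 f f' c2 : Kcube n (c1 ++ [:: f; f'] ++ c2) <->
  [/\ (size c1 + size c2).+2 = n, all isI c1, isI f, isI f' & all isI c2].
Proof.
rewrite /Kcube !size_cat !all_cat /= andbT !addnS -!andbA.
by split; [case=> e /and4P[]|case=> e -> -> -> ->].
Qed.

Lemma Kcube2_cat2 n j c1 f f' c2 : size c1 = j ->
  Kcube2 n j.+2 (c1 ++ [:: f; f'] ++ c2) <->
  [/\ (j + size c2).+2 = n, all isI c1, isI f & all isI c2].
Proof.
move=> <-; have := @Kcube2_cat n (c1 ++ [:: f]) f' c2.
rewrite -catA /= !size_cat /= addn1 => ->; rewrite all_cat /= andbT addSn.
by split; [case=> e /andP[? ?] ?|case=> e -> -> ?].
Qed.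

Lemma subdiv_cat2 j c1 f f' c2 t : size c1 = j -> subdiv j.+1 (c1 ++ [:: f; f'] ++ c2) t <->
  exists2 g, t = c1 ++ [:: f; g] ++ c2 & mu_fac f' g.
Proof.
by move=> <-; have := @subdiv_cat (c1 ++ [:: f]) f' c2 t; rewrite -catA /= size_cat /= addn1 => ->;
  split=> -[g -> m]; exists g; rewrite -?catA.
Qed.

Lemma nth_cat2 j c1 f f' (c2 : cell) : size c1 = j -> nth V0 (c1 ++ [:: f; f'] ++ c2) j.+1 = f'.
Proof. by move=> <-; rewrite nth_cat ltnNge leqnSn /= subSnn. Qed.

Lemma preserves_fold_left n j : j.+1 < n ->
    preserves (Kcube2 n j.+2) (Kcube n) (graph (fold_left j)).
Proof.
move=> lt; apply: preserves_gen => c Kc.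
have [|c1 [f [f' [c2 [ec s1]]]]] := @split2 c j; first by case: Kc => ->.
subst c; move/(Kcube2_cat2 n f f' c2 s1): Kc => [e I1 If I2].
apply: cell_ok_gen; first by apply: window_ok => //; exact: fold_left_loc_ok.
rewrite /fold_left window_cat //.
by case: f' => /=; apply/Kcube_cat2; rewrite s1; split=> //; case: f If.
Qed.

Lemma fold_halves_first j s : (forall t, s t -> nth V0 t j.+1 \notin [:: E12; V2]) ->
  ext (fold_halves j) s = ext (graph (fold_left j)) (mu_set j.+1 s).
Proof.
move=> h; rewrite mu_setE ext_comp; apply: eq_ext => c /h.
by rewrite /fold_halves; case: (nth _ _ _).
Qed.

(** By definition the middle vertex [V1] belongs to the first half, but there both prescriptions
    give the factors [[:: f; V1]]. Hence a closed cell of the second half is moved by the single map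
    [fold_right]. *)
Lemma fold_halves_second j c1 f f' c2 : size c1 = j -> isI f -> f' \in [:: V1; E12; V2] ->
  fold_halves j (c1 ++ [:: f; f'] ++ c2) = graph (fold_right j) (c1 ++ [:: f; f'] ++ c2).
Proof.
move=> s1 If; rewrite /fold_halves nth_cat2 //; case: f' => // _.
apply: csetP => t; rewrite /graph /fold_right window_cat //; split.
  case=> u [/(subdiv_cat2 _ _ _ _ s1)[g -> m] ->]; rewrite (m : g = V2) /fold_left window_cat //.
  by case: f If.
move=> ->; exists (c1 ++ [:: f; V2] ++ c2); split; first by apply/subdiv_cat2 => //; exists V2.
by rewrite /graph /fold_left window_cat //; case: f If.
Qed.

Lemma preserves_fold_halves n j : j.+1 < n -> preserves (Kcube2 n j.+2) (Kcube n) (fold_halves j).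
Proof.
move=> lt; apply: preserves_gen => c Kc.
have [|c1 [f [f' [c2 [ec s1]]]]] := @split2 c j; first by case: Kc => ->.
case: (boolP (f' \in [:: E12; V2])) => If'.
  subst c; move/(Kcube2_cat2 n f f' c2 s1): Kc => [e I1 If I2].
  have If3 : f' \in [:: V1; E12; V2] by rewrite inE If' orbT.
  have sub : forall s : cset, (forall t, s t -> leb t (c1 ++ [:: f; f'] ++ c2)) ->
      ext (fold_halves j) s = ext (graph (fold_right j)) s.
    move=> s h; apply: eq_ext => t /h le.
    have [|t1 [g [g' [t2 [et st]]]]] := @split2 t j.
      by rewrite (leb_size le) size_cat /= s1; lia.
    subst t; move: le; rewrite leb_cat ?s1 //= => /and4P[h1 h2 h3 h4].
    apply: fold_halves_second => //; first by move: If h2; clear; case: f; case: g.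
    by move: If' h3; clear; case: f'; case: g'.
  rewrite sub; last by move=> t; rewrite cl_cellE.
  have [] := @cell_ok_gen (Kcube n) (fold_right j) (c1 ++ [:: f; f'] ++ c2).
  - by apply: window_ok => //; exact: fold_right_loc_ok.
  - rewrite /fold_right window_cat //; apply/Kcube_cat2; rewrite s1; split=> //.
    by move: If' If; clear; case: f'; case: f.
  - move=> h1 h2; split=> // d a; rewrite (sub (bd_cell a _)); first exact: h2.
    by move=> t; rewrite bd_cellE; exact: bdb_leb.
have Kc' : Kcube n c.
  subst c; move/(Kcube2_cat2 n f f' c2 s1): Kc => [e I1 If I2].
  by apply/Kcube_cat2; rewrite s1; split=> //; case: f' If'.
have sub : forall s : cset, (forall t, s t -> leb t c) ->
    ext (fold_halves j) s = ext (graph (fold_left j)) (mu_set j.+1 s).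
  move=> s h; apply: fold_halves_first => t /h le.
  have [st /(all_nthP V0)/(_ j.+1)] := Kcube_down Kc' le.
  by rewrite st => /(_ lt); case: (nth _ _ _).
have [pm pb] := preserves_comp (preserves_fold_left lt) (preserves_mu lt).
rewrite sub; last by move=> t; rewrite cl_cellE.
rewrite mu_setE ext_comp; split=> [a p le|d a].
  by apply: pb; exact: bd_gen_top.
rewrite sub; last by move=> t; rewrite bd_cellE; exact: bdb_leb.
by rewrite mu_setE ext_comp; apply: pb; exact: bd_gen_face.
Qed.

Lemma preserves_fold_rel n j : j.+1 < n -> preserves (Kcube n) (Kcube n) (fold_rel j).
Proof. by move=> lt; apply: preserves_comp (preserves_fold_halves lt) (preserves_mu lt). Qed.

(** * Foldings as relations between cells *)

Lemma img_img g h s : img g (img h s) = img (fun c => g (h c)) s.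
Proof.
apply: csetP => t; split; first by case=> _ [[c [sc ->]] ->]; exists c.
by case=> c [sc ->]; exists (h c); split=> //; exists c.
Qed.

Lemma eq_img g h (s : cset) : (forall c, s c -> g c = h c) -> img g s = img h s.
Proof.
by move=> e; apply: csetP => t; split=> -[c [sc ->]]; exists c; rewrite e.
Qed.

Lemma ext_graph g s : ext (graph g) s = img g s.
Proof. by []. Qed.

Lemma ext_id s : ext (graph id) s = s.
Proof. by apply: csetP => t; split=> [[c [sc ->]]|st] //; exists t. Qed.

Lemma ins_gam n j a v c : j.+1 < n -> Kcube n c ->
  exists c1 f f' c2, [/\ c = c1 ++ [:: f; f'] ++ c2, size c1 = j, isI f, isI f' &
    ins j.+1 v (gam j a c) = c1 ++ [:: merge_fac a f f'; v] ++ c2].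
Proof.
move=> lt Kc; have [|c1 [f [f' [c2 [ec s1]]]]] := @split2 c j; first by case: Kc => ->.
move: Kc; rewrite ec => /Kcube_cat2[e I1 If If' I2].
exists c1, f, f', c2; split=> //.
have -> : gam j a (c1 ++ [:: f; f'] ++ c2) = (c1 ++ [:: merge_fac a f f']) ++ c2.
  rewrite /gam nth_cat2 // -s1 take_size_cat // nth_cat ltnn subnn -addn2 addnC -drop_drop.
  by rewrite drop_size_cat //= drop0 -catA.
have -> : j.+1 = size (c1 ++ [:: merge_fac a f f']) by rewrite size_cat addn1 s1.
by rewrite /ins take_size_cat // drop_size_cat // -catA.
Qed.

Section Folding.
Variable X : omega_category.
Implicit Types x y F : cset -> X.

(** The push-out morphisms of the inner and outer composition are [x] after [fold_left] and [x]
    after [fold_halves]; these are the witnesses for [lcomp_spec]. *)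
Lemma psi_spec n j x : j.+1 < n -> hom (Kcube n) X x ->
  agree n (psi n j.+1 x) (fun s => x (ext (fold_rel j) s)).
Proof.
move=> lt hx; rewrite /psi.
have unI f : isI f -> [/\ fold_left_loc [:: f; V1] = [:: f; V0], fold_left_loc [:: f;
    V2] = [:: f; V1] &
    fold_left_loc [:: f; E12] = [:: f; E01]] by case: f.
have inner : agree n (lcomp n j.+2 (lconn j.+1 true (lface j.+2 false x)) x)
    (fun s => x (ext (graph (fold_left j)) (mu_set j.+1 s))).
  apply: (@lcomp_spec X n j.+1 _ _ (fun s => x (ext (graph (fold_left j)) s))) => //.
  - exact: hom_preserves hx (preserves_fold_left lt).
  - move=> s ms; rewrite ext_graph /lconn /lface img_img /=; congr x; apply: eq_img => c sc.
    have [c1 [f [f' [c2 [ec s1 If If' ->]]]]] := ins_gam true V0 lt (Mol_Kcube ms sc).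
    by rewrite ec /fold_left window_cat //; case: f' If' {ec}.
  - move=> s ms; rewrite ext_graph img_img -[in RHS](ext_id s) ext_graph.
    congr x; apply: eq_img => c /(Mol_Kcube ms) Kc.
    have [|c1 [f [f' [c2 [ec s1]]]]] := @split2 c j; first by case: Kc => ->.
    move: Kc; rewrite ec => /Kcube_cat2[e I1 If If' I2].
    have := iota_plus_cat (c1 ++ [:: f]) f' c2.
    rewrite size_cat /= addn1 s1 -!catA /= => ->.
    rewrite -[c1 ++ _]/(c1 ++ [:: f; shift_fac f'] ++ c2) /fold_left window_cat //.
    by have [e1 e2 e3] := unI f If; case: f' If' {ec} => // _; rewrite ?e1 ?e2 ?e3.
apply: agree_trans (lcomp_spec (F := fun s => x (ext (fold_halves j) s)) _ _ _ _) _ => //.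
- exact: hom_preserves hx (preserves_fold_halves lt).
- move=> s ms; rewrite inner // fold_halves_first // =>
    t /(Mol_Kcube ms) [st /(all_nthP V0)/(_ j.+1)].
  by rewrite st => /(_ lt); case: (nth _ _ _).
- move=> s ms; rewrite /lconn /lface img_img -[in LHS](ext_id s) ext_graph img_img /=.
  congr x; rewrite -ext_graph ext_comp -ext_graph; apply: eq_ext => c /(Mol_Kcube ms) Kc.
  have [c1 [f [f' [c2 [ec s1 If If' ec']]]]] := ins_gam false V1 lt Kc.
  have iE : iota_plus j.+1 c = c1 ++ [:: f; shift_fac f'] ++ c2.
    by have := iota_plus_cat (c1 ++ [:: f]) f' c2;
    rewrite ec size_cat /= addn1 s1 -!catA.
  have -> : ext (fold_halves j) (graph (iota_plus j.+1) c) = fold_halves j (iota_plus j.+1 c).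
    apply: csetP => t; split; first by case=> u [-> ].
    by move=> h; exists (iota_plus j.+1 c).
  rewrite iE fold_halves_second //; last by case: f' If' {ec iE ec'}.
  by apply: csetP => t; rewrite /graph /fold_right window_cat // ec' ; case: f' If' {ec iE ec'}.
- by move=> s ms; rewrite mu_setE ext_comp.
Qed.
End Folding.

(** Precomposition reverses the order: the outermost [psi] acts on cells first, and [Phi_rel m]
    carries out [Psi_rel 1], ..., [Psi_rel m] in this order. *)
Fixpoint Psi_rel (r : nat) : cell -> cset :=
  if r is r'.+1 then
    if r' is j.+1 then fun c => ext (Psi_rel r') (fold_rel j c) else graph id
  else graph id.

Fixpoint Phi_rel (m : nat) : cell -> cset :=
  if m is m'.+1 then fun c => ext (Psi_rel m) (Phi_rel m' c) else graph id.

Lemma preserves_id K : preserves K K (graph id).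
Proof. by split=> *; rewrite !ext_id. Qed.

Lemma preserves_Psi_rel n r : r <= n -> preserves (Kcube n) (Kcube n) (Psi_rel r).
Proof.
elim: r => [|[|j] IH] lt; try exact: preserves_id.
by apply: preserves_comp (preserves_fold_rel lt); apply: IH; exact: ltnW.
Qed.

Lemma preserves_Phi_rel n m : m <= n -> preserves (Kcube n) (Kcube n) (Phi_rel m).
Proof.
elim: m => [|m IH] lt; first exact: preserves_id.
by apply: preserves_comp (preserves_Psi_rel lt) (IH _); exact: ltnW.
Qed.

Section FoldingPhi.
Variable X : omega_category.

Lemma Psi_spec n r (x : cset -> X) : r <= n -> hom (Kcube n) X x ->
  agree n (Psi n r x) (fun s => x (ext (Psi_rel r) s)).
Proof.
elim: r => [|[|j] IH] lt hx; try by move=> s _; rewrite ext_id.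
have h := IH (ltnW lt) hx.
have hP : hom (Kcube n) X (fun s => x (ext (Psi_rel j.+1) s)).
  by apply: hom_preserves hx _; apply: preserves_Psi_rel; exact: ltnW.
apply: agree_trans (psi_spec lt (hom_agree (agree_sym h) hP)) _.
move=> s ms; rewrite h; last by have [p _] := preserves_fold_rel lt; exact: p.
by rewrite ext_comp.
Qed.

Lemma Phi_spec n m (x : cset -> X) : m <= n -> hom (Kcube n) X x ->
  agree n (Phi n m x) (fun s => x (ext (Phi_rel m) s)).
Proof.
elim: m x => [|m IH] x lt hx; first by move=> s _; rewrite ext_id.
have h := Psi_spec lt hx.
have hP : hom (Kcube n) X (fun s => x (ext (Psi_rel m.+1) s)).
  by apply: hom_preserves hx _; exact: preserves_Psi_rel.
apply: agree_trans (IH _ (ltnW lt) (hom_agree (agree_sym h) hP)) _.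
move=> s ms; rewrite h; last by have [p _] := preserves_Phi_rel (ltnW lt); exact: p.
by rewrite ext_comp.
Qed.
End FoldingPhi.

(** Two subdivisions cut [[0,1]] into three edges with two inner vertices; the five pairs are their
    images under [Gamma^+ d^-], the identity and [Gamma^- d^+]. An endpoint [f'] is copied onto the
    factor before it. *)
Definition fold_pairs (f f' : fac) : seq (fac * fac) :=
  match f' with
  | V0 => [:: (V0, V0)]
  | V1 => [:: (V1, V1)]
  | _ => [:: (merge_fac true f E01, V0); (f, V0); (f, E01); (f, V1); (merge_fac false f E01, V1)]
  end.

Lemma fold_relE j c1 f f' c2 t : size c1 = j -> isI f -> isI f' ->
  fold_rel j (c1 ++ [:: f; f'] ++ c2) t <->
  exists2 p, p \in fold_pairs f f' & t = c1 ++ [:: p.1; p.2] ++ c2.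
Proof.
move=> s1 If If'.
have wE h u : ext (graph (fold_left j)) (subdiv j.+1 (c1 ++ [:: f; h] ++ c2)) u <->
    exists2 g, mu_fac h g & u = c1 ++ fold_left_loc [:: f; g] ++ c2.
  split; first by case=> v [/(subdiv_cat2 _ _ _ _ s1)[g -> m] ->]; exists g;
      rewrite /fold_left ?window_cat.
  case=> g m ->; exists (c1 ++ [:: f; g] ++ c2); rewrite /graph /fold_left window_cat //;
      split=> //.
  by apply/subdiv_cat2 => //; exists g.
have RE : fold_rel j (c1 ++ [:: f; f'] ++ c2) t <->
    exists2 g, mu_fac f' g & fold_halves j (c1 ++ [:: f; g] ++ c2) t.
  split; first by case=> v [/(subdiv_cat2 _ _ _ _ s1)[g -> m] h]; exists g.
  by case=> g m h; exists (c1 ++ [:: f; g] ++ c2); split=> //; apply/subdiv_cat2 => //; exists g.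
have W1E h : h \in [:: V0; V1; E01] -> fold_halves j (c1 ++ [:: f; h] ++ c2) t <->
    exists2 g, mu_fac h g & t = c1 ++ fold_left_loc [:: f; g] ++ c2.
  by move=> hh; rewrite -wE /fold_halves nth_cat2 //; case: h hh.
have W3E h : h \in [:: V1; E12; V2] -> fold_halves j (c1 ++ [:: f; h] ++ c2) t <->
    t = c1 ++ fold_right_loc [:: f; h] ++ c2.
  by move=> hh; rewrite fold_halves_second // /graph /fold_right window_cat.
rewrite RE; case: f' If' {RE} => // _; split.
- by case=> g -> /(W1E V0 isT)[g' -> ->]; exists (V0, V0) => //; case: f If {wE W1E W3E}.
- case=> p; rewrite inE => /eqP-> et; exists V0 => //; apply/(W1E V0 isT).
  by exists V0 => //; rewrite et; case: f If {wE W1E W3E et}.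
- by case=> g -> /(W3E V2 isT) ->; exists (V1, V1) => //; case: f If {wE W1E W3E}.
- case=> p; rewrite inE => /eqP-> et; exists V2 => //; apply/(W3E V2 isT).
  by rewrite et; case: f If {wE W1E W3E et}.
- case=> g [->|[->|->]].
  + case/(W1E E01 isT)=> g' [->|[->|->]] ->.
    * by exists (merge_fac true f E01, V0); rewrite ?inE ?eqxx.
    * by exists (f, V0); rewrite ?inE ?eqxx ?orbT //; case: f If {wE W1E W3E}.
    * by exists (f, E01); rewrite ?inE ?eqxx ?orbT.
  + case/(W1E V1 isT)=> g' -> ->.
    by exists (f, V1); rewrite ?inE ?eqxx ?orbT.
  + by move/(W3E E12 isT)=> ->; exists (merge_fac false f E01, V1); rewrite ?inE ?eqxx ?orbT.
- case=> p; rewrite !inE => /or4P[/eqP->|/eqP->|/eqP->|/orP[]/eqP->] et.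
  + by exists E01; [left|apply/(W1E E01 isT); exists E01 => //; left].
  + exists E01; [by left|apply/(W1E E01 isT); exists V1; first by right; left].
    by rewrite et; case: f If {wE W1E W3E et}.
  + by exists E01; [left|apply/(W1E E01 isT); exists E12 => //; right; right].
  + by exists V1; [right; left|apply/(W1E V1 isT); exists V2].
  + by exists E12; [right; right|apply/(W3E E12 isT)].
Qed.

(** * The collapse of the cube onto the globe *)

(* The image of c in the globe: (q, b) is the q-cell of sign b, and the top cell of
   the n-globe is (n, false). *)
Fixpoint globe_cell (c : cell) : nat * bool :=
  if c is f :: c' then
    if all isE c' then (if isE f then ((size c').+1, false) else (size c', f == V1))
    else globe_cell c'
  else (0, false).

Definition globe_bd (a : bool) (p : nat) (e : nat * bool) : nat * bool :=
  if e.1 <= p then e else (p, a).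

Definition globe_le (e' e : nat * bool) : Prop := e' = e \/ e'.1 < e.1.

Lemma globe_le_trans e1 e2 e3 : globe_le e1 e2 -> globe_le e2 e3 -> globe_le e1 e3.
Proof. by case=> [->//|h] [<-|h']; right=> //; exact: ltn_trans h'. Qed.

Lemma globe_cell_allE c : all isE c -> globe_cell c = (size c, false).
Proof. by case: c => //= f c /andP[-> ->]. Qed.

Lemma globe_cell_lt c : ~~ all isE c -> (globe_cell c).1 < size c.
Proof.
elim: c => //= f c IH; case: ifP => [_|/negbT /IH h _]; last exact: ltnW.
by rewrite andbT => /negbTE ->.
Qed.

Lemma globe_cell_le c : (globe_cell c).1 <= size c.
Proof. by case: (boolP (all isE c)) => [/globe_cell_allE ->|/globe_cell_lt/ltnW]. Qed.

Lemma all_isE_cdim c : all isE c -> cdim c = size c.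
Proof. by rewrite all_count => /eqP. Qed.

Lemma globe_cell_dim c : (globe_cell c).1 <= cdim c.
Proof.
elim: c => //= f c IH; case: ifP => [/all_isE_cdim|_]; rewrite /cdim in IH *.
  by move=> ->; case: (isE f).
exact: leq_trans (leq_addl _ _).
Qed.

Lemma globe_cell_cat c1 c2 : ~~ all isE c2 -> globe_cell (c1 ++ c2) = globe_cell c2.
Proof. by move=> n; elim: c1 => //= f c1 IH; rewrite all_cat (negbTE n) andbF. Qed.

Lemma globe_cell_vertex c1 v c2 : ~~ isE v -> all isE c2 ->
    globe_cell (c1 ++ v :: c2) = (size c2, v == V1).
Proof.
by move=> nv Ec; rewrite globe_cell_cat /= ?Ec ?(negbTE nv).
Qed.

Lemma globe_cell_cat_ge c1 c2 : all isE c2 -> size c2 <= (globe_cell (c1 ++ c2)).1.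
Proof.
move=> Ec; elim: c1 => [|f c1 IH] /=; first by rewrite globe_cell_allE.
case: ifP => // _; rewrite size_cat; case: (isE f) => /=; lia.
Qed.

Lemma leb_globe_cell t c : all isI c -> leb t c -> globe_le (globe_cell t) (globe_cell c).
Proof.
elim: c t => [|f c IH] [|f' t] //=; first by left.
case/andP=> If Ic /andP[lf lt]; have st := leb_size lt.
case: (boolP (all isE c)) => Ec; last first.
  case: (boolP (all isE t)) => Et; last exact: IH.
  have := IH t Ic lt; rewrite (globe_cell_allE Et) st /globe_le => -[e|/=].
    by have := globe_cell_lt Ec; rewrite -e ltnn.
  by move/ltn_trans => /(_ _ (globe_cell_lt Ec)); rewrite ltnn.
case: (boolP (all isE t)) => Et; last first.
  right; apply: leq_trans (globe_cell_lt Et) _; rewrite st; by case: (isE f).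
rewrite st; case: f If lf => // _; case: f' => //= _; first [by left|by right].
Qed.

Lemma globe_le_globe_cell c e : all isI c -> globe_le e (globe_cell c) -> exists2 t,
    leb t c & globe_cell t = e.
Proof.
elim: c e => [|f c IH] e /=; first by move=> _ [->|//]; exists [::].
case/andP=> If Ic h; case: (h) => [->|lt].
  by exists (f :: c) => //; rewrite /= lef_refl leb_refl.
case: (boolP (all isE c)) lt => Ec lt; last first.
  have [t le et] := IH e Ic (or_intror lt); exists (f :: t); first by rewrite /= lef_refl.
  rewrite /= et; case: ifP => // Et; move: lt; rewrite -et (globe_cell_allE Et) (leb_size le) /=.
  by rewrite ltnNge globe_cell_le.
have low (g : fac) : lef g f -> e.1 < size c -> exists2 t, leb t (f :: c) & globe_cell t = e.
  move=> gf lt'; have [|t le et] := IH e Ic; first by right; rewrite globe_cell_allE.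
  exists (g :: t); first by rewrite /= gf.
  rewrite /= et; case: ifP => // Et; move: lt'; rewrite -et (globe_cell_allE Et) (leb_size le) /=.
  by rewrite ltnn.
case Ef: (isE f) lt => /= lt; last exact: low (lef_refl f) lt.
move: lt; rewrite ltnS leq_eqVlt => /orP[/eqP es|]; last exact/low/lef_refl.
(* The cells of codimension one in the globe come from the ends of the leading interval; all lower
   ones are found in the tail. *)
exists (vert e.2 :: c).
  by rewrite /= leb_refl andbT; case: f If Ef {h low} => // _ _; case: e.2.
by rewrite /= Ec; case: e es {h low} => q b /= ->; case: b.
Qed.

Lemma bdb_notE a c t : bdb a c t -> ~~ all isE t.
Proof.
elim: c a t => [|f c IH] a [|g t] //= /orP[/andP[/andP[Ef /eqP->] _]|].
  by case: a f Ef => -[].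
by case/andP=> _ /IH /negbTE ->; rewrite andbF.
Qed.

(** If only intervals follow a leading interval, its end of sign [a] maps onto [(q, a)], with [q]
    the length of the tail, and the other boundary cells land strictly lower. If an endpoint occurs
    later, the image has dimension below that of the cell and is covered by the ends of the leading
    interval. A leading endpoint defers to the tail. *)
Lemma bd_globe_cell a c e : all isI c -> 0 < cdim c ->
  (exists2 t, bdb a c t & globe_cell t = e) <-> globe_le e (globe_bd a (cdim c).-1 (globe_cell c)).
Proof.
elim: c a e => [//|f c IH] a e /= /andP[If Ic].
case Ef: (isE f); rewrite /= ?add0n ?add1n => d; last first.
  have {}IH := IH a e Ic d.
  have key t : bdb a c t -> globe_cell (f :: t) = globe_cell t.
    by move=> /bdb_notE /=; case: ifP.
  have fE g : lef g f -> g = f by case: f If Ef {key} => // _ _; case: g.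
  have -> : globe_bd a (cdim c).-1 (if all isE c then (size c, f == V1) else globe_cell c) =
      globe_bd a (cdim c).-1 (globe_cell c).
    case: ifP => // Ec; rewrite (globe_cell_allE Ec) /globe_bd (all_isE_cdim Ec) /=.
    by rewrite (all_isE_cdim Ec) in d; case: (size c) d => // n; rewrite ltnn.
  rewrite -IH; split=> -[].
    case=> [//|g t]; rewrite addbF => /andP[/fE -> b] et; exists t => //; by rewrite -key.
  by move=> t b et; exists (f :: t); rewrite ?key // lef_refl addbF.
rewrite -/(cdim c); case: (boolP (all isE c)) => Ec.
  have -> : globe_bd a (cdim c) ((size c).+1, false) = (size c, a).
    by rewrite /globe_bd (all_isE_cdim Ec) /= ltnn.
  split.
    case=> -[//|g t] /orP[/andP[/eqP -> le]|/andP[_ b]] <- /=.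
      case: ifP => Et; last by right; rewrite -(leb_size le); apply: globe_cell_lt; rewrite Et.
      left; rewrite (leb_size le); by case: (f) If Ef => // _ _; case: a.
    have Et := bdb_notE b; rewrite (negbTE Et); right; rewrite -(bdb_size b); exact: globe_cell_lt.
  case=> [->|/= lt].
    exists (endp a f :: c); first by rewrite eqxx leb_refl.
    by rewrite /= Ec; case: (f) If Ef => // _ _; case: a.
  have [|t le et] := @globe_le_globe_cell c e Ic; first by right; rewrite globe_cell_allE.
  exists (endp a f :: t); first by rewrite eqxx le.
  by rewrite /= et; case: ifP => // Et; move: lt; rewrite -et globe_cell_allE // (leb_size le) ltnn.
have -> : globe_bd a (cdim c) (globe_cell c) = globe_cell c by rewrite /globe_bd globe_cell_dim.
have key g t : leb t c -> globe_cell (g :: t) = globe_cell t.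
  move=> le /=; case: ifP => // Et; have := leb_globe_cell Ic le.
  rewrite (globe_cell_allE Et) (leb_size le) => -[e'|/=]; have := globe_cell_lt Ec;
      rewrite -?e' /=; lia.
split.
  case=> -[//|g t] /orP[/andP[_ le]|/andP[_ /bdb_leb le]] <-; rewrite key //; exact: leb_globe_cell.
case/(globe_le_globe_cell Ic)=> t le <-; exists (endp a f :: t); last exact: key.
by rewrite eqxx le.
Qed.

(* The image of s is the closed cell e of the globe. *)
Definition atom (s : cset) (e : nat * bool) : Prop :=
  forall e', (exists2 t, s t & globe_cell t = e') <-> globe_le e' e.

Lemma atom_cl n c : Kcube n c -> atom (cl_cell c) (globe_cell c).
Proof.
case=> _ Ic e'; rewrite cl_cellE; split; last exact: globe_le_globe_cell.
by case=> t le <-; exact: leb_globe_cell.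
Qed.

Lemma atom_bd n a c : Kcube n c -> 0 < cdim c ->
  atom (bd_cell a c) (globe_bd a (cdim c).-1 (globe_cell c)).
Proof. by case=> _ Ic d e'; rewrite bd_cellE; exact: bd_globe_cell. Qed.

Lemma globe_le_anti e e' : globe_le e e' -> globe_le e' e -> e = e'.
Proof. by case=> [//|h] [->//|h']; have := ltn_trans h h'; rewrite ltnn. Qed.

Lemma atom_uniq s e e' : atom s e -> atom s e' -> e = e'.
Proof.
by move=> h h'; apply: globe_le_anti; [apply/h'/h; left|apply/h/h'; left].
Qed.

Lemma atom_cunion x y e e' : atom x e -> atom y e' -> globe_le e e' -> atom (cunion x y) e'.
Proof.
move=> hx hy le e''; split.
  case=> t [xt|yt] et; last by apply/hy; exists t.
  by apply: globe_le_trans le; apply/hx; exists t.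
by case/hy=> t yt et; exists t => //; right.
Qed.

Lemma globe_le_globe_bd a p e : globe_le (globe_bd a p e) e.
Proof. by rewrite /globe_bd; case: leqP => [_|lt]; [left|right]. Qed.

(** * Attaching codes to molecules *)

Section CodeInduction.
Variables (K : cell -> Prop) (E : Type) (d : bool -> nat -> E -> E).
Variables (at_ : cset -> E -> Prop) (ok : E -> Prop) (jn : nat -> E -> E -> E).
Hypothesis at_uniq : forall s e e', at_ s e -> at_ s e' -> e = e'.
Hypothesis at_gen : forall c, K c -> exists e, [/\ ok e, at_ (cl_cell c) e,
  forall a p, cdim c <= p -> d a p e = e &
  0 < cdim c -> forall a, at_ (bd_cell a c) (d a (cdim c).-1 e)].
Hypothesis ok_d : forall a p e, ok e -> ok (d a p e).
Hypothesis dd_lt : forall a b p q e, q < p -> d b q (d a p e) = d b q e.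
Hypothesis dd_ge : forall a b p q e, p <= q -> d b q (d a p e) = d a p e.
Hypothesis jnP : forall p e e', ok e -> ok e' -> d true p e = d false p e' ->
  [/\ ok (jn p e e'),
      forall x y, at_ x e -> at_ y e' -> at_ (cunion x y) (jn p e e'),
      d false p (jn p e e') = d false p e, d true p (jn p e e') = d true p e' &
      forall b q u v, q <> p -> at_ u (d b q e) -> at_ v (d b q e') ->
        at_ (cunion u v) (d b q (jn p e e'))].

(** Uniqueness identifies the codes found for different premises of a rule. The codes will be images
    in the globe, and pairs of images for a subdivided cube, where [ok] is the invariant satisfied
    by the pairs. *)
Lemma code_ind :
  (forall s, Mol K s -> exists2 e, ok e & at_ s e) /\
  (forall a p x y, Bd K a p x y -> exists e, [/\ ok e, at_ x e & at_ y (d a p e)]).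
Proof.
have comp p x y z : (exists2 e, ok e & at_ x e) -> (exists2 e, ok e & at_ y e) ->
   (exists e, [/\ ok e, at_ x e & at_ z (d true p e)]) ->
   (exists e, [/\ ok e, at_ y e & at_ z (d false p e)]) ->
   exists e e', [/\ ok e, ok e', at_ x e, at_ y e' & d true p e = d false p e'].
  move=> _ _ [e [oe xe ze]] [e' [oe' ye' ze']]; exists e, e'; split=> //.
  exact: at_uniq ze ze'.
apply: Mol_Bd_mut.
- by move=> c /at_gen[e [? ? _ _]]; exists e.
- move=> p x y z _ hx _ hy _ hz _ hz'.
  have [e [e' [oe oe' xe ye' ee']]] := comp _ _ _ _ hx hy hz hz'.
  by have [? h _ _ _] := jnP oe oe' ee'; exists (jn p e e') => //; exact: h.
- by move=> a p x y _ [e [oe xe ye]]; exists (d a p e) => //; exact: ok_d.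
- by move=> a p c /at_gen[e [? ? de _]] le; exists e; rewrite de.
- by move=> a c /at_gen[e [? ? _ be]] /be h; exists e.
- move=> a b p q x y z _ [e [oe xe ye]] _ [e' [oe' ye' ze']] lt; exists e; split=> //.
  by rewrite -(dd_lt a b e lt) (at_uniq ye ye').
- move=> a b p q x y _ [e [oe xe ye]] le; exists (d a p e); split=> //; first exact: ok_d.
  by rewrite dd_ge.
- move=> p x y z w _ hx _ hy _ hz _ hz' _ [e1 [oe1 xe1 we1]].
  have [e [e' [oe oe' xe ye' ee']]] := comp _ _ _ _ hx hy hz hz'.
  have [? h hl _ _] := jnP oe oe' ee'; exists (jn p e e'); split=> //; first exact: h.
  by rewrite hl (at_uniq xe xe1).
- move=> p x y z w _ hx _ hy _ hz _ hz' _ [e1 [oe1 ye1 we1]].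
  have [e [e' [oe oe' xe ye' ee']]] := comp _ _ _ _ hx hy hz hz'.
  have [? h _ hr _] := jnP oe oe' ee'; exists (jn p e e'); split=> //; first exact: h.
  by rewrite hr (at_uniq ye' ye1).
- move=> b p q x y z u v _ hx _ hy _ hz _ hz' ne _ [e1 [oe1 xe1 ue1]] _ [e2 [oe2 ye2 ve2]].
  have [e [e' [oe oe' xe ye' ee']]] := comp _ _ _ _ hx hy hz hz'.
  have [? h _ _ ho] := jnP oe oe' ee'; exists (jn p e e'); split=> //; first exact: h.
  by apply: ho => //; [rewrite (at_uniq xe xe1)|rewrite (at_uniq ye' ye2)].
Qed.
End CodeInduction.

Lemma globe_bd_lt a b p q e : q < p -> globe_bd b q (globe_bd a p e) = globe_bd b q e.
Proof.
rewrite /globe_bd => lt; case: (leqP e.1 p) => //= h.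
by rewrite !ifN // -ltnNge // (ltn_trans lt).
Qed.

Lemma globe_bd_ge a b p q e : p <= q -> globe_bd b q (globe_bd a p e) = globe_bd a p e.
Proof.
rewrite /globe_bd => le; case: (leqP e.1 p) => /= h; last by rewrite le.
by rewrite (leq_trans h).
Qed.

(* Composites in the globe are trivial: one of the two cells is an identity. *)
Definition globe_comp (p : nat) (e e' : nat * bool) : nat * bool := if e.1 <= p then e' else e.

Lemma globe_bd_eq p e e' : globe_bd true p e = globe_bd false p e' ->
  (e.1 <= p /\ e = globe_bd false p e') \/ (e'.1 <= p /\ e' = globe_bd true p e).
Proof.
rewrite /globe_bd; case: (leqP e.1 p) => h; first by left.
by case: (leqP e'.1 p) => h' ; [right|].
Qed.

Lemma globe_compP p e e' : globe_bd true p e = globe_bd false p e' ->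
  [/\ forall x y, atom x e -> atom y e' -> atom (cunion x y) (globe_comp p e e'),
      globe_bd false p (globe_comp p e e') = globe_bd false p e,
      globe_bd true p (globe_comp p e e') = globe_bd true p e' &
      forall b q u v, q <> p -> atom u (globe_bd b q e) -> atom v (globe_bd b q e') ->
        atom (cunion u v) (globe_bd b q (globe_comp p e e'))].
Proof.
move=> ee'; rewrite /globe_comp; case: (leqP e.1 p) => [h|h].
  have {}ee' : e = globe_bd false p e' by move: ee'; rewrite {1}/globe_bd h.
  split=> //.
  - by move=> x y hx hy; apply: atom_cunion hx hy _; rewrite ee'; exact: globe_le_globe_bd.
  - by rewrite ee' globe_bd_ge.
  - move=> b q u v ne hu hv; apply: atom_cunion hu hv _; rewrite ee'.
    have [lt|le] := ltnP q p; first by rewrite globe_bd_lt //; left.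
    rewrite globe_bd_ge //; rewrite /globe_bd; case: (leqP e'.1 p) => h1; case: (leqP e'.1 q) => h2;
      by [left|right|right=> /=; lia].
have {}ee' : e' = globe_bd true p e by case: (globe_bd_eq ee') => -[]; rewrite // leqNgt h.
split=> //.
- by move=> x y hx hy; rewrite cunionC; apply: atom_cunion hy hx _; rewrite ee';
    exact: globe_le_globe_bd.
- by rewrite ee' globe_bd_ge.
- move=> b q u v ne hu hv; rewrite cunionC; apply: atom_cunion hv hu _; rewrite ee'.
  have [lt|le] := ltnP q p; first by rewrite globe_bd_lt //; left.
  rewrite globe_bd_ge //; rewrite /globe_bd; case: (leqP e.1 p) => h1; case: (leqP e.1 q) => h2;
    by [left|right|right=> /=; lia].
Qed.

Lemma atom_ind n :
  (forall s, Mol (Kcube n) s -> exists2 e, True & atom s e) /\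
  (forall a p x y, Bd (Kcube n) a p x y -> exists e, [/\ True, atom x e & atom y (globe_bd a p e)]).
Proof.
apply: (code_ind (jn := globe_comp) atom_uniq) => //.
- move=> c Kc; exists (globe_cell c); split=> //; first exact: atom_cl Kc.
    by move=> a p le; rewrite /globe_bd (leq_trans (globe_cell_dim c)).
  by move=> d a; exact: atom_bd Kc d.
- exact: globe_bd_lt.
- exact: globe_bd_ge.
- by move=> p e e' _ _ /globe_compP[].
Qed.

(** * Folded morphisms *)

(** The first clause and the bound by [globe_le] leave the image of a set in the globe unchanged
    ([keeps_atom]); the fixed factors from [r] on let the stages of [Phi_rel] be followed one by
    one. *)
Definition keeps (n r : nat) (T : cell -> cset) : Prop := forall c, Kcube n c ->
  (exists2 t, T c t & globe_cell t = globe_cell c) /\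
  forall t, T c t -> [/\ Kcube n t, drop r t = drop r c & globe_le (globe_cell t) (globe_cell c)].

Lemma keeps_id n r : keeps n r (graph id).
Proof.
move=> c Kc; split; first by exists c.
by move=> t ->; split=> //; left.
Qed.

Lemma keeps_comp n r T U : keeps n r T -> keeps n r U -> keeps n r (fun c => ext T (U c)).
Proof.
move=> hT hU c Kc; have [[u cu ue] hu] := hU c Kc; split.
  have [Ku _ _] := hu u cu; have [[t ut te] _] := hT u Ku.
  by exists t; [exists u|rewrite te].
move=> t [v [cv vt]]; have [Kv dv lv] := hu v cv.
have [_ ht] := hT v Kv; have [Kt dt lt] := ht t vt.
by split=> //; [rewrite dt|exact: globe_le_trans lv].
Qed.

Lemma keeps_le n r r' T : r <= r' -> keeps n r T -> keeps n r' T.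
Proof.
move=> le h c Kc; have [ex al] := h c Kc; split=> // t /al[Kt dt lt]; split=> //.
by rewrite -(subnK le) -!drop_drop dt.
Qed.

(** An endpoint among [c2] or at [f'] determines the image and is not moved. Otherwise [f'] is an
    interval and [(f, f')] keeps the image, while any other pair puts an endpoint just before [c2]
    and lowers the dimension. *)
Lemma keeps_fold_rel n j : j.+1 < n -> keeps n j.+2 (fold_rel j).
Proof.
move=> lt c Kc; have [|c1 [f [f' [c2 [ec s1]]]]] := @split2 c j; first by case: Kc => ->.
move: Kc; rewrite ec => Kc; have /Kcube_cat2[e I1 If If' I2] := Kc.
have Kp p : p \in fold_pairs f f' -> isI p.1 && isI p.2.
  move: If If'; clear; case: f' => // If _; rewrite !inE; first by move/eqP=> ->.
    by move/eqP=> ->.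
  by case/or4P=> [|||/orP[]] /eqP->; rewrite /= ?If //; case: f If.
have dE g g' : drop j.+2 (c1 ++ [:: g; g'] ++ c2) = c2.
  have -> : j.+2 = size (c1 ++ [:: g; g']) by rewrite size_cat /= s1; lia.
  by rewrite catA drop_size_cat.
have cE g g' : c1 ++ [:: g; g'] ++ c2 = (c1 ++ [:: g]) ++ g' :: c2 by rewrite -catA.
have gE p : p \in fold_pairs f f' ->
    globe_le (globe_cell (c1 ++ [:: p.1; p.2] ++ c2)) (globe_cell (c1 ++ [:: f; f'] ++ c2)).
  case: (boolP (all isE c2)) => E2 hp; last first.
    by left; rewrite !cE !globe_cell_cat //= ?(negbTE E2) ?andbF.
  case: (boolP (isE f')) => Ef'; last first.
    have p2 : p.2 = f'.
      by move: If' Ef' hp; clear; case: f' => // _ _; rewrite inE => /eqP->.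
    by left; rewrite !cE p2 !globe_cell_vertex.
  have f'E : f' = E01 by move: If' Ef'; clear; case: f'.
  have [->|nE] := eqVneq p (f, f'); first by left.
  right; rewrite [X in globe_cell X]cE globe_cell_vertex //; last first.
    by move: hp nE; rewrite f'E !inE => /or4P[/eqP->|/eqP->|/eqP->|/orP[]/eqP->] //; rewrite eqxx.
  have := @globe_cell_cat_ge (c1 ++ [:: f]) (f' :: c2); rewrite /= Ef' E2 => /(_ isT).
  by rewrite -catA.
split.
  have [p hp gp] : exists2 p, p \in fold_pairs f f' &
      globe_cell (c1 ++ [:: p.1; p.2] ++ c2) = globe_cell (c1 ++ [:: f; f'] ++ c2).
    move: If'; case: (f') => // _.
    - exists (V0, V0); rewrite ?inE //= !cE; case: (boolP (all isE c2)) => E2.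
        by rewrite !globe_cell_vertex.
      by rewrite !globe_cell_cat //= ?(negbTE E2).
    - exists (V1, V1); rewrite ?inE //= !cE; case: (boolP (all isE c2)) => E2.
        by rewrite !globe_cell_vertex.
      by rewrite !globe_cell_cat //= ?(negbTE E2).
    - by exists (f, E01); rewrite ?inE ?eqxx ?orbT.
  by exists (c1 ++ [:: p.1; p.2] ++ c2) => //; apply/fold_relE => //; exists p.
move=> t /(fold_relE _ _ s1 If If')[p hp ->]; split; [|by rewrite !dE|exact: gE].
by apply/Kcube_cat2; case/andP: (Kp p hp) => ? ?; split.
Qed.

Lemma keeps_Psi_rel n r : r <= n -> keeps n r (Psi_rel r).
Proof.
elim: r => [|[|j] IH] lt; try exact: keeps_id.
apply: keeps_comp (keeps_fold_rel lt); apply: keeps_le (IH (ltnW lt)) => //.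
Qed.

Lemma keeps_Phi_rel n m : m <= n -> keeps n m (Phi_rel m).
Proof.
elim: m => [|m IH] lt; first exact: keeps_id.
by apply: keeps_comp (keeps_Psi_rel lt) (keeps_le _ (IH (ltnW lt))).
Qed.

(** For an endpoint [v] the only pair in [fold_pairs f v] is [(v, v)], so each folding copies [v]
    one place to the left. *)
Lemma Psi_rel_vertex n c1 v c2 : Kcube n (c1 ++ v :: c2) -> ~~ isE v ->
  Psi_rel (size c1).+1 (c1 ++ v :: c2) = graph id (nseq (size c1).+1 v ++ c2).
Proof.
move e: (size c1) => m; elim: m c1 v c2 e => [|m IH] c1 v c2.
  by move/size0nil => ->.
case/lastP: c1 => [//|c1 f]; rewrite size_rcons => -[s1]; rewrite -cats1 -catA => Kc nv.
have /Kcube_cat2[e I1 If Iv I2] := Kc.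
have K' : Kcube n (c1 ++ v :: v :: c2) by apply/Kcube_cat2.
have fv : fold_pairs f v = [:: (v, v)] by move: nv Iv; clear; case: v.
have -> : nseq m.+2 v ++ c2 = nseq m.+1 v ++ v :: c2.
  by elim: (m.+1) => //= k ->.
rewrite -(IH c1 v (v :: c2) s1 K' nv).
apply: csetP => t; split.
  case=> u [/(fold_relE _ _ s1 If Iv)[p]]; rewrite fv inE => /eqP-> -> //.
move=> h; exists (c1 ++ [:: v; v] ++ c2); split=> //.
by apply/(fold_relE _ _ s1 If Iv); exists (v, v); rewrite ?fv ?inE.
Qed.

(** An endpoint at position [i] overwrites what precedes it: [Phi_rel i] does not touch the factors
    from [i] on, and [Psi_rel i.+1] then copies the endpoint over the first [i + 1] places. Some
    cell reaches this stage by [keeps_Phi_rel], so the relations coincide. *)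
Lemma Phi_rel_inv n m i c c' : m <= n -> i < m -> Kcube n c -> Kcube n c' ->
  drop i c = drop i c' -> ~~ isE (nth V0 c i) -> Phi_rel m c = Phi_rel m c'.
Proof.
move=> + + Kc Kc' dc nv; elim: m => // m IH lt; rewrite ltnS leq_eqVlt => /orP[/eqP im|im];
    last first.
  by rewrite /= -/(Psi_rel m.+1) IH // ltnW.
subst i; have key d : Kcube n d -> drop m d = drop m c ->
    Phi_rel m.+1 d = graph id (nseq m.+1 (nth V0 c m) ++ drop m.+1 c).
  move=> Kd dd; have kp := keeps_Phi_rel (ltnW lt) Kd.
  have pt t : Phi_rel m d t -> Psi_rel m.+1 t = graph id (nseq m.+1 (nth V0 c m) ++ drop m.+1 c).
    case: kp => _ h /h[Kt dt _]; move: (Kt) => [st _]; have [sc _] := Kc.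
    have et : t = take m t ++ nth V0 c m :: drop m.+1 c.
      by rewrite -(drop_nth V0) ?sc // -dd -dt cat_take_drop.
    have szt : size (take m t) = m by rewrite size_takel // st ltnW.
    have := @Psi_rel_vertex n (take m t) (nth V0 c m) (drop m.+1 c).
    by rewrite szt -et; apply.
  case: kp => -[t dt _] _; apply: csetP => u; split.
    by case=> t' [/pt e h]; rewrite -e.
  by move=> h; exists t; rewrite (pt t dt).
by rewrite (key c) // (key c').
Qed.

Lemma globe_cell_shape n c : Kcube n c ->
  c = nseq n E01 \/ exists i v, [/\ i < n, ~~ isE v, drop i c = v :: nseq (n - i).-1 E01 &
    globe_cell c = ((n - i).-1, v == V1)].
Proof.
have aE d : all isI d -> all isE d -> d = nseq (size d) E01.
  by elim: d => //= f d IH /andP[If /IH h] /andP[Ef /h <-]; case: f If Ef.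
case=> <-; elim: c => [|f c IH] /=; first by left.
case/andP=> If Ic; case: (boolP (all isE c)) => Ec; last first.
  case: (IH Ic) => [e|[i [v [lt nv dv gv]]]].
    by move: Ec; rewrite e all_nseq /= orbT.
  by right; exists i.+1, v; rewrite gv.
case Ef: (isE f); first by left; rewrite -(aE c Ic Ec); case: f If Ef.
by right; exists 0, f; rewrite Ef subn0 /= -aE.
Qed.

(** The image records position and sign of the last endpoint, after which only intervals follow;
    equal images thus give equal tails from that position. *)
Lemma Phi_rel_globe_cell n c c' : Kcube n c -> Kcube n c' -> globe_cell c = globe_cell c' ->
  Phi_rel n c = Phi_rel n c'.
Proof.
move=> Kc Kc'.
have top : globe_cell (nseq n E01) = (n, false).
  by rewrite globe_cell_allE ?size_nseq // all_nseq orbT.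
case: (globe_cell_shape Kc) => [->|[i [v [lt nv dv gv]]]];
  case: (globe_cell_shape Kc') => [->//|[i' [v' [lt' nv' dv' gv']]]].
- by rewrite top gv' => -[]; lia.
- by rewrite top gv => -[]; lia.
rewrite gv gv' => -[ei ev]; have {}ei : i = i' by lia.
subst i'; have vv : v = v'.
  have Iv d j w k : Kcube n d -> drop j d = w :: k -> isI w.
    by case=> _ + e; rewrite -(cat_take_drop j d) e all_cat /= => /and3P[].
  by move: (Iv _ _ _ _ Kc dv) (Iv _ _ _ _ Kc' dv') nv nv' ev; clear;
    case: v; case: v'.
apply: (@Phi_rel_inv n n i) => //; first by rewrite dv dv' vv.
by rewrite -[i]addn0 -nth_drop dv.
Qed.

Lemma atom_Phi_rel n s s' e : (forall t, s t -> Kcube n t) -> (forall t, s' t -> Kcube n t) ->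
  atom s e -> atom s' e -> ext (Phi_rel n) s = ext (Phi_rel n) s'.
Proof.
have half (x y : cset) : (forall t, x t -> Kcube n t) -> (forall t, y t -> Kcube n t) ->
    atom x e -> atom y e -> forall t, ext (Phi_rel n) x t -> ext (Phi_rel n) y t.
  move=> Kx Ky ax ay t [c [xc ct]].
  have /ay[c' yc' e'] : globe_le (globe_cell c) e by apply/ax; exists c.
  by exists c'; split=> //; rewrite (Phi_rel_globe_cell (Ky _ yc') (Kx _ xc)).
by move=> Ks Ks' as_ as'; apply: csetP => t; split; exact: half.
Qed.

Lemma keeps_atom n r T s e : keeps n r T -> (forall t, s t -> Kcube n t) ->
  atom s e -> atom (ext T s) e.
Proof.
move=> kT Ks as_ e'; split.
  case=> t [c [sc ct]] <-; have [_ h] := kT c (Ks c sc); have [_ _ le] := h t ct.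
  by apply: globe_le_trans le _; apply/as_; exists c.
case/as_=> c sc <-; have [[t ct et] _] := kT c (Ks c sc).
by exists t => //; exists c.
Qed.

Lemma del_cl f c : img (del 0) (cl_cell (f :: c)) = cl_cell c.
Proof.
apply: csetP => t; rewrite !cl_cellE; split.
  by case=> -[|g t'] [] //= /andP[_ le] ->; rewrite /del /= drop0.
by move=> le; exists (f :: t); rewrite /= lef_refl /del /= drop0.
Qed.

(** * The morphisms obtained by collapsing *)

Section Globe.
Variable X : omega_category.
Implicit Types (a : X) (x : cset -> X).

(** The top cell [(n, false)] receives [d^-_n a], which is [a] exactly when [n] is at least the
    dimension of [a]. *)
Definition globval a (e : nat * bool) : X := oc_d X e.2 e.1 a.

Definition globe a : cset -> X := fun s => globval a (epsilon (inhabits (0, false)) (atom s)).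

Lemma globeE a s e : atom s e -> globe a s = globval a e.
Proof.
move=> h; rewrite /globe; congr globval.
by apply: (@atom_uniq s) => //; apply: epsilon_spec; exists e.
Qed.

Lemma globval_d a b p e : globval a (globe_bd b p e) = oc_d X b p (globval a e).
Proof.
rewrite /globval /globe_bd; case: leqP => le; first by rewrite oc_dd_ge.
by rewrite oc_dd_lt.
Qed.

Lemma globval_j a p e e' : globe_bd true p e = globe_bd false p e' ->
  globval a (globe_comp p e e') = oc_comp X p (globval a e) (globval a e').
Proof.
move=> ee'; rewrite /globe_comp; case: leqP => h; case: (globe_bd_eq ee') => -[h' E].
- by rewrite E globval_d oc_unit_l.
- have -> : e = globe_bd false p e' by rewrite -ee' /globe_bd h.
  by rewrite globval_d oc_unit_l.
- by move: h'; rewrite leqNgt h.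
- by rewrite E globval_d oc_unit_r.
Qed.

Lemma hom_globe n a : hom (Kcube n) X (globe a).
Proof.
have [am ab] := atom_ind n; split.
  move=> b p x y /ab[e [_ xe ye]].
  by rewrite (globeE a xe) (globeE a ye) globval_d.
move=> p x y z mx my /ab[e [_ xe ze]] /ab[e' [_ ye ze']].
have ee' := atom_uniq ze ze'; have [h _ _ _] := globe_compP ee'.
by rewrite (globeE a (h _ _ xe ye)) (globeE a xe) (globeE a ye) globval_j.
Qed.

Lemma globe_inPhi n a : inPhi n (globe a).
Proof.
exists (globe a); split; first exact: hom_globe.
apply: agree_sym; apply: agree_trans (Phi_spec (leqnn n) (hom_globe n a)) _ => s ms.
have [/(_ s ms)[e _ se] _] := atom_ind n.
have Ks t : s t -> Kcube n t by exact: Mol_Kcube.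
by rewrite (globeE a se) (globeE a (keeps_atom (keeps_Phi_rel (leqnn n)) Ks se)).
Qed.

Lemma Kcube_top n : Kcube n (nseq n E01).
Proof. by rewrite /Kcube size_nseq all_nseq orbT. Qed.

Lemma globe_cell_top n : globe_cell (nseq n E01) = (n, false).
Proof. by rewrite globe_cell_allE ?size_nseq // all_nseq orbT. Qed.

Lemma cdim_top n : cdim (nseq n E01) = n.
Proof. by rewrite /cdim count_nseq mul1n. Qed.

Lemma Acube_d n x b p : hom (Kcube n) X x -> n <= p -> oc_d X b p (Acube n x) = Acube n x.
Proof.
case=> h _ le; rewrite /Acube -(h b p (cl_cell (nseq n E01)) (cl_cell (nseq n E01))) //.
by apply: bd_gen_top; rewrite ?cdim_top //; exact: Kcube_top.
Qed.

(** A folded morphism depends only on the image in the globe, so its values are found by descending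
    induction: each lower globe cell is a boundary of one a dimension higher. *)
Lemma inPhi_globe n x : hom (Kcube n) X x -> inPhi n x -> agree n x (globe (Acube n x)).
Proof.
move=> hx [y [hy xy]].
have val s s' e : Mol (Kcube n) s -> Mol (Kcube n) s' -> atom s e -> atom s' e -> x s = x s'.
  move=> ms ms' se se'; rewrite !xy // !(Phi_spec (leqnn n) hy) //; congr y.
  by apply: atom_Phi_rel se se' => t; exact: Mol_Kcube.
have [am _] := atom_ind n.
have codeI s e : Mol (Kcube n) s -> atom s e -> e = (n, false) \/ e.1 < n.
  move=> ms se; have [t st <-] : exists2 t, s t & globe_cell t = e by apply/se; left.
  have Kt := Mol_Kcube ms st; case: (globe_cell_shape Kt) => [->|[i [v [lt _ _ ->]]]].
    by left; exact: globe_cell_top.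
  by right=> /=; lia.
have top s : Mol (Kcube n) s -> atom s (n, false) -> x s = Acube n x.
  move=> ms se; apply: val se _ => //; first exact/mol_gen/Kcube_top.
  by rewrite -globe_cell_top; exact: atom_cl (Kcube_top n).
suff main k s e : Mol (Kcube n) s -> atom s e -> n - e.1 = k -> x s = globval (Acube n x) e.
  by move=> s ms; have [e _ se] := am s ms; rewrite (globeE _ se); exact: main erefl.
elim: k s e => [|k IH] s e ms se ek; have [e0|lt] := codeI s e ms se.
- by rewrite e0 /globval (Acube_d _ hx) //; apply: top => //; rewrite -e0.
- by lia.
- by rewrite e0 /= in ek; lia.
case: e se ek lt => q b /= se ek lt.
(* A cell whose dimension and image dimension are both [q + 1]; its boundary of sign [b] therefore
   has image [(q, b)]. *)
pose c := nseq (n - q.+1) V0 ++ nseq q.+1 E01.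
have Kc : Kcube n c.
  by rewrite /Kcube /c size_cat all_cat !size_nseq !all_nseq !orbT; split=> //; lia.
have dc : cdim c = q.+1 by rewrite /c cdim_cat cdim_top /cdim count_nseq mul0n.
have gc : (globe_cell c).1 = q.+1.
  apply/eqP; rewrite eqn_leq -{1}dc globe_cell_dim /c.
  by have := @globe_cell_cat_ge (nseq (n - q.+1) V0) (nseq q.+1 E01);
      rewrite size_nseq all_nseq orbT; exact.
have bc : Bd (Kcube n) b q (cl_cell c) (bd_cell b c).
  by have := @bd_gen_face (Kcube n) b c Kc; rewrite dc; exact.
have -> : x s = x (bd_cell b c).
  apply: val se _ => //; first exact: mol_bd bc.
  have := @atom_bd n b c Kc; rewrite dc => /(_ isT).
  by rewrite /globe_bd gc ltnn.
have [h _] := hx; rewrite (h _ _ _ _ bc).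
rewrite (IH (cl_cell c) (globe_cell c)); [|exact: mol_gen|exact: atom_cl Kc|rewrite gc; lia].
by rewrite /globval gc /= oc_dd_lt.
Qed.

Lemma preserves_del n : preserves (Kcube n.+1) (Kcube n) (graph (del 0)).
Proof.
apply: preserves_gen => c Kc; have [|c1 [l [c2 [ec s1 sl]]]] := @split_window c 0 1.
  by case: Kc => ->.
have dE d : del 0 d = window 0 1 (fun=> [::]) d by [].
case: l ec sl => [|f [|? ?]] // ec _; rewrite (size0nil s1) in ec.
rewrite ec in Kc *; have [sz If I2] : [/\ (size c2).+1 = n.+1, isI f & all isI c2].
  by case: Kc => ? /andP[].
apply: cell_ok_gen; last by rewrite /Kcube /del /= drop0; case: sz.
have := @window_ok 0 1 (fun=> [::]) [::] [:: f] c2 erefl erefl; apply.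
by apply: local_okP; move: If; clear; case: f.
Qed.

(** Deleting the first factor affects the image only if all others are intervals. The images then
    have dimension [n] or [n + 1], where every boundary of [a] is [a]. *)
Lemma ldegen_globe n x a : agree n x (globe a) -> (forall b, oc_d X b n a = a) ->
  agree n.+1 (ldegen 1 x) (globe a).
Proof.
move=> xa da; have hx := hom_agree (agree_sym xa) (hom_globe n a).
apply: hom_eq_gen (hom_globe _ _) _; first exact: hom_preserves hx (preserves_del n).
case=> [|f c]; first by case.
case=> -[sc] /= /andP[If Ic]; have Kc : Kcube n c by [].
have -> : ldegen 1 x (cl_cell (f :: c)) = x (cl_cell c).
  by rewrite /ldegen /= del_cl.
rewrite xa; last exact: mol_gen.
have Kfc : Kcube n.+1 (f :: c) by rewrite /Kcube /= sc If.
rewrite (globeE a (atom_cl Kc)) (globeE a (atom_cl Kfc)) /=; case: ifP => // Ec.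
rewrite (globe_cell_allE Ec) sc /globval /= da; case: (isE f) => /=; last by rewrite da.
by rewrite -{2}(da true) oc_dd_ge // da.
Qed.
End Globe.

(** * Composition of folded morphisms *)

(* A morphism on the subdivided cube with halves globe a and globe b is read off from
   the pair of images of a set under the two collapses of [0,2] to [0,1]. *)
Definition collapse_hi (f : fac) : fac := match f with E12 | V2 => V1 | g => g end.
Definition collapse_lo (f : fac) : fac := match f with E12 => E01 | V2 => V1 | _ => V0 end.
Definition on_factor (k : nat) (h : fac -> fac) : cell -> cell := window k 1 (map h).

Lemma on_factorE k h c1 f c2 : size c1 = k ->
  on_factor k h (c1 ++ f :: c2) = c1 ++ h f :: c2.
Proof. by move=> s1; rewrite /on_factor -[f :: c2]/([:: f] ++ c2) window_cat. Qed.

Lemma on_factor_ok k h c1 f c2 : size c1 = k -> local_ok (map h) [:: f] ->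
  cell_ok (on_factor k h) (c1 ++ f :: c2).
Proof. by move=> s1 ok; rewrite -[f :: c2]/([:: f] ++ c2); exact: window_ok. Qed.

Lemma collapse_hi_ok f : local_ok (map collapse_hi) [:: f].
Proof. by apply: local_okP; case: f. Qed.
Lemma collapse_lo_ok f : local_ok (map collapse_lo) [:: f].
Proof. by apply: local_okP; case: f. Qed.
Lemma shift_ok f : isI f -> local_ok (map shift_fac) [:: f].
Proof. by move=> If; apply: local_okP; case: f If. Qed.

Lemma atom_cell_ok n g c : cell_ok g c -> Kcube n (g c) ->
  [/\ atom (img g (cl_cell c)) (globe_cell (g c)),
      forall a q, cdim c <= q -> globe_bd a q (globe_cell (g c)) = globe_cell (g c) &
      0 < cdim c -> forall a, atom (img g (bd_cell a c)) (globe_bd a (cdim c).-1 (globe_cell (g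
          c)))].
Proof.
case=> -> bd Kg; have gd := globe_cell_dim (g c).
have dle q : cdim (g c) <= q -> forall a, globe_bd a q (globe_cell (g c)) = globe_cell (g c).
  by move=> le a; rewrite /globe_bd (leq_trans gd).
split; first exact: atom_cl Kg.
  by move=> a q le; apply: dle; apply: leq_trans le; case: bd => -[] => [->|/ltnW].
move=> d a; case: bd => -[d' ->]; first by rewrite -d'; apply: atom_bd Kg _; rewrite d'.
rewrite dle; first exact: atom_cl Kg.
by rewrite -ltnS prednK.
Qed.

Lemma preserves_iota n k : k < n -> preserves (Kcube n) (Kcube2 n k.+1) (graph (iota_plus k)).
Proof.
move=> lt.
have [pm pb] : preserves (Kcube n) (Kcube2 n k.+1) (graph (on_factor k shift_fac)).
  apply: preserves_gen => c Kc.
  have [|c1 [f [c2 [ec s1]]]] := @split_at c k; first by case: Kc => ->.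
  move: Kc; rewrite ec => /Kcube_cat[e I1 If I2].
  apply: cell_ok_gen; first by apply: on_factor_ok => //; exact: shift_ok.
  by rewrite on_factorE // -s1; apply/Kcube2_cat.
have E s : Mol (Kcube n) s ->
    ext (graph (iota_plus k)) s = ext (graph (on_factor k shift_fac)) s.
  move=> ms; apply: eq_ext => c /(Mol_Kcube ms)[sc _].
  have [|c1 [f [c2 [-> s1]]]] := @split_at c k; first by rewrite sc.
  by rewrite /graph on_factorE // -s1 iota_plus_cat.
split=> [s ms|a p x y b]; first by rewrite E //; exact: pm.
by rewrite !E; [exact: pb|exact: mol_bd b|exact: Bd_Mol b].
Qed.

Lemma collapse_mu n k h c : k < n -> Kcube n c ->
  (forall f g, isI f -> mu_fac f g -> lef (h g) f) ->
  (forall f, isI f -> exists2 g, mu_fac f g & h g = f) ->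
  img (on_factor k h) (mu_set k (cl_cell c)) = cl_cell c.
Proof.
move=> lt Kc h1 h2; rewrite mu_setE; apply: csetP => t; rewrite cl_cellE; split.
  case=> u [[d [le m]] ->].
  have Kd := Kcube_down Kc le; apply: leb_trans le.
  have [|d1 [f [d2 [ed s1]]]] := @split_at d k; first by case: Kd => ->.
  subst k d; case/subdiv_cat: m => g -> m; rewrite on_factorE // leb_cat //= !leb_refl andbT.
  by rewrite h1 //; case/Kcube_cat: Kd.
move=> le; have Kt := Kcube_down Kc le.
have [|d1 [f [d2 [ed s1]]]] := @split_at t k; first by case: Kt => ->.
subst k t; have [g m hg] : exists2 g, mu_fac f g & h g = f by apply: h2; case/Kcube_cat: Kt.
exists (d1 ++ g :: d2); rewrite on_factorE // hg; split=> //.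
by exists (d1 ++ f :: d2); split=> //; apply/subdiv_cat; exists g.
Qed.

Section Composite.
Variables (X : omega_category) (n p : nat).
Hypothesis pn : p < n.
(** The 0-based position of factor [n - p]. Exactly [p] factors follow it, so an endpoint at [k]
    followed by intervals maps to a [p]-cell of the globe. *)
Let k := (n - p).-1.
Let code2 : Type := ((nat * bool) * (nat * bool))%type.

Definition atom2 (s : cset) (e : code2) : Prop :=
  atom (img (on_factor k collapse_hi) s) e.1 /\ atom (img (on_factor k collapse_lo) s) e.2.

(** [(p, true)] in the globe of [a] and [(p, false)] in that of [b] both stand for the common cell
    [d^+_p a = d^-_p b]; such pairs have [#_p]-composable values. *)
Definition above (e : code2) : Prop :=
  globe_bd true p e.1 = (p, true) /\ globe_bd false p e.2 = (p, false).
Definition ok2 (e : code2) : Prop := (e.1 = e.2 /\ e.1.1 <= p) \/ above e.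
Definition globe_bd2 a q (e : code2) : code2 := (globe_bd a q e.1, globe_bd a q e.2).
Definition globe_comp2 q (e e' : code2) : code2 := (globe_comp q e.1 e'.1, globe_comp q e.2 e'.2).

Lemma ltkn : k < n. Proof. rewrite /k; lia. Qed.

Lemma above_ge e : above e -> p <= e.1.1 /\ p <= e.2.1.
Proof.
case: e => [[q1 b1] [q2 b2]] [/=]; rewrite /globe_bd /=.
by case: leqP => [_ [-> _]|/ltnW ? _]; case: leqP => [_ [-> _]|/ltnW ? _].
Qed.

Lemma globe_bd_p a b e : globe_bd a p e = (p, a) -> globe_bd b p e = (p,
    a) \/ globe_bd b p e = (p, b).
Proof. by rewrite /globe_bd; case: leqP => _ h; [left|right]. Qed.

Lemma ok2_d a q e : ok2 e -> ok2 (globe_bd2 a q e).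
Proof.
case=> [[e12 le]|[h1 h2]].
  left; rewrite /globe_bd2 /= e12; split=> //; rewrite /globe_bd -e12.
  by case: (leqP e.1.1 q) => //= /ltnW lt; exact: leq_trans lt le.
case: (ltngtP q p) => [lt|gt|->].
- have [g1 g2] := above_ge (conj h1 h2).
  by left; rewrite /globe_bd2 /globe_bd /= !ifN -?ltnNge ?(leq_trans lt) //; split=> //;
      exact: ltnW.
- right; split; rewrite /= /globe_bd.
    by case: (leqP e.1.1 q) => //= _; rewrite leqNgt gt.
  by case: (leqP e.2.1 q) => //= _; rewrite leqNgt gt.
- have [g1 g2] := above_ge (conj h1 h2).
  case: a; rewrite /globe_bd2.
    rewrite h1; case: (globe_bd_p true h2) => ->; [right; split|left] => //=;
      by rewrite /globe_bd /= leqnn.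
  rewrite h2; case: (globe_bd_p false h1) => ->; [right; split|left] => //=;
    by rewrite /globe_bd /= leqnn.
Qed.

(** In each coordinate one of the two cells is an identity. If it is not on the same side in both,
    both pairs are [above]. Then [q < p] is impossible by dimension, and at [q = p] the identities
    lie on opposite sides: a part of the first half meets a part of the second. *)
Lemma ok2_mix q e e' : ok2 e -> ok2 e' -> globe_bd2 true q e = globe_bd2 false q e' ->
  [\/ e = globe_bd2 false q e' /\ globe_comp2 q e e' = e',
      e' = globe_bd2 true q e /\ globe_comp2 q e e' = e,
      [/\ p < q, above e & above e'] |
      [/\ q = p, above e, above e', e.2 = (p, false) & e'.1 = (p, true)]].
Proof.
case: e e' => [e1 e2] [e1' e2'] oe oe'; rewrite /globe_bd2 /globe_comp2 /= => -[c1 c2].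
case: (boolP ((e1.1 <= q) && (e2.1 <= q))) => [/andP[l1 l2]|nA].
  by apply: Or41; rewrite -c1 -c2 /globe_bd /globe_comp l1 l2.
case: (boolP ((e1'.1 <= q) && (e2'.1 <= q))) => [/andP[l1 l2]|nB].
  apply: Or42; split; first by rewrite c1 c2 /globe_bd l1 l2.
  have jE f f' : f'.1 <= q -> globe_bd true q f = globe_bd false q f' -> globe_comp q f f' = f.
    by move=> l; rewrite /globe_comp /globe_bd l; case: ifP.
  by rewrite !jE.
have A : above (e1, e2).
  case: oe => // -[/= e12 _]; subst e2; move: nA; rewrite andbb => nA.
  by move: nB; case: (globe_bd_eq c1) => -[l _]; rewrite l // in nA *;
     case: (globe_bd_eq c2) => -[l' _]; rewrite ?l' // in nA *.
have A' : above (e1', e2').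
  case: oe' => // -[/= e12 _]; subst e2'; move: nB; rewrite andbb => nB.
  by move: nA; case: (globe_bd_eq c1) => -[l _]; rewrite l // in nB *;
     case: (globe_bd_eq c2) => -[l' _]; rewrite ?l' // in nB *.
have [/= g1 g2] := above_ge A; have [/= g1' g2'] := above_ge A'.
case: (ltngtP q p) => [lt|gt|eq]; last first.
- apply: Or44; subst q; split=> //=.
    by case: A' => _ /= h; move: c2; rewrite h /globe_bd; case: leqP.
  by case: A => /= h _; move: c1; rewrite h /globe_bd; case: (leqP e1'.1 p).
- exact: Or43.
- case: (globe_bd_eq c1) => -[l _]; lia.
Qed.

Lemma ok2_j q e e' : ok2 e -> ok2 e' -> globe_bd2 true q e = globe_bd2 false q e' ->
  ok2 (globe_comp2 q e e').
Proof.
move=> oe oe' c; case: (ok2_mix oe oe' c) =>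
    [[_ ->]|[_ ->]|[_ [h1 h2] [h1' h2']]|[-> A A' e2 e1]] //.
  by right; split; rewrite /= /globe_comp; case: ifP.
right; split; rewrite /= /globe_comp; case: A => h1 h2; case: A' => h1' h2';
    last by rewrite e2 leqnn.
by case: ifP.
Qed.

Lemma atom2_cell c : Kcube2 n k.+1 c ->
  let e := (globe_cell (on_factor k collapse_hi c), globe_cell (on_factor k collapse_lo c)) in
  [/\ ok2 e, atom2 (cl_cell c) e, forall a q, cdim c <= q -> globe_bd2 a q e = e &
    0 < cdim c -> forall a, atom2 (bd_cell a c) (globe_bd2 a (cdim c).-1 e)].
Proof.
move=> Kc; have [|c1 [f [c2 [ec s1]]]] := @split_at c k; first by case: Kc => -> _; exact: ltkn.
move: Kc; rewrite ec -s1 => /Kcube2_cat[e I1 I2].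
have s2 : size c2 = p by move: e s1; rewrite /k; lia.
have ok1 := @on_factor_ok (size c1) _ c1 f c2 erefl (collapse_hi_ok f).
have ok2' := @on_factor_ok (size c1) _ c1 f c2 erefl (collapse_lo_ok f).
have K1 : Kcube n (on_factor (size c1) collapse_hi (c1 ++ f :: c2)).
  by rewrite on_factorE //; apply/Kcube_cat; split=> //; case: (f).
have K2 : Kcube n (on_factor (size c1) collapse_lo (c1 ++ f :: c2)).
  by rewrite on_factorE //; apply/Kcube_cat; split=> //; case: (f).
have [a1 d1 b1] := atom_cell_ok ok1 K1; have [a2 d2 b2] := atom_cell_ok ok2' K2.
rewrite /atom2 -!s1; split=> //=; last first.
- by move=> d a; split; [exact: b1|exact: b2].
- by move=> a q le; rewrite /globe_bd2 /= d1 ?d2.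
rewrite !on_factorE // /ok2 /above /=.
(* An endpoint after position [k] makes both images equal; otherwise the five values of [f] are
   compared. *)
case: (boolP (all isE c2)) => E2; last first.
  have nE g : ~~ all isE (g :: c2) by rewrite /= negb_and E2 orbT.
  left; rewrite !globe_cell_cat // /= (negbTE E2); split=> //.
  by rewrite -s2; exact: globe_cell_le.
have vE v : ~~ isE v -> globe_cell (c1 ++ v :: c2) = (p, v == V1).
  by move=> nv; rewrite globe_cell_vertex // s2.
have eE a : globe_bd a p (globe_cell (c1 ++ E01 :: c2)) = (p, a).
  have := @globe_cell_cat_ge c1 (E01 :: c2) E2; rewrite /globe_bd /= s2 ltnNge.
  by case: (_ <= p).
have pE a b : globe_bd a p (p, b) = (p, b) by rewrite /globe_bd /= leqnn.
case: f {ec ok1 ok2' K1 K2 a1 d1 b1 a2 d2 b2} => /=.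
- by left; rewrite !vE.
- by right; rewrite !vE // !pE.
- by left; rewrite !vE.
- by right; rewrite eE (vE V0) // pE.
- by right; rewrite eE (vE V1) // pE.
Qed.

Variables (a b : X).
Hypothesis ab : oc_d X true p a = oc_d X false p b.

(* The image pairs which are not composites are the cells of dimension <= p that lie
   in both globes, or in the d^-_p of the first or the d^+_p of the second one. *)
Definition glue (e : code2) : X :=
  if (e.1 == e.2) && (e.1.1 <= p) then
    (if e.1 == (p, true) then globval b e.1 else globval a e.1)
  else oc_comp X p (globval a e.1) (globval b e.2).

(** Below dimension [p] both sides are boundaries of the common cell [d^+_p a = d^-_p b]. *)
Lemma globval_low e : e.1 < p -> globval a e = globval b e.
Proof.
by case: e => q s /= lt; rewrite /globval /= -(oc_dd_lt true s a lt) ab oc_dd_lt.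
Qed.

Lemma glue_above e : above e -> glue e = oc_comp X p (globval a e.1) (globval b e.2).
Proof.
case=> h1 h2; rewrite /glue; case: ifP => // /andP[/eqP e12 le]; move: h1 h2.
by rewrite -e12 /globe_bd le => ->.
Qed.

Lemma above_comp e : above e ->
  oc_d X true p (globval a e.1) = oc_d X false p (globval b e.2).
Proof. by case=> h1 h2; rewrite -!globval_d h1 h2 /globval /= ab. Qed.

Lemma glue_above_l e : above e -> e.2 = (p, false) -> glue e = globval a e.1.
Proof.
move=> A e2; rewrite glue_above //.
have -> : globval b e.2 = oc_d X true p (globval a e.1).
  by rewrite above_comp // -globval_d e2 /globe_bd /= leqnn.
by rewrite oc_unit_r.
Qed.

Lemma glue_above_r e : above e -> e.1 = (p, true) -> glue e = globval b e.2.
Proof.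
move=> A e1; rewrite glue_above //.
have -> : globval a e.1 = oc_d X false p (globval b e.2).
  by rewrite -above_comp // -globval_d e1 /globe_bd /= leqnn.
by rewrite oc_unit_l.
Qed.

Lemma glue_low e : e.1 < p -> glue (e, e) = globval a e.
Proof.
move=> lt; rewrite /glue /= eqxx ltnW //=; case: eqP => // e'.
by rewrite globval_low.
Qed.

Lemma glue_d s q e : ok2 e -> glue (globe_bd2 s q e) = oc_d X s q (glue e).
Proof.
case: e => e1 e2 oe; case: oe (oe) => [[/= e12 le] _|A oe].
  subst e2; case: (leqP e1.1 q) => h.
    have eE : globe_bd s q e1 = e1 by rewrite /globe_bd h.
    rewrite /globe_bd2 /= eE /glue /= eqxx le /=.
    by case: ifP => _; rewrite -globval_d eE.
  have eE : globe_bd s q e1 = (q, s) by rewrite /globe_bd leqNgt h.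
  have lt : q < p := leq_trans h le.
  rewrite /globe_bd2 /= eE glue_low // /glue /= eqxx le /=.
  case: ifP => _; rewrite -globval_d eE //; exact: globval_low.
have [/= g1 g2] := above_ge A; have [h1 h2] := A; rewrite /= in h1 h2.
have pE c c' : globe_bd c p (p, c') = (p, c') by rewrite /globe_bd /= leqnn.
have cA := above_comp A; rewrite (glue_above A); case: (ltngtP q p) => [lt|gt|eq].
- have eE e : p <= e.1 -> globe_bd s q e = (q, s).
    by move=> le; rewrite /globe_bd leqNgt (leq_trans lt).
  have ne : q <> p by move=> e; rewrite e ltnn in lt.
  rewrite (oc_d_comp _ cA ne).
  rewrite -!globval_d /globe_bd2 /= !eE // glue_low // -(globval_low (e := (q, s))) //.
  (* Both factors are [d^s_q a] with [q < p], an identity for [#_p]. *)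
  by rewrite -{3}[globval a _](oc_dd_ge s true a (ltnW lt)) oc_unit_r.
- have A2 : above (globe_bd2 s q (e1, e2)).
    split; rewrite /= /globe_bd.
      by case: (leqP e1.1 q) => //= _; rewrite leqNgt gt.
    by case: (leqP e2.1 q) => //= _; rewrite leqNgt gt.
  have ne : q <> p by move=> e; rewrite e ltnn in gt.
  by rewrite (glue_above A2) (oc_d_comp _ cA ne) -!globval_d.
(* The boundary pair is either [above], with an identity as one factor, or a diagonal pair at the
   outer end of the composite. *)
- subst q; case: s.
    rewrite (oc_d_comp_r cA).
    rewrite -globval_d /globe_bd2 /= h1; case: (globe_bd_p true h2) => ->.
      by rewrite glue_above_r //; split=> //=; rewrite pE.
    by rewrite /glue /= !eqxx leqnn.
  rewrite (oc_d_comp_l cA).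
  rewrite -globval_d /globe_bd2 /= h2; case: (globe_bd_p false h1) => ->.
    by rewrite glue_above_l //; split=> //=; rewrite pE.
  by rewrite /glue /= eqxx leqnn xpair_eqE andbF.
Qed.

(** The cases of [ok2_mix] correspond to the unit laws, the interchange law for [q > p], and for
    [q = p] the composite defining [glue]. *)
Lemma glue_j q e e' : ok2 e -> ok2 e' -> globe_bd2 true q e = globe_bd2 false q e' ->
  glue (globe_comp2 q e e') = oc_comp X q (glue e) (glue e').
Proof.
move=> oe oe' c; case: (ok2_mix oe oe' c) => [[e0 ->]|[e0 ->]|[gt A A']|[eq A A' e2 e1]].
- by rewrite e0 glue_d // oc_unit_l.
- by rewrite e0 glue_d // oc_unit_r.
- have J : above (globe_comp2 q e e').
    by case: A A' => h1 h2 [h1' h2']; split; rewrite /= /globe_comp; case: ifP.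
  have cd : oc_d X true q (glue e) = oc_d X false q (glue e') by rewrite -!glue_d // c.
  have [c1 c2] : globe_bd true q e.1 = globe_bd false q e'.1 /\ globe_bd true q e.2 = globe_bd
      false q e'.2.
    by case: c.
  rewrite (glue_above J) /= !globval_j // (glue_above A) (glue_above A').
  symmetry; apply: oc_interchange; try exact: above_comp.
  + by move=> e0; rewrite e0 ltnn in gt.
  + by rewrite -!glue_above.
  + by rewrite -!globval_d c1.
  + by rewrite -!globval_d c2.
  + by rewrite -!globval_j //; exact: (above_comp J).
- subst q; rewrite (glue_above_l A e2) (glue_above_r A' e1) glue_above //=.
    have [h1 h2] : globe_bd true p e.1 = (p, true) /\ globe_bd false p e'.2 = (p, false).
      by case: A A' => ? ? [].
    congr oc_comp; congr globval; rewrite /globe_comp.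
      case: ifP => // le; move: h1; rewrite /globe_bd le => ->; by rewrite e1.
    by rewrite e2 leqnn.
  case: A A' => h1 h2 [h1' h2']; split; rewrite /= /globe_comp; last by rewrite e2 leqnn.
  by case: ifP.
Qed.

Definition glued : cset -> X :=
  fun s => glue (epsilon (inhabits ((0, false), (0, false))) (atom2 s)).

Lemma atom2_uniq s e e' : atom2 s e -> atom2 s e' -> e = e'.
Proof.
case: e e' => [e1 e2] [e1' e2'] [/= h1 h2] [/= h1' h2'].
by rewrite (atom_uniq h1 h1') (atom_uniq h2 h2').
Qed.

Lemma gluedE s e : atom2 s e -> glued s = glue e.
Proof.
move=> h; rewrite /glued; congr glue.
by apply: (@atom2_uniq s) => //; apply: epsilon_spec; exists e.
Qed.

Lemma img_cunion g x y : img g (cunion x y) = cunion (img g x) (img g y).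
Proof. exact: (ext_cunion (graph g)). Qed.

Lemma globe_comp2P q e e' : ok2 e -> ok2 e' -> globe_bd2 true q e = globe_bd2 false q e' ->
  [/\ ok2 (globe_comp2 q e e'),
      forall x y, atom2 x e -> atom2 y e' -> atom2 (cunion x y) (globe_comp2 q e e'),
      globe_bd2 false q (globe_comp2 q e e') = globe_bd2 false q e,
      globe_bd2 true q (globe_comp2 q e e') = globe_bd2 true q e' &
      forall s r u v, r <> q -> atom2 u (globe_bd2 s r e) -> atom2 v (globe_bd2 s r e') ->
        atom2 (cunion u v) (globe_bd2 s r (globe_comp2 q e e'))].
Proof.
move=> oe oe' c; have [c1 c2] : globe_bd true q e.1 = globe_bd false q e'.1 /\
  globe_bd true q e.2 = globe_bd false q e'.2 by case: c.
have [u1 l1 r1 o1] := globe_compP c1; have [u2 l2 r2 o2] := globe_compP c2.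
split; first exact: ok2_j.
- by move=> x y [x1 x2] [y1 y2]; split; rewrite img_cunion; auto.
- by rewrite /globe_bd2 /= l1 l2.
- by rewrite /globe_bd2 /= r1 r2.
- move=> s r u v ne [x1 x2] [y1 y2]; split; rewrite img_cunion.
    exact: o1 ne x1 y1.
  exact: o2 ne x2 y2.
Qed.

Lemma hom_glued : hom (Kcube2 n k.+1) X glued.
Proof.
have [am abd] : (forall s, Mol (Kcube2 n k.+1) s -> exists2 e, ok2 e & atom2 s e) /\
  (forall s q x y, Bd (Kcube2 n k.+1) s q x y ->
     exists e, [/\ ok2 e, atom2 x e & atom2 y (globe_bd2 s q e)]).
  apply: (code_ind (jn := globe_comp2) atom2_uniq).
  - by move=> c Kc; eexists; exact: (atom2_cell Kc).
  - exact: ok2_d.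
  - by move=> s s' q r e lt; rewrite /globe_bd2 /= !globe_bd_lt.
  - by move=> s s' q r e le; rewrite /globe_bd2 /= !globe_bd_ge.
  - exact: globe_comp2P.
split=> [s q x y /abd[e [oe xe ye]]|q x y z _ _ /abd[e [oe xe ze]] /abd[e' [oe' ye ze']]].
  by rewrite (gluedE xe) (gluedE ye) glue_d.
have c := atom2_uniq ze ze'; have [_ h _ _ _] := globe_comp2P oe oe' c.
by rewrite (gluedE (h _ _ xe ye)) (gluedE xe) (gluedE ye) glue_j.
Qed.

Lemma glued_cell c1 f c2 : size c1 = k -> Kcube2 n k.+1 (c1 ++ f :: c2) ->
  glued (cl_cell (c1 ++ f :: c2)) =
  glue (globe_cell (c1 ++ collapse_hi f :: c2), globe_cell (c1 ++ collapse_lo f :: c2)).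
Proof.
move=> s1 Kc; have [_ h _ _] := atom2_cell Kc.
by rewrite (gluedE h) !on_factorE.
Qed.

(** On the first half [collapse_lo] is constantly [V0]: before a tail of intervals its component is
    [(p, false)], which drops out as an identity or equals the first component. The second half is
    symmetric, and a tail with an endpoint gives a common cell of dimension below [p]. *)
Lemma glued_spec : agree n glued (globe a) /\
  agree n (fun s => glued (img (iota_plus k) s)) (globe b).
Proof.
have tail c1 f c2 : size c1 = k -> Kcube n (c1 ++ f :: c2) -> size c2 = p.
  by move=> s1 [+ _]; rewrite size_cat /= s1 /k; lia.
have pE c c' : globe_bd c p (p, c') = (p, c') by rewrite /globe_bd /= leqnn.
have eE c1 c2 s : size c2 = p -> all isE c2 -> globe_bd s p (globe_cell (c1 ++ E01 :: c2)) = (p, s).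
  move=> s2 E2; have := @globe_cell_cat_ge c1 (E01 :: c2) E2; rewrite /globe_bd /= s2 ltnNge.
  by case: (_ <= p).
have low c1 f g c2 : size c2 = p -> ~~ all isE c2 ->
    globe_cell (c1 ++ f :: c2) = globe_cell (c1 ++ g :: c2) /\ (globe_cell (c1 ++ g :: c2)).1 < p.
  move=> s2 n2; have nE h : ~~ all isE (h :: c2) by rewrite /= negb_and n2 orbT.
  by rewrite !globe_cell_cat // /= (negbTE n2) -s2; split=> //; exact: globe_cell_lt.
split; apply: hom_eq_gen (hom_globe n _) _.
- by apply: hom_mono hom_glued => c; exact: Kcube_Kcube2.
- move=> c Kc; have [|c1 [f [c2 [ec s1]]]] := @split_at c k; first by case: Kc => -> _; exact: ltkn.
  subst c; rewrite (globeE a (atom_cl Kc)) glued_cell //; last exact: Kcube_Kcube2.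
  have s2 := tail _ _ _ s1 Kc; have /Kcube_cat[_ _ If _] := Kc.
  have -> : collapse_hi f = f by move: If; clear; case: f.
  case: (boolP (all isE c2)) => E2; last first.
    have [e _] := low c1 (collapse_lo f) f c2 s2 E2; have [_ lt] := low c1 f f c2 s2 E2.
    by rewrite e glue_low.
  have -> : collapse_lo f = V0 by move: If; clear; case: f.
  rewrite [X in (_, X)]globe_cell_vertex // s2.
  clear Kc; case: f If => // _.
  + by rewrite globe_cell_vertex // s2 /glue /= eqxx leqnn xpair_eqE andbF.
  + by rewrite globe_cell_vertex // s2 glue_above_l //; split=> /=; rewrite ?pE ?eE.
  + by rewrite glue_above_l //; split=> /=; rewrite ?pE ?eE.
- exact: hom_preserves hom_glued (preserves_iota ltkn).
- move=> c Kc; rewrite (iota_plus_cl ltkn Kc).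
  have [|c1 [f [c2 [ec s1]]]] := @split_at c k; first by case: Kc => -> _; exact: ltkn.
  subst c; rewrite (globeE b (atom_cl Kc)) -{1}s1 iota_plus_cat.
  have s2 := tail _ _ _ s1 Kc; have /Kcube_cat[e0 I1 If I2] := Kc.
  rewrite glued_cell //; last by rewrite -s1; apply/Kcube2_cat.
  have -> : collapse_lo (shift_fac f) = f by move: If; clear; case: f.
  case: (boolP (all isE c2)) => E2; last first.
    have [e _] := low c1 (collapse_hi (shift_fac f)) f c2 s2 E2; have [_ lt] := low c1 f f c2 s2 E2.
    by rewrite e glue_low // globval_low.
  have -> : collapse_hi (shift_fac f) = V1 by move: If; clear; case: f.
  rewrite [X in (X, _)]globe_cell_vertex // s2.
  clear Kc; case: f If => // _.
  + by rewrite globe_cell_vertex // s2 glue_above_r //; split=> /=; rewrite ?pE ?eE.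
  + by rewrite globe_cell_vertex // s2 /glue /= !eqxx leqnn.
  + by rewrite glue_above_r //; split=> /=; rewrite ?pE ?eE.
Qed.

Lemma lcomp_globe (x y : cset -> X) : agree n x (globe a) -> agree n y (globe b) ->
  (forall s, oc_d X s n a = a) -> (forall s, oc_d X s n b = b) ->
  Acube n (lcomp n (n - p) x y) = oc_comp X p a b.
Proof.
move=> xa yb da db; have [ga gb] := glued_spec.
have -> : n - p = k.+1 by rewrite /k; lia.
rewrite /Acube (@lcomp_spec X n k x y glued ltkn hom_glued).
(* Both collapses take the subdivided cube onto all of [I^n]; as [p < n], this pair is evaluated by
   the composite branch of [glue]. *)
- rewrite (@gluedE _ ((n, false), (n, false))).
    by rewrite /glue /= leqNgt pn andbF /globval /= da db.
  have At : atom (cl_cell (nseq n E01)) (n, false).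
    by rewrite -globe_cell_top; exact: atom_cl (Kcube_top n).
  split; rewrite (collapse_mu ltkn (Kcube_top n)) //.
  + by case=> // -[] //= _ ; intuition discriminate.
  + by case=> // _; [exists V0|exists V2|exists E01; [left|]].
  + by case=> // -[] //= _ ; intuition discriminate.
  + by case=> // _; [exists V0|exists V2|exists E12; [right; right|]].
- by move=> s ms; rewrite ga // xa.
- by move=> s ms; rewrite gb // yb.
- exact/mol_gen/Kcube_top.
Qed.
End Composite.

(** * Operations of the colimit and the isomorphism *)

Section Operations.
Variable X : omega_category.
Implicit Types x y : cset -> X.

Lemma iter_ldegen j x c : iter j (ldegen 1) x (cl_cell (nseq j E01 ++ c)) = x (cl_cell c).
Proof. by elim: j => //= j IH; rewrite {1}/ldegen /= del_cl. Qed.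

Lemma iter_lface j a x c :
  iter j (lface 1 a) x (cl_cell c) = x (cl_cell (nseq j (vert a) ++ c)).
Proof.
elim: j c => //= j IH c; rewrite {1}/lface /=.
have -> : img (ins 0 (if a then V1 else V0)) (cl_cell c) = cl_cell (vert a :: c).
  rewrite cl_vert; apply: csetP => t; split.
    by case=> u [uc ->]; rewrite /ins take0 drop0 /=; split.
  by case: t => //= f t [-> tc]; exists t; split=> //; rewrite /ins take0 drop0.
rewrite IH; congr (x (cl_cell _)).
by elim: j {IH} => //= j ->.
Qed.

Lemma oc_d_fixed (a : X) n m : (forall b, oc_d X b n a = a) -> n <= m ->
  forall b, oc_d X b m a = a.
Proof. by move=> h le b; rewrite -{1}(h b) oc_dd_ge. Qed.

Lemma iter_ldegen_globe n j x (a : X) : agree n x (globe a) -> (forall b, oc_d X b n a = a) ->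
  agree (n + j) (iter j (ldegen 1) x) (globe a).
Proof.
move=> xa da; elim: j => [|j IH]; first by rewrite addn0.
rewrite addnS /=; apply: ldegen_globe => //.
by apply: oc_d_fixed da _; exact: leq_addr.
Qed.

Lemma Acube_gd n x a p : hom (Kcube n) X x -> inPhi n x -> p < n ->
  Acube n (gd n a p x) = oc_d X a p (Acube n x).
Proof.
move=> hx px lt; rewrite {1}/Acube /gd.
(* The value on [I^n] is that of [x] on [{a}^{n-p} x I^p], whose last endpoint has sign [a] and is
   followed by [p] intervals. *)
have -> : nseq n E01 = nseq (n - p) E01 ++ nseq p E01.
  by rewrite -nseqD subnK // ltnW.
rewrite iter_ldegen iter_lface.
case: n {hx px lt} (hx) (px) (lt) => // n hx px lt; rewrite subSn //.
have e : nseq (n - p).+1 (vert a) ++ nseq p E01 = nseq (n - p) (vert a) ++ vert a :: nseq p E01.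
  by elim: (n - p) => //= j ->.
have Kc : Kcube n.+1 (nseq (n - p).+1 (vert a) ++ nseq p E01).
  rewrite e; apply/Kcube_cat; rewrite !size_nseq !all_nseq !orbT vert_isI orbT; split=> //; lia.
rewrite (inPhi_globe hx px) ?(globeE _ (atom_cl Kc)); last exact: mol_gen.
rewrite e globe_cell_vertex ?all_nseq ?orbT //; last by case: (a).
by rewrite size_nseq /globval /=; congr (oc_d X _ _ _); case: (a).
Qed.

Lemma Acube_globe n (a : X) : (forall b, oc_d X b n a = a) -> Acube n (globe a) = a.
Proof.
move=> h; rewrite /Acube (globeE a (atom_cl (Kcube_top n))) globe_cell_top; exact: h.
Qed.
End Operations.

Theorem theorem4p1 :
  forall X : omega_category,
  (* the functions A are compatible with eps_1 *)
  (forall n (x : cset -> X), hom (Kcube n) X x -> inPhi n x ->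
     Acube n.+1 (ldegen 1 x) = Acube n x) /\
  (* A : gamma lambda X -> X is surjective *)
  (forall a : X, exists n (x : cset -> X), hom (Kcube n) X x /\ inPhi n x /\ Acube n x = a) /\
  (* A is injective *)
  (forall n m (x y : cset -> X), hom (Kcube n) X x -> inPhi n x ->
     hom (Kcube m) X y -> inPhi m y -> Acube n x = Acube m y -> gamma_eq n x m y) /\
  (* A preserves the operations d^a_p *)
  (forall n (x : cset -> X) a p, hom (Kcube n) X x -> inPhi n x -> (p < n)%N ->
     Acube n (gd n a p x) = oc_d X a p (Acube n x)) /\
  (forall n (x : cset -> X) a p, hom (Kcube n) X x -> inPhi n x -> (n <= p)%N ->
     Acube n x = oc_d X a p (Acube n x)) /\
  (* A preserves the compositions #_p *)
  (forall n (x y : cset -> X) p, hom (Kcube n) X x -> inPhi n x ->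
     hom (Kcube n) X y -> inPhi n y -> (p < n)%N ->
     gamma_eq n (gd n true p x) n (gd n false p y) ->
     Acube n (lcomp n (n - p) x y) = oc_comp X p (Acube n x) (Acube n y)) /\
  (forall n (x : cset -> X) p, hom (Kcube n) X x -> inPhi n x -> (n <= p)%N ->
     Acube n x = oc_comp X p (Acube n x) (Acube n x)) /\
  (* naturality in X *)
  (forall (Y : omega_category) (f : X -> Y), omega_functor f ->
     forall n (x : cset -> X), Acube n (fun s => f (x s)) = f (Acube n x)).
Proof.
move=> X.
split; first by move=> n x _ _; rewrite /Acube /ldegen /= del_cl.
split.
  (* With [n] the dimension of [a], the collapse takes the value [d^-_n a = a] on [I^n]. *)
  move=> a; have [n dn] := oc_dim a; exists n, (globe a).
  split; first exact: hom_globe.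
  by split; [exact: globe_inPhi|apply: Acube_globe => b; apply/dn].
split.
  (* At the common level both elements become the collapse determined by their common value. *)
  move=> n m x y hx px hy py e; exists (maxn n m).
  split; [exact: leq_maxl|split; [exact: leq_maxr|]].
  have up k z : hom (Kcube k) X z -> inPhi k z -> k <= maxn n m ->
      agree (maxn n m) (iter (maxn n m - k) (ldegen 1) z) (globe (Acube k z)).
    move=> hz pz le; have := @iter_ldegen_globe X k (maxn n m - k) _ _ (inPhi_globe hz pz)
      (fun b => Acube_d b hz (leqnn k)).
    by rewrite subnKC.
  apply: agree_trans (up _ _ hx px (leq_maxl _ _)) _; rewrite e.
  exact: agree_sym (up _ _ hy py (leq_maxr _ _)).
split; first exact: Acube_gd.
split; first by move=> n x a p hx _ le; rewrite Acube_d.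
split.
  move=> n x y p hx px hy py lt [k [le [_ g]]].
  (* Composability is an equality at some level [k] of the colimit; it descends to [X] by evaluation
     on [I^k], since degeneracies keep the value on the top cube. *)
  have cc : oc_d X true p (Acube n x) = oc_d X false p (Acube n y).
    rewrite -!Acube_gd //.
    have := g (cl_cell (nseq k E01)) (mol_gen (Kcube_top k)).
    have -> : nseq k E01 = nseq (k - n) E01 ++ nseq n E01 by rewrite -nseqD subnK.
    by rewrite !iter_ldegen.
  apply: (lcomp_globe lt cc); try exact: inPhi_globe.
    by move=> b; exact: Acube_d hx (leqnn n).
  by move=> b; exact: Acube_d hy (leqnn n).
split; last by [].
by move=> n x p hx _ le; rewrite -{3}(Acube_d true hx le) oc_unit_r.
Qed.
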